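(* Let $D\ge 2$ be an integer, let $p>1$ and $0<a<b$ be real numbers, and define $$\gamma_{D,p}:=\left[\frac{T(p;B_1^D)}{T(p;B_1^1)}\right]^{-1/p}>0 .$$ Then $$T(p;\Omega_b)\le T(p;\Omega_a)\qquad\text{for all }\Omega_a\in\mathbb{P}^D(a)\text{ and all }\Omega_b\in\mathbb{P}^D(b)$$ if and only if $\gamma_{D,p}\,b\ge a$. If $\gamma_{D,p}\,b>a$, then the inequality is strict, i.e. $T(p;\Omega_b)<T(p;\Omega_a)$ for all such $\Omega_a,\Omega_b$. Moreover, when $\gamma_{D,p}\,b=a$, equality occurs asymptotically for $\Omega_b=B_b^D$: there exists a sequence of domains $\{\omega_n\}_n\subset\mathbb{P}^D(a)$ such that $$\lim_{n\to\infty}T(p;\omega_n)=T(p;B_b^D).$$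
   Context: For an integer $D\ge1$, $\mathbb{P}^D$ is the family of (nonempty) open, bounded, convex subsets of $\mathbb{R}^D$. For $\Omega\in\mathbb{P}^D$, $R_\Omega$ denotes its inradius (the radius of the largest ball inscribed in $\Omega$), and for $r>0$, $\mathbb{P}^D(r):=\{\Omega\in\mathbb{P}^D : R_\Omega=r\}$. $B_r^D$ is the open ball of radius $r$ in $\mathbb{R}^D$ (so $B_1^1$ is an open interval of length $2$). $|\Omega|$ is Lebesgue measure. For $p>1$ and $\Omega\in\mathbb{P}^D$, let $u_p\in W_0^{1,p}(\Omega)$ be the unique (weak) solution of $-\Delta_p u=1$ in $\Omega$, $u=0$ on $\partial\Omega$, where $\Delta_p u=\operatorname{div}(|\nabla u|^{p-2}\nabla u)$. The $p$-torsional rigidity is $T_p(\Omega):=\int_\Omega u_p\,dx$, and the normalized $p$-torsional rigidity is $T(p;\Omega):=|\Omega|^{p-1}T_p(\Omega)^{1-p}$. Equivalently, $$T(p;\Omega)=\inf_{u\in W_0^{1,p}(\Omega)\setminus\{0\}}\frac{\frac1{|\Omega|}\int_\Omega|\nabla u|^p\,dx}{\left(\frac1{|\Omega|}\int_\Omega|u|\,dx\right)^p}.$$ *)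

(* Defs.v *)
From HB Require Import structures.
From mathcomp Require Import all_boot all_order all_algebra.
From mathcomp Require Import all_classical all_reals all_analysis.

Set Implicit Arguments.
Unset Strict Implicit.
Unset Printing Implicit Defensive.

Import Order.TTheory GRing.Theory Num.Theory.
Import numFieldNormedType.Exports.

Local Open Scope classical_set_scope.
Local Open Scope ring_scope.

Section lebesgue_rV_sigma_algebra.
Context (R : realType) (n : nat).

(* The product sigma-algebra of R^n, i.e. its Borel sigma-algebra. *)
Definition rV_measurable : set (set 'rV[R]_n) :=
  g_sigma_preimage (fun (i : 'I_n) (x : 'rV[R]_n) => x ord0 i : measurableTypeR R).

Let rV_set0 : rV_measurable set0.
Proof. exact: sigma_algebra0. Qed.

Let rV_setC A : rV_measurable A -> rV_measurable (~` A).
Proof. exact: sigma_algebraC. Qed.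

Let rV_bigcup (F : (set 'rV[R]_n)^nat) : (forall i, rV_measurable (F i)) ->
  rV_measurable (\bigcup_i F i).
Proof. exact: sigma_algebra_bigcup. Qed.

HB.instance Definition _ := @isMeasurable.Build default_measure_display
  'rV[R]_n rV_measurable rV_set0 rV_setC rV_bigcup.

End lebesgue_rV_sigma_algebra.

Section lebesgue_rV_step.
Local Open Scope ereal_scope.
Context (R : realType) (n : nat).

Definition rV_cons (p : measurableTypeR R * 'rV[R]_n) : 'rV[R]_n.+1 :=
  row_mx (const_mx p.1 : 'rV[R]_1) p.2.

Definition rV_uncons (x : 'rV[R]_n.+1) : measurableTypeR R * 'rV[R]_n :=
  (x ord0 ord0, \row_i x ord0 (lift ord0 i)).

Let rV_cons0 r v : rV_cons (r, v) ord0 ord0 = r.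
Proof.
transitivity (row_mx (const_mx r : 'rV[R]_1) v ord0 (lshift n (ord0 : 'I_1))).
  by congr (row_mx _ _ _ _); exact/val_inj.
by rewrite row_mxEl mxE.
Qed.

Let rV_cons_lift r v i : rV_cons (r, v) ord0 (lift ord0 i) = v ord0 i.
Proof.
transitivity (row_mx (const_mx r : 'rV[R]_1) v ord0 (rshift 1 i)).
  by congr (row_mx _ _ _ _); exact/val_inj.
by rewrite row_mxEr.
Qed.

Lemma rV_consK : cancel rV_cons rV_uncons.
Proof.
move=> [r v]; rewrite /rV_uncons rV_cons0; congr pair.
by apply/rowP => i; rewrite mxE rV_cons_lift.
Qed.

Lemma measurable_coord m (i : 'I_m) :
  measurable_fun [set: 'rV[R]_m] (fun x => x ord0 i : measurableTypeR R).
Proof.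
move=> _ Y mY; rewrite setTI; apply: sub_sigma_algebra => /=.
rewrite -bigcup_seq/=; exists i => /=; first by rewrite mem_index_enum.
by exists Y => //; rewrite setTI.
Qed.

Lemma measurable_rVP d (T : measurableType d) m (f : T -> 'rV[R]_m) :
  (forall i, measurable_fun [set: T] (fun x => f x ord0 i : measurableTypeR R)) ->
  measurable_fun [set: T] f.
Proof.
move=> mf; apply: measurability; first by [].
move=> _ [A + <-]; rewrite -bigcup_seq => -[i _ [B mB <-]].
rewrite setTI preimage_setI preimage_setT setTI.
by rewrite -[X in measurable X]setTI; exact: mf.
Qed.

Lemma measurable_rV_cons : measurable_fun setT rV_cons.
Proof.
apply: measurable_rVP => i; case: (unliftP ord0 i) => [j|] ->.
  rewrite (_ : (fun x => _) = (fun x : 'rV[R]_n => x ord0 j : measurableTypeR R) \o snd).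
    exact: measurableT_comp (measurable_coord j) measurable_snd.
  by apply/funext => -[r v] /=; rewrite rV_cons_lift.
rewrite (_ : (fun x => _) = fst)//.
by apply/funext => -[r v] /=; rewrite rV_cons0.
Qed.

Lemma measurable_rV_uncons : measurable_fun setT rV_uncons.
Proof.
apply/measurable_fun_pairP; split; first exact: measurable_coord.
apply: measurable_rVP => i.
rewrite (_ : (fun x => _) = fun x : 'rV[R]_n.+1 => x ord0 (lift ord0 i)).
  exact: measurable_coord.
by apply/funext => x /=; rewrite mxE.
Qed.

Variable mu : {sigma_finite_measure set 'rV[R]_n -> \bar R}.

Definition lebesgue_rV_step : set 'rV[R]_n.+1 -> \bar R :=
  pushforward (@lebesgue_measure R \x mu) rV_cons.

Let step0 : lebesgue_rV_step set0 = 0.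
Proof. by rewrite /lebesgue_rV_step /pushforward preimage_set0 measure0. Qed.

Let step_ge0 A : 0 <= lebesgue_rV_step A.
Proof. by rewrite /lebesgue_rV_step /pushforward; exact: measure_ge0. Qed.

Let step_sigma_additive : semi_sigma_additive lebesgue_rV_step.
Proof.
move=> F mF tF mUF; rewrite /lebesgue_rV_step /pushforward preimage_bigcup.
apply: measure_semi_sigma_additive.
- by move=> k; rewrite -[X in measurable X]setTI; exact: measurable_rV_cons.
- apply/trivIsetP => /= i j _ _ ij; rewrite -preimage_setI.
  by move/trivIsetP : tF => /(_ _ _ _ _ ij) ->//; rewrite preimage_set0.
- rewrite -preimage_bigcup -[X in measurable X]setTI.
  exact: measurable_rV_cons.
Qed.

HB.instance Definition _ := isMeasure.Build _ _ _ lebesgue_rV_step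
  step0 step_ge0 step_sigma_additive.

Let step_sigma_finite : sigma_finite setT lebesgue_rV_step.
Proof.
have /sigma_finiteP[F [TF ndF Foo]] := sigma_finiteT (@lebesgue_measure R).
have /sigma_finiteP[G [TG ndG Goo]] := sigma_finiteT mu.
exists (fun k => rV_uncons @^-1` (F k `*` G k)).
  rewrite -preimage_bigcup; apply/esym; rewrite -subTset => x _ /=.
  have [i _ Fi] : (\bigcup_i F i) (rV_uncons x).1 by rewrite -TF.
  have [j _ Gj] : (\bigcup_j G j) (rV_uncons x).2 by rewrite -TG.
  exists (maxn i j) => //; split.
    exact: (subsetPset _ _ (ndF _ _ (leq_maxl i j))) Fi.
  exact: (subsetPset _ _ (ndG _ _ (leq_maxr i j))) Gj.
move=> k; have [mF Fk] := Foo k; have [mG Gk] := Goo k; split.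
  rewrite -[X in measurable X]setTI; apply: measurable_rV_uncons => //.
  exact: measurableX.
rewrite /lebesgue_rV_step /pushforward -comp_preimage (_ : _ \o _ = id).
  by rewrite product_measure1E// lte_mul_pinfty// ge0_fin_numE.
by apply/funext => x; exact: rV_consK.
Qed.

HB.instance Definition _ := Measure_isSigmaFinite.Build _ _ _ lebesgue_rV_step
  step_sigma_finite.

End lebesgue_rV_step.

(* Lebesgue measure on R^n, as the n-fold product of [lebesgue_measure]. *)
Fixpoint lebesgue_rV (R : realType) (n : nat) :
    {sigma_finite_measure set 'rV[R]_n -> \bar R} :=
  if n is m.+1 then lebesgue_rV_step (lebesgue_rV R m) else \d_(0 : 'rV[R]_0).

Section torsional_rigidity.
Context (R : realType) (n : nat).
Implicit Types (p r : R) (Omega : set 'rV[R]_n) (x : 'rV[R]_n).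
Implicit Types (u phi : 'rV[R]_n -> R) (g : 'rV[R]_n -> 'rV[R]_n).

Local Notation mu := (lebesgue_rV R n).

(* The norm of the library on row vectors is the sup norm, hence these. *)
Definition dotr (v w : 'rV[R]_n) : R := \sum_(i < n) v ord0 i * w ord0 i.
Definition enorm (v : 'rV[R]_n) : R := Num.sqrt (dotr v v).
Definition eball x r : set 'rV[R]_n := [set y | enorm (y - x) < r].

Definition convex_domain Omega : Prop :=
  [/\ Omega !=set0, open Omega, bounded_set Omega & convex_set Omega].

Definition inradius Omega : R :=
  sup [set r | 0 < r /\ exists x, eball x r `<=` Omega].

Definition convex_domain_inradius r : set (set 'rV[R]_n) :=
  [set Omega | convex_domain Omega /\ inradius Omega = r].

Definition partial (i : 'I_n) phi : 'rV[R]_n -> R :=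
  fun x => 'D_(delta_mx ord0 i) phi x.

Definition grad phi x : 'rV[R]_n := \row_i partial i phi x.

Definition smooth phi : Prop := forall s : seq 'I_n,
  let d_s := foldr partial phi s in
  continuous d_s /\ forall i x, derivable d_s x (delta_mx ord0 i).

(* The space C_c^oo(Omega); its elements are extended by 0 outside Omega. *)
Definition test_fun Omega phi : Prop :=
  let supp := closure [set x | phi x != 0] in
  [/\ smooth phi, compact supp & supp `<=` Omega].

Definition Lp p Omega u : Prop := u \_ Omega \in Lfun mu p%:E.

Definition Lp_cvg p Omega (v : nat -> 'rV[R]_n -> R) u : Prop :=
  ('N[mu]_(p%:E)[EFin \o ((v k \- u)%R \_ Omega)])%E @[k --> \oo] --> 0%E.

(* [u] is in W^{1,p}(Omega), with weak gradient [g]. *)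
Definition sobolev p Omega u g : Prop :=
  [/\ Lp p Omega u,
      forall i, Lp p Omega (fun x => g x ord0 i) &
      forall i phi, test_fun Omega phi ->
        \int[mu]_(x in Omega) (u x * partial i phi x) =
        - \int[mu]_(x in Omega) (g x ord0 i * phi x)].

(* W_0^{1,p}(Omega) is the closure of C_c^oo(Omega) in W^{1,p}(Omega). *)
Definition sobolev0 p Omega u g : Prop :=
  sobolev p Omega u g /\
  exists phi : nat -> 'rV[R]_n -> R,
    [/\ forall k, test_fun Omega (phi k),
        Lp_cvg p Omega phi u &
        forall i, Lp_cvg p Omega (fun k => partial i (phi k))
                                 (fun x => g x ord0 i)].

(* [u] is the weak solution of - Delta_p u = 1 in Omega, u = 0 on its boundary.
   Where [g x = 0] the flux |g|^(p-2) g vanishes, also when [p < 2], because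
   [dotr] does and [0 `^ (p - 2)] is finite. *)
Definition torsion_solution p Omega u : Prop :=
  exists g, sobolev0 p Omega u g /\
    forall phi, test_fun Omega phi ->
      \int[mu]_(x in Omega) (enorm (g x) `^ (p - 2) * dotr (g x) (grad phi x)) =
      \int[mu]_(x in Omega) phi x.

(* The solution is unique up to a null set; any choice gives the same integral. *)
Definition torsion_function p Omega : 'rV[R]_n -> R :=
  xget (cst 0) (torsion_solution p Omega).

Definition torsional_rigidity p Omega : R :=
  \int[mu]_(x in Omega) torsion_function p Omega x.

Definition normalized_torsional_rigidity p Omega : R :=
  fine (mu Omega) `^ (p - 1) * torsional_rigidity p Omega `^ (1 - p).

End torsional_rigidity.

Definition torsion_gamma (R : realType) (D : nat) (p : R) : R :=
  (normalized_torsional_rigidity p (eball (0 : 'rV[R]_D) 1) /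
   normalized_torsional_rigidity p (eball (0 : 'rV[R]_1) 1)) `^ (- p^-1).

(* Main.v *)
(* Put q = p/(p-1). The mean torsion T_p/|Omega| of a convex domain of inradius r
   lies between r^q D^(1-q)/(D+q) and r^q/(1+q). Balls attain the first bound, long
   slabs approach the second, and the normalized rigidity is the (1-p)-th power of
   the mean torsion; so everything reduces to comparing b^q D^(1-q)/(D+q) with
   a^q/(1+q), and gamma^q is the ratio of the two constants.

   For test functions v one has q (int v - 1/p int |grad v|^p) <= T_p, and T_p <= A
   as soon as int v <= A/q + 1/p int |grad v|^p for every v. The lower bounds use
   v = c (1 - J^q) on {J < 1}, J being the maximum of affine functions that cut out
   a polytope close to Omega (smoothed by log-sum-exp), together with the scaling
   |{J <= t}| >= t^k |{J <= 1}|. For the ball, the upper bound is the identity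
   int v = - 1/D int x . grad v and Young's inequality. For a convex domain one
   circumscribes a polytope, cuts it into the cells of points nearest to a given
   face, and integrates grad v along the inner normal of that face; convexity of the
   cells bounds the q-th moment of the lengths of the normals. *)

Require Import Defs.
From HB Require Import structures.
From mathcomp Require Import all_boot all_order all_algebra.
From mathcomp Require Import all_classical all_reals all_analysis.
From mathcomp Require Import measurable_realfun ring lra.

Set Implicit Arguments.
Unset Strict Implicit.
Unset Printing Implicit Defensive.

Import Order.TTheory GRing.Theory Num.Theory.
Import numFieldNormedType.Exports.

Local Open Scope classical_set_scope.
Local Open Scope ring_scope.

(** Since [torsional_rigidity] is read off a function picked by [xget], the two variational
    inequalities require that a weak solution exist. The direct method supplies it in strong form:
    uniform convexity of the p-th power of the norm makes a minimizing sequence of test functions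
    Cauchy in W^{1,p}, and geometrically shrinking steps give almost everywhere convergence of
    values and gradients below one L^p majorant, so that dominated convergence passes to the limit
    even in the nonlinear flux. The profile 1 - J^q is that of the exact solutions: r^q D^(1-q)/q (1
    - (|x|/r)^q) in a ball, a^q/q (1 - (|x_1|/a)^q) in an infinite slab. Sublevel sets of J grow
    like t^D in the first case and like t in the second, hence the exponent k. The constant
    r^q/(1+q) is the mean of l^q for l uniform on [0,r], the law of the lengths of the normals in a
    long slab. Test functions are C^oo with compact support in Omega, so the truncation to {J < 1}
    is smoothed too, with s exp(-eta/s) for the positive part of s; errors of order eta are removed
    by a limit. *)

Section affine_1d.
Local Open Scope ereal_scope.
Context (R : realType).
Notation leb := (@lebesgue_measure R).

Lemma measurable_affine (k c : R) :
  measurable_fun [set: measurableTypeR R]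
    (fun x : measurableTypeR R => (k * x + c)%R : measurableTypeR R).
Proof.
by apply: measurable_funD.
Qed.

(** Uniqueness of Lebesgue measure: k times the pushforward under the affine map gives every
    half-open interval its length. *)
Lemma lebesgue_measure_affine (k c : R) (A : set (measurableTypeR R)) : (0 < k)%R ->
  measurable A -> leb A = k%:E * leb ((fun x => k * x + c)%R @^-1` A).
Proof.
move=> k0 mA.
pose pm := measure_function_pushforward__canonical__measure_function_Measure
  leb (measurable_affine k c).
rewrite (lebesgue_measure_unique (mu := mscale (NngNum (ltW k0)) pm)) //.
move=> X [[a b] /= ab <-]; rewrite /mscale/= /pushforward.
rewrite (_ : _ @^-1` _ = `](a - c) / k, (b - c) / k]%classic)%R; last first.
  apply/seteqP; split=> x /=; rewrite !in_itv/=.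
    by rewrite ltr_pdivrMr// ler_pdivlMr// ltrBlDr lerBrDr mulrC.
  by rewrite ltr_pdivrMr// ler_pdivlMr// ltrBlDr lerBrDr mulrC.
rewrite !lebesgue_measure_itv/= !lte_fin ltr_pM2r ?invr_gt0// ltrD2r.
case: ifP => _; last by rewrite mule0.
rewrite -!EFinD -EFinM -mulrBl; congr EFin.
by field; rewrite gt_eqF.
Qed.

Lemma ge0_integral_affine_1d (k c : R) (f : R -> \bar R) :
  (0 < k)%R -> measurable_fun [set: R] f -> (forall x, 0 <= f x) ->
  \int[leb]_x f (k * x + c)%R = (k^-1)%:E * \int[leb]_x f x.
Proof.
move=> k0 mf f0.
pose pm := measure_function_pushforward__canonical__measure_function_Measure
  leb (measurable_affine k c).
rewrite [in RHS](eq_measure_integral (mscale (NngNum (ltW k0)) pm)); last first.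
  by move=> A mA _; rewrite /mscale/= (lebesgue_measure_affine c k0).
rewrite ge0_integral_mscale//= muleA -EFinM mulVf ?gt_eqF// mul1e.
by rewrite ge0_integral_pushforward//; exact: measurable_affine.
Qed.

End affine_1d.

(** * Lebesgue measure on row vectors: affine maps, Borel sets, boxes *)

Section rV_measure.
Local Open Scope ereal_scope.
Context (R : realType).
Notation leb := (@lebesgue_measure R).

Lemma rV_cons0 n r (v : 'rV[R]_n) : rV_cons (r, v) ord0 ord0 = r.
Proof. exact: (congr1 fst (rV_consK (r, v))). Qed.

Lemma rV_consS n r (v : 'rV[R]_n) i : rV_cons (r, v) ord0 (lift ord0 i) = v ord0 i.
Proof. by have /(congr1 snd)/rowP/(_ i) := rV_consK (r, v); rewrite mxE. Qed.

Lemma rV_consD n (p q : R * 'rV[R]_n) :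
  rV_cons (p.1 + q.1, p.2 + q.2)%R = (rV_cons p + rV_cons q)%R.
Proof.
case: p q => [a v] [b w]; apply/rowP => i.
by case: (unliftP ord0 i) => [j|] ->; rewrite [RHS]mxE ?rV_consS ?rV_cons0 ?mxE.
Qed.

Lemma rV_consZ n k (p : R * 'rV[R]_n) :
  rV_cons (k * p.1, k *: p.2)%R = (k *: rV_cons p)%R.
Proof.
case: p => [a v]; apply/rowP => i.
by case: (unliftP ord0 i) => [j|] ->; rewrite [RHS]mxE ?rV_consS ?rV_cons0 ?mxE.
Qed.

Lemma rV_unconsK n : cancel (@rV_uncons R n) (@rV_cons R n).
Proof.
move=> x; apply/rowP => i.
by case: (unliftP ord0 i) => [j|] ->; rewrite ?rV_consS ?rV_cons0 ?mxE.
Qed.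

Lemma measurable_rV_affine n (k : R) (c : 'rV[R]_n) :
  measurable_fun [set: 'rV[R]_n] (fun x => k *: x + c)%R.
Proof.
apply: measurable_rVP => i.
rewrite (_ : (fun x => _) = (fun r => k * r + c ord0 i)%R \o (fun x : 'rV[R]_n => x ord0 i)).
  exact: (measurableT_comp (measurable_affine _ _) (@measurable_coord _ _ i)).
by apply/funext => x; rewrite /= !mxE.
Qed.

Lemma ge0_integral_rV_cons n (f : 'rV[R]_n.+1 -> \bar R) :
  measurable_fun setT f -> (forall x, 0 <= f x) ->
  \int[lebesgue_rV R n.+1]_x f x =
  \int[leb]_r \int[lebesgue_rV R n]_v f (rV_cons (r, v)).
Proof.
move=> mf f0.
rewrite -(fubini_tonelli1 (f \o @rV_cons R n)).
- by rewrite ge0_integral_pushforward//; exact: measurable_rV_cons.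
- exact: (measurableT_comp mf (@measurable_rV_cons R n)).
- by move=> x; exact: f0.
Qed.

(** Induction on the dimension: Tonelli splits off the first coordinate, whose one-dimensional
    substitution gives one factor 1/k. In dimension 0 the measure is a Dirac mass and all vectors
    coincide. *)
Lemma ge0_integral_rV_affine n (k : R) (c : 'rV[R]_n) (f : 'rV[R]_n -> \bar R) :
  (0 < k)%R -> measurable_fun setT f -> (forall x, 0 <= f x) ->
  \int[lebesgue_rV R n]_x f (k *: x + c)%R
  = (k^-1 ^+ n)%:E * \int[lebesgue_rV R n]_x f x.
Proof.
move=> k0; elim: n c f => [c f mf f0|n IH c f mf f0].
  rewrite expr0 mul1e /= !integral_dirac//=.
    by rewrite diracT !mul1e; congr f; apply/rowP => -[].
  exact: (measurableT_comp mf (measurable_rV_affine k c)).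
rewrite !ge0_integral_rV_cons//; last first.
  exact: (measurableT_comp mf (measurable_rV_affine k c)).
have mfc : measurable_fun setT (f \o @rV_cons R n).
  exact: (measurableT_comp mf (@measurable_rV_cons R n)).
pose F r := \int[lebesgue_rV R n]_v f (rV_cons (r, v)).
have mF : measurable_fun setT F.
  by apply: (measurable_fun_fubini_tonelli_F (f \o @rV_cons R n)) => // x; exact: f0.
have F0 r : 0 <= F r by apply: integral_ge0 => *; exact: f0.
transitivity (\int[leb]_r ((k^-1 ^+ n)%:E * F (k * r + (rV_uncons c).1)%R)).
  apply: eq_integral => r _.
  rewrite /F -(IH (rV_uncons c).2 (fun v => f (rV_cons (k * r + (rV_uncons c).1, v))%R)).
  - apply: eq_integral => v _; congr f.
    by rewrite -{1}(rV_unconsK c) -rV_consZ -rV_consD.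
  - exact: (measurableT_comp mfc (pair1_measurable _)).
  - by move=> x; exact: f0.
rewrite ge0_integralZl//.
- rewrite ge0_integral_affine_1d// muleA -EFinM.
  by rewrite exprS mulrC.
- exact: (measurableT_comp mF (measurable_affine _ _)).
- by rewrite lee_fin exprn_ge0// invr_ge0 ltW.
Qed.

End rV_measure.
Section rV_borel.
Context (R : realType).

Definition rbox n (c : 'rV[R]_n) (r : 'I_n -> R) : set 'rV[R]_n :=
  [set x | forall i, `|x ord0 i - c ord0 i| < r i].

Lemma measurable_rbox n (c : 'rV[R]_n) r : measurable (rbox c r).
Proof.
rewrite (_ : rbox c r = \bigcap_(i in [set: 'I_n])
   ((fun x : 'rV[R]_n => x ord0 i : measurableTypeR R) @^-1`
      `](c ord0 i - r i), (c ord0 i + r i)[)).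
  apply: fin_bigcap_measurable => // i _.
  by rewrite -[X in measurable X]setTI; apply: measurable_coord.
apply/seteqP; split => x /= xr i; first by move=> _; rewrite /= in_itv/= -ltr_distl; exact: xr.
by have /= := xr i Logic.I; rewrite in_itv/= -ltr_distl.
Qed.

Lemma ball_rV n (x : 'rV[R]_n) e : 0 < e -> ball x e = rbox x (fun=> e).
Proof.
move=> e0; apply/seteqP; split => y.
  move=> [_ H] i; have := H ord0 i.
  by rewrite -ball_normE /ball_/= distrC.
move=> H; split=> // i j; rewrite (ord1 i) -ball_normE /ball_/= distrC; exact: H.
Qed.

(** The sigma-algebra is generated by the coordinates, so an open set has to be exhausted by
    countably many boxes: those with rational centre and radius 1/(k+1) that are contained in
    [U]. *)
Lemma open_rV_measurable n (U : set 'rV[R]_n) : open U -> measurable U.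
Proof.
move=> oU.
pose F (qk : 'rV[rat]_n * nat) : set 'rV[R]_n :=
  let B := rbox (map_mx ratr qk.1) (fun=> qk.2.+1%:R^-1) in
  if `[< B `<=` U >] then B else set0.
rewrite (_ : U = \bigcup_i F i).
  apply: countable_bigcupT_measurable => // [[q k]].
  by rewrite /F; case: ifP => // _; exact: measurable_rbox.
apply/seteqP; split => [x Ux|x [[q k] _]]; last first.
  by rewrite /F; case: ifPn => // /asboolP; exact.
have /nbhs_ballP[e /= e0 eU] : nbhs x U by exact: open_nbhs_nbhs.
(* A rational centre within 1/(k+1) of x puts x in the box, and the box within distance 2/(k+1) < e
   of x. *)
have [k] : exists k, 0 + k.+1%:R^-1 < e / 2.
  by apply: ltr_add_invr; rewrite divr_gt0.
rewrite add0r => ke.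
have k0 : 0 < k.+1%:R^-1 :> R by rewrite invr_gt0.
have /choice[q hq] : forall i : 'I_n, exists q : rat,
    `|x ord0 i - ratr q| < k.+1%:R^-1.
  move=> i.
  have [|q] := @rat_in_itvoo R (x ord0 i - k.+1%:R^-1) (x ord0 i + k.+1%:R^-1).
    by rewrite ltrBlDr -addrA ltrDl addr_gt0.
  by rewrite in_itv/= -ltr_distl distrC => ?; exists q.
exists (\row_i q i, k) => //.
rewrite /F /= ifT; first by move=> i; rewrite !mxE.
apply/asboolP => y yB; apply: eU; rewrite ball_rV// => i.
have := yB i; have := hq i; rewrite !mxE => h1 h2.
rewrite (_ : y ord0 i - x ord0 i =
  (y ord0 i - ratr (q i)) - (x ord0 i - ratr (q i))); last by ring.
rewrite (le_lt_trans (ler_normB _ _))// (splitr e) ltrD//.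
  exact: lt_trans h2 ke.
exact: lt_trans h1 ke.
Qed.

Lemma continuous_rV_measurable n (f : 'rV[R]_n -> R) :
  continuous f -> measurable_fun [set: 'rV[R]_n] f.
Proof.
move=> cf; apply: (measurability _ (RGenOpens.measurableE R)).
move=> _ [_ [a [b ->]] <-]; rewrite setTI.
apply: open_rV_measurable; move/continuousP : cf; apply; exact: interval_open.
Qed.

Local Open Scope ereal_scope.

Lemma lebesgue_rV_setX n (A : set (measurableTypeR R)) (B : set 'rV[R]_n) :
  measurable A -> measurable B ->
  lebesgue_rV R n.+1 (@rV_uncons R n @^-1` (A `*` B)) =
  @lebesgue_measure R A * lebesgue_rV R n B.
Proof.
move=> mA mB; rewrite /= /lebesgue_rV_step /pushforward -comp_preimage.
rewrite (_ : _ \o _ = id) ?product_measure1E//.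
by apply/funext => x; exact: rV_consK.
Qed.

Lemma lebesgue_rbox n (c : 'rV[R]_n) r : (forall i, 0 < r i)%R ->
  lebesgue_rV R n (rbox c r) = (\prod_i (2 * r i)%R)%:E.
Proof.
elim: n c r => [c r _|n IH c r r0].
  rewrite big_ord0 /= diracE mem_set//; by move=> [].
rewrite (_ : rbox c r = @rV_uncons R n @^-1`
   (`](c ord0 ord0 - r ord0), (c ord0 ord0 + r ord0)[%classic `*`
    rbox (\row_i c ord0 (lift ord0 i)) (fun i => r (lift ord0 i))))%R.
  rewrite lebesgue_rV_setX//; last exact: measurable_rbox.
  rewrite IH// lebesgue_measure_itv/= lte_fin ifT; last by have := r0 ord0; lra.
  rewrite big_ord_recl EFinM -EFinD; congr (EFin _ * _); ring.
apply/seteqP; split => x /=.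
  move=> H; split; first by have := H ord0; rewrite in_itv/= -ltr_distl.
  by move=> i; rewrite !mxE.
move=> [H1 H2] i; case: (unliftP ord0 i) => [j|] ->.
  by have := H2 j; rewrite !mxE.
by move: H1; rewrite in_itv/= -ltr_distl.
Qed.

Lemma bounded_set_rbox n (A : set 'rV[R]_n) : bounded_set A ->
  exists2 M : R, (0 < M)%R & A `<=` rbox 0%R (fun=> M).
Proof.
move=> [M [_ /(_ (`|M| + 1)%R)]].
have /[swap] /[apply] H : (M < `|M| + 1)%R by rewrite (le_lt_trans (ler_norm _))// ltrDl.
exists (`|M| + 2)%R; first by rewrite ltr_wpDl.
move=> x /H /= xM i; rewrite mxE subr0.
apply: (@le_lt_trans _ _ (`|M| + 1)%R); last by rewrite ltrD2l ltr1n.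
by apply: le_trans xM; rewrite [X in (_ <= X)%R]mx_normrE; apply: (le_bigmax _ (fun ij => `|x ij.1 ij.2|%R) (ord0, i)).
Qed.

Lemma rbox_bounded n (A : set 'rV[R]_n) c r : A `<=` rbox c (fun=> r) -> bounded_set A.
Proof.
move=> Ar; exists (`|c| + `|r|)%R; split; first exact: num_real.
move=> M; rewrite /= => cM x /Ar /= xr; apply: le_trans (ltW cM).
rewrite -(subrK c x) addrC (le_trans (ler_normD _ _))// lerD2l.
rewrite [X in (X <= _)%R]mx_normrE; apply: bigmax_le => // -[i j] _ /=.
by rewrite (ord1 i); have := xr j; rewrite !mxE => /ltW/le_trans; apply; exact: ler_norm.
Qed.

Lemma lebesgue_rV_bounded n (A : set 'rV[R]_n) : measurable A -> bounded_set A ->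
  lebesgue_rV R n A < +oo.
Proof.
move=> mA /bounded_set_rbox[M M0 AM].
apply: (@le_lt_trans _ _ (lebesgue_rV R n (rbox 0%R (fun=> M)))).
  by apply: le_measure; rewrite ?inE//; exact: measurable_rbox.
by rewrite lebesgue_rbox ?ltry.
Qed.

Lemma lebesgue_rV_open_gt0 n (A : set 'rV[R]_n) : open A -> A !=set0 ->
  0 < lebesgue_rV R n A.
Proof.
move=> oA [x Ax].
have /nbhs_ballP[e /= e0 eA] : nbhs x A by exact: open_nbhs_nbhs.
apply: (@lt_le_trans _ _ (lebesgue_rV R n (rbox x (fun=> e)))); last first.
  apply: le_measure; rewrite ?inE; [exact: measurable_rbox|exact: open_rV_measurable|].
  by rewrite -ball_rV.
by rewrite lebesgue_rbox ?lte_fin ?prodr_gt0// => i _; rewrite mulr_gt0.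
Qed.

Lemma lebesgue_rV_affine n (k : R) (c : 'rV[R]_n) (A : set 'rV[R]_n) :
  (0 < k)%R -> measurable A ->
  lebesgue_rV R n ((fun x => k *: x + c)%R @^-1` A) = (k^-1 ^+ n)%:E * lebesgue_rV R n A.
Proof.
move=> k0 mA.
have mA' : measurable ((fun x => k *: x + c)%R @^-1` A).
  by rewrite -[X in measurable X]setTI; exact: measurable_rV_affine.
rewrite -[in LHS](setIT (_ @^-1` _)) -integral_indic// -[in RHS](setIT A) -integral_indic//.
rewrite -(@ge0_integral_rV_affine _ _ _ c (fun x => (\1_A x)%:E))//.
  by apply/measurable_EFinP; exact: measurable_indic.
Qed.

End rV_borel.

(** * Calculus on row vectors *)

Section continuous_arith.
Context (R : realType) (T : topologicalType).
Implicit Types f g : T -> R.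

Lemma continuous_addr f g : continuous f -> continuous g ->
  continuous (fun x => f x + g x).
Proof. by move=> cf cg x; apply: continuousD; [exact: cf|exact: cg]. Qed.

Lemma continuous_mulr f g : continuous f -> continuous g ->
  continuous (fun x => f x * g x).
Proof. by move=> cf cg x; apply: continuousM; [exact: cf|exact: cg]. Qed.

Lemma continuous_oppr f : continuous f -> continuous (fun x => - f x).
Proof. by move=> cf x; apply: continuousN; exact: cf. Qed.

Lemma continuous_const (k : R) : continuous (fun _ : T => k).
Proof. by move=> x; exact: cst_continuous. Qed.

Lemma continuous_sumr (I : Type) (r : seq I) (f : I -> T -> R) :
  (forall i, continuous (f i)) -> continuous (fun x => \sum_(i <- r) f i x).
Proof.
move=> cf; elim: r => [|i r IH].
  by under eq_fun do rewrite big_nil; exact: continuous_const.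
by under eq_fun do rewrite big_cons; exact: continuous_addr.
Qed.

Lemma continuous_compr (h : R -> R) f : continuous h -> continuous f ->
  continuous (fun x => h (f x)).
Proof. by move=> ch cf x; apply: continuous_comp; [exact: cf|exact: ch]. Qed.

End continuous_arith.

Lemma cvg_sumr (R : realType) (T : Type) (F : set_system T) {FF : Filter F}
    (I : Type) (r : seq I) (f : I -> T -> R) (l : I -> R) :
  (forall i, f i x @[x --> F] --> l i) ->
  \sum_(i <- r) f i x @[x --> F] --> \sum_(i <- r) l i.
Proof.
move=> fl; elim: r => [|i r IH].
  rewrite big_nil; under eq_fun do rewrite big_nil; exact: cvg_cst.
rewrite big_cons; under eq_fun do rewrite big_cons; exact: cvgD.
Qed.

Section euclid.
Context (R : realType) (n : nat).
Implicit Types (u v w x y : 'rV[R]_n) (k : R).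

Lemma dotrC v w : dotr v w = dotr w v.
Proof. by apply: eq_bigr => i _; rewrite mulrC. Qed.

Lemma dotrDl u v w : dotr (u + v) w = dotr u w + dotr v w.
Proof. by rewrite -big_split; apply: eq_bigr => i _; rewrite mxE mulrDl. Qed.

Lemma dotrDr u v w : dotr w (u + v) = dotr w u + dotr w v.
Proof. by rewrite dotrC dotrDl !(dotrC w). Qed.

Lemma dotrZl k v w : dotr (k *: v) w = k * dotr v w.
Proof. by rewrite mulr_sumr; apply: eq_bigr => i _; rewrite mxE mulrA. Qed.

Lemma dotrZr k v w : dotr v (k *: w) = k * dotr v w.
Proof. by rewrite dotrC dotrZl dotrC. Qed.

Lemma dotrNl v w : dotr (- v) w = - dotr v w.
Proof. by rewrite -scaleN1r dotrZl mulN1r. Qed.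

Lemma dotrNr v w : dotr v (- w) = - dotr v w.
Proof. by rewrite dotrC dotrNl dotrC. Qed.

Lemma dotrBl u v w : dotr (u - v) w = dotr u w - dotr v w.
Proof. by rewrite dotrDl dotrNl. Qed.

Lemma dotrBr u v w : dotr w (u - v) = dotr w u - dotr w v.
Proof. by rewrite dotrDr dotrNr. Qed.

Lemma dotr0l v : dotr 0 v = 0.
Proof. by rewrite -(scale0r 0) dotrZl mul0r. Qed.

Lemma dotr0r v : dotr v 0 = 0.
Proof. by rewrite dotrC dotr0l. Qed.

Lemma dotr_delta i v : dotr v (delta_mx ord0 i) = v ord0 i.
Proof.
rewrite /dotr (bigD1 i)//= mxE !eqxx mulr1 big1 ?addr0// => j ji.
by rewrite mxE eqxx (negbTE ji) mulr0.
Qed.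

Lemma dotr_ge0 v : 0 <= dotr v v.
Proof. by apply: sumr_ge0 => i _; rewrite -expr2 sqr_ge0. Qed.

Lemma enorm_ge0 v : 0 <= enorm v.
Proof. exact: sqrtr_ge0. Qed.

Lemma sqr_enorm v : enorm v ^+ 2 = dotr v v.
Proof. by rewrite sqr_sqrtr// dotr_ge0. Qed.

Lemma enorm0 : enorm (0 : 'rV[R]_n) = 0.
Proof. by rewrite /enorm dotr0l sqrtr0. Qed.

Lemma enorm_eq0 v : (enorm v == 0) = (v == 0).
Proof.
apply/idP/eqP => [|->]; last by rewrite enorm0.
rewrite sqrtr_eq0 => v0; apply/rowP => i; rewrite mxE.
have /psumr_eq0P H : \sum_(i < n) v ord0 i * v ord0 i = 0.
  by apply/eqP; rewrite eq_le v0 dotr_ge0.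
by apply/eqP; rewrite -sqrf_eq0 expr2 H// => j _; rewrite -expr2 sqr_ge0.
Qed.

Lemma enorm_gt0 v : (0 < enorm v) = (v != 0).
Proof. by rewrite lt_neqAle enorm_ge0 andbT eq_sym enorm_eq0. Qed.

Lemma enormZ k v : enorm (k *: v) = `|k| * enorm v.
Proof.
by rewrite /enorm dotrZl dotrZr mulrA -expr2 sqrtrM ?sqr_ge0// sqrtr_sqr.
Qed.

Lemma enormN v : enorm (- v) = enorm v.
Proof. by rewrite -scaleN1r enormZ normrN1 mul1r. Qed.

Lemma enormB v w : enorm (v - w) = enorm (w - v).
Proof. by rewrite -enormN opprB. Qed.

Lemma cauchy_schwarz v w : `|dotr v w| <= enorm v * enorm w.
Proof.
have [->|w0] := eqVneq w 0; first by rewrite dotr0r normr0 enorm0 mulr0.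
rewrite -(@ler_pXn2r _ 2)// ?nnegrE ?mulr_ge0 ?enorm_ge0//.
rewrite real_normK ?num_real// exprMn !sqr_enorm.
have ww : 0 < dotr w w by rewrite -sqr_enorm exprn_gt0// enorm_gt0.
have := dotr_ge0 (dotr w w *: v - dotr v w *: w).
rewrite !(dotrBl, dotrBr, dotrZl, dotrZr) (dotrC w v).
rewrite (_ : _ - _ = dotr w w * (dotr v v * dotr w w - dotr v w ^+ 2)); last by ring.
by rewrite pmulr_rge0// subr_ge0.
Qed.

Lemma dotr_le v w : dotr v w <= enorm v * enorm w.
Proof. exact: le_trans (ler_norm _) (cauchy_schwarz _ _). Qed.

Lemma enormD v w : enorm (v + w) <= enorm v + enorm w.
Proof.
rewrite -(@ler_pXn2r _ 2)// ?nnegrE ?addr_ge0 ?enorm_ge0//.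
rewrite sqrrD !sqr_enorm !(dotrDl, dotrDr) (dotrC w v).
have := dotr_le v w; lra.
Qed.

Lemma enorm_coord v i : `|v ord0 i| <= enorm v.
Proof.
rewrite -sqrtr_sqr ler_wsqrtr// expr2 /dotr (bigD1 i)//= lerDl.
by apply: sumr_ge0 => j _; rewrite -expr2 sqr_ge0.
Qed.

Lemma enorm_le_sum v : enorm v <= \sum_(i < n) `|v ord0 i|.
Proof.
rewrite -(@ler_pXn2r _ 2)// ?nnegrE ?enorm_ge0 ?sumr_ge0//.
rewrite sqr_enorm expr2 mulr_sumr ler_sum// => i _.
rewrite (le_trans (ler_norm _))// normrM ler_wpM2r// (bigD1 i)//= lerDl.
by rewrite sumr_ge0.
Qed.

Lemma continuous_dotr w : continuous (fun v => dotr v w).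
Proof.
apply: continuous_sumr => i; apply: continuous_mulr; last exact: continuous_const.
exact: coord_continuous.
Qed.

Lemma continuous_enorm : continuous (@enorm R n).
Proof.
apply: continuous_compr; first exact: sqrt_continuous.
by apply: continuous_sumr => i; apply: continuous_mulr; exact: coord_continuous.
Qed.

Lemma open_eball x r : open (eball x r).
Proof.
rewrite (_ : eball x r = (fun y => enorm (y - x)) @^-1` [set s | s < r])//.
apply: open_comp; last exact: open_lt.
have c : continuous (fun y : 'rV[R]_n => y - x).
  by move=> z; apply: continuousB; [move=> A|exact: cst_continuous].
by move=> y _; exact: (continuous_comp (c y) (@continuous_enorm _)).
Qed.

Lemma bounded_eball x r : bounded_set (eball x r).
Proof.
apply: (@rbox_bounded _ _ _ x r) => y xy i.
by have := enorm_coord (y - x) i; rewrite !mxE => /le_lt_trans; apply.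
Qed.

End euclid.

Section line_derivative.
Context (R : realType) (n : nat).
Implicit Types (f : 'rV[R]_n -> R) (x v : 'rV[R]_n).

(** Turns a directional derivative into an ordinary one along the line, so that the mean value
    theorem, the chain rule and the fundamental theorem of calculus for real functions apply. *)
Lemma is_derive_line f x v (a : R) :
  is_derive x v f a <-> is_derive (0 : R) (1 : R) (fun t => f (x + t *: v)) a.
Proof.
have E : (fun h : R => h^-1 *: ((f \o shift x) (h *: v) - f x)) =
  (fun h : R => h^-1 *: (((fun t : R => f (x + t *: v)) \o shift 0) (h *: (1 : R)) -
    f (x + 0 *: v))).
  apply/funext => h; rewrite /= scale0r !addr0; congr (_ *: (f _ - _)).
  by rewrite addrC (_ : h *: (1 : R) = h)//; exact: mulr1.
split=> -[d1 d2]; split; first by rewrite /derivable -E.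
- by rewrite -d2 /derive -E.
- by rewrite /derivable E.
- by rewrite -d2 /derive -E.
Qed.

Lemma is_derive_shift1 (g : R -> R) (t a : R) :
  is_derive (0 : R) (1 : R) (fun s => g (t + s)) a <-> is_derive t 1 g a.
Proof.
have E : (fun h : R => h^-1 *: ((g \o shift t) (h *: (1 : R)) - g t)) =
  (fun h : R => h^-1 *: (((fun s : R => g (t + s)) \o shift 0) (h *: (1 : R)) -
    g (t + 0))).
  by apply/funext => h; rewrite /= !addr0 (addrC t).
split=> -[d1 d2]; split.
- by rewrite /derivable E.
- by rewrite -d2 /derive -E.
- by rewrite /derivable -E.
- by rewrite -d2 /derive -E.
Qed.

Lemma is_derive_line_at f x v (t a : R) :
  is_derive (x + t *: v) v f a <-> is_derive t 1 (fun s => f (x + s *: v)) a.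
Proof.
rewrite is_derive_line -(is_derive_shift1 (fun s => f (x + s *: v))).
by under eq_fun do rewrite -addrA -scalerDl.
Qed.

End line_derivative.
Section C1.
Context (R : realType) (n : nat).
Implicit Types (f g : 'rV[R]_n -> R) (x y e : 'rV[R]_n).
Local Notation d_ := (delta_mx ord0 : 'I_n -> 'rV[R]_n).

(** The first-order content of [smooth], in terms of partial derivatives; derivatives in arbitrary
    directions are recovered in [is_derive_C1]. *)
Definition C1 f := [/\ continuous f, forall i, continuous (partial i f) &
  forall i x, derivable f x (d_ i)].

Lemma is_derive_affine (a b t : R) : is_derive t (1 : R) (fun t => a + t * b) b.
Proof.
have := is_deriveD (is_derive_cst a t (1 : R))
  (is_deriveM (is_derive_id t (1 : R)) (is_derive_cst b t (1 : R))).
by rewrite scaler0 !add0r /GRing.scale/= mulr1.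
Qed.

Lemma is_derive_partial f x i : derivable f x (d_ i) ->
  is_derive x (d_ i) f (partial i f x).
Proof. by move=> df; split. Qed.

Lemma mvt_coord f y i (s : R) : (forall x, derivable f x (d_ i)) ->
  exists2 t, `|t| <= `|s| & f (y + s *: d_ i) - f y = partial i f (y + t *: d_ i) * s.
Proof.
move=> df; pose g t := f (y + t *: d_ i).
have dg (t : R) : is_derive t (1 : R) g (partial i f (y + t *: d_ i)).
  by apply/is_derive_line_at; exact: is_derive_partial.
have cg a b : {within `[a, b], continuous g}.
  by apply: derivable_within_continuous => t _; have [] := dg t.
have -> : f y = g 0 by rewrite /g scale0r addr0.
have [s0|/ltW s0] := lerP 0 s.
  have [t] := MVT_segment s0 (fun t _ => dg t) (cg _ _).
  rewrite in_itv/= => /andP[t0 ts] H; exists t; first by rewrite !ger0_norm.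
  by rewrite -[f _]/(g s) H subr0.
have [t] := MVT_segment s0 (fun t _ => dg t) (cg _ _).
rewrite in_itv/= => /andP[t0 ts] H; exists t; first by rewrite !ler0_norm// lerN2.
by rewrite -[f _]/(g s) -opprB H sub0r mulrN opprK.
Qed.

(** The move from x to x + h e is split into moves along the coordinate axes. The mean value theorem
    applies to each of them, and continuity of the partial derivatives brings the mean value points
    back to x. *)
Lemma is_derive_C1 f x e : C1 f -> is_derive x e f (dotr (grad f x) e).
Proof.
move=> [cf cdf df].
(* The points x + h [P k] are the corners of the broken path. *)
pose P (k : nat) : 'rV[R]_n := \row_i (if (i < k)%N then e ord0 i else 0).
have P0 : P 0%N = 0 by apply/rowP => i; rewrite !mxE.
have Pn : P n = e by apply/rowP => i; rewrite !mxE ltn_ord.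
have PS (k : 'I_n) : P k.+1 = P k + e ord0 k *: d_ k.
  apply/rowP => i; rewrite !mxE eqxx/=.
  have [->|ik] := eqVneq i k; first by rewrite ltnSn ltnn mulr1 add0r.
  have ik' : (i < k.+1)%N = (i < k)%N.
    by move: ik; rewrite -val_eqE ltnS leq_eqVlt /= => /negbTE ->.
  by rewrite ik' mulr0 addr0.
suff : h^-1 *: (f (h *: e + x) - f x) @[h --> (0 : R)^'] --> dotr (grad f x) e.
  by move=> H; split; [apply/cvg_ex; eexists; exact: H|exact/cvg_lim].
have E : (fun h : R => h^-1 *: (f (h *: e + x) - f x)) =
  (fun h => \sum_(k < n) h^-1 * (f (x + h *: P k.+1) - f (x + h *: P k))).
  apply/funext => h; rewrite -mulr_sumr; congr (_ * _).
  rewrite -(big_mkord xpredT (fun k => f (x + h *: P k.+1) - f (x + h *: P k))).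
  by rewrite telescope_sumr// Pn P0 scaler0 addr0 (addrC x).
rewrite E /dotr; apply: (@cvg_sumr _ _ (0^') _) => k; rewrite mxE.
apply/cvgrPdist_lt => eps eps0.
have := cdf k x; move/cvgrPdist_lt.
have eps'0 : 0 < eps / (1 + `|e ord0 k|) by rewrite divr_gt0// ltr_pwDl.
move=> /(_ _ eps'0) /nbhs_ballP[r /= r0 rball].
(* The mean value point on the k-th edge is within |h| [M] of x; the summand 1 keeps [M]
   positive. *)
pose M := `|P k| + `|e ord0 k| * `|d_ k| + 1.
have M0 : 0 < M by rewrite ltr_wpDl// addr_ge0// mulr_ge0.
exists (r / M); first by rewrite /= divr_gt0.
move=> h /=; rewrite sub0r normrN => hr h0.
rewrite PS scalerDr addrA scalerA.
have [t th ->] := mvt_coord (x + h *: P k) (h * e ord0 k) (df k).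
set D := partial k f (_ + t *: _).
rewrite (_ : h^-1 * (D * (h * e ord0 k)) = D * e ord0 k); last by field.
rewrite -mulrBl normrM {}/D.
apply: (@le_lt_trans _ _ (eps / (1 + `|e ord0 k|) * `|e ord0 k|)).
  rewrite ler_wpM2r//; apply/ltW/rball; rewrite -ball_normE /ball_/=.
  rewrite -addrA opprD addrA subrr add0r normrN.
  rewrite (le_lt_trans (ler_normD _ _))// !normrZ.
  move: hr; rewrite ltr_pdivlMr//; apply: le_lt_trans.
  rewrite /M !mulrDr mulr1 -addrA lerD2l (@le_trans _ _ (`|h| * (`|e ord0 k| * `|d_ k|)))//.
    by rewrite mulrA -normrM ler_wpM2r.
  by rewrite lerDl.
rewrite mulrAC ltr_pdivrMr ?ltr_pwDl// ltr_pM2l//.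
by rewrite ltrDr.
Qed.

Lemma partialD f g k i x : derivable f x (d_ i) -> derivable g x (d_ i) ->
  partial i (fun x => f x + k * g x) x = partial i f x + k * partial i g x.
Proof.
move=> df dg.
have [_] : is_derive x (d_ i) (fun x => f x + k * g x) (partial i f x + k * partial i g x).
  by apply: is_deriveD; [exact: is_derive_partial|exact/is_deriveZ/is_derive_partial].
by [].
Qed.

Lemma is_derive_mul f g x e a b : is_derive x e f a -> is_derive x e g b ->
  is_derive x e (fun x => f x * g x) (f x * b + g x * a).
Proof. by move=> df dg; exact: is_deriveM. Qed.

Lemma C1M f g : C1 f -> C1 g -> C1 (fun x => f x * g x).
Proof.
move=> [cf cdf df] [cg cdg dg].
have D i x : is_derive x (d_ i) (fun x => f x * g x) (f x * partial i g x + g x * partial i f x).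
  by apply: is_derive_mul; exact: is_derive_partial.
split => [|i|i x].
- exact: continuous_mulr.
- rewrite (_ : partial i _ = (fun x => f x * partial i g x + g x * partial i f x)).
    by apply: continuous_addr; exact: continuous_mulr.
  by apply/funext => y; have [_] := D i y.
- by have [] := D i x.
Qed.

Lemma C1_coord j : C1 (fun x => x ord0 j).
Proof.
have D i x : is_derive x (d_ i) (fun x => x ord0 j) (d_ i ord0 j).
  apply/is_derive_line.
  rewrite (_ : (fun t : R => (x + t *: d_ i) ord0 j) =
    (fun t => x ord0 j + t * d_ i ord0 j)); last by apply/funext => t; rewrite !mxE.
  exact: is_derive_affine.
split => [|i|i x].
- exact: coord_continuous.
- rewrite (_ : partial i _ = cst (d_ i ord0 j)); first exact: continuous_const.
  by apply/funext => y; have [_] := D i y.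
- by have [] := D i x.
Qed.

Lemma smooth_C1 f : smooth f -> C1 f.
Proof.
move=> sf; have [cf df] := sf [::]; split => // i.
by have [+ _] := sf [:: i].
Qed.

Lemma smoothD f g k : smooth f -> smooth g -> smooth (fun x => f x + k * g x).
Proof.
move=> sf sg s.
have E : foldr (@partial R n) (fun x => f x + k * g x) s =
   (fun x => foldr (@partial R n) f s x + k * foldr (@partial R n) g s x).
  elim: s => [//|i s IH] /=; rewrite IH; apply/funext => x.
  by apply: partialD; [have [_] := sf s|have [_] := sg s].
have [cf df] := sf s; have [cg dg] := sg s.
rewrite /= E; split => [|i x].
  by apply: continuous_addr => //; apply: continuous_mulr => //; exact: continuous_const.
by apply: derivableD; [exact: df|exact: derivableZ (dg _ _)].
Qed.

Lemma gradD f g k x : C1 f -> C1 g ->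
  grad (fun x => f x + k * g x) x = grad f x + k *: grad g x.
Proof.
move=> [_ _ df] [_ _ dg]; apply/rowP => i; rewrite !mxE.
exact: partialD.
Qed.

End C1.

Section integration.
Context (R : realType) (n : nat).
Implicit Types (A Omega : set 'rV[R]_n) (f g phi : 'rV[R]_n -> R).
Local Notation mu := (lebesgue_rV R n).
Local Notation d_ := (delta_mx ord0 : 'I_n -> 'rV[R]_n).

Lemma continuous_bounded f A : continuous f -> bounded_set A ->
  exists2 M : R, 0 < M & forall x, A x -> `|f x| <= M.
Proof.
move=> cf /bounded_set_rbox[M M0 AM].
have [|||c _ cM] := @EVT_max_rV _ n (fun x => `|f x|)
    [set x | forall i, `[- M, M]%classic (x ord0 i)].
- by exists 0 => i /=; rewrite mxE in_itv/=; lra.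
- exact: (@rV_compact R n (fun=> `[- M, M]%classic) (fun=> @segment_compact _ _ _)).
- by apply: continuous_subspaceT; apply: continuous_compr => //; exact: norm_continuous.
exists (`|f c| + 1); first by rewrite ltr_wpDl.
move=> x /AM xM; apply: (@le_trans _ _ `|f c|); last by rewrite lerDl.
apply: cM; rewrite inE /= => i; rewrite in_itv/=.
by have := xM i; rewrite mxE subr0 ltr_norml => /andP[? ?]; rewrite !ltW.
Qed.

Lemma continuous_integrable f A : measurable A -> bounded_set A -> continuous f ->
  mu.-integrable A (EFin \o f).
Proof.
move=> mA bA cf; apply: measurable_bounded_integrable => //.
- exact: lebesgue_rV_bounded.
- by apply: measurable_funS (continuous_rV_measurable cf).
- have [M M0 fM] := continuous_bounded cf bA.
  exists M; split; first exact: num_real.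
  by move=> K MK x Ax /=; exact: le_trans (fM x Ax) (ltW MK).
Qed.

Lemma Rintegral_setT f A : measurable A -> (forall x, ~ A x -> f x = 0) ->
  \int[mu]_x f x = \int[mu]_(x in A) f x.
Proof.
move=> mA f0; rewrite [RHS]Rintegral_mkcond; apply: eq_Rintegral => x _.
rewrite patchE; case: ifPn => // /negP xA; apply: f0; apply: contra_not xA.
by move=> ?; rewrite inE.
Qed.

Lemma integrable_setT f A : measurable A -> (forall x, ~ A x -> f x = 0) ->
  mu.-integrable A (EFin \o f) -> mu.-integrable setT (EFin \o f).
Proof.
move=> mA f0; move/(integrable_mkcond _ mA); congr (integrable _ _ _).
apply/funext => x; rewrite patchE/=; case: ifPn => // /negP xA; rewrite f0//.
by apply: contra_not xA => ?; rewrite inE.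
Qed.

Lemma integral_rV_shift (c : 'rV[R]_n) (f : 'rV[R]_n -> \bar R) :
  measurable_fun setT f -> mu.-integrable setT f ->
  (\int[mu]_x f (x + c)%R = \int[mu]_x f x)%E.
Proof.
move=> mf fi.
have ge0shift (h : 'rV[R]_n -> \bar R) : measurable_fun setT h -> (forall x, 0 <= h x)%E ->
    (\int[mu]_x h (x + c)%R = \int[mu]_x h x)%E.
  move=> mh h0; have := @ge0_integral_rV_affine _ _ 1 c h ltr01 mh h0.
  by rewrite invr1 expr1n mul1e => <-; apply: eq_integral => x _; rewrite scale1r.
rewrite integralE [RHS]integralE; congr (_ - _)%E.
- rewrite -(ge0shift f^\+%E)//; last exact: measurable_funepos.
  by apply: eq_integral => x _; rewrite !funeposE.
- rewrite -(ge0shift f^\-%E)//; last exact: measurable_funeneg.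
  by apply: eq_integral => x _; rewrite !funenegE.
Qed.

Lemma Rintegral_rV_shift (c : 'rV[R]_n) f : mu.-integrable setT (EFin \o f) ->
  \int[mu]_x f (x + c) = \int[mu]_x f x.
Proof.
move=> fi; rewrite /Rintegral -(@integral_rV_shift c (EFin \o f))//.
by case/integrableP : fi.
Qed.

Lemma cvg_harmonic_dnbhs (g : R -> R) (l : R) : g h @[h --> (0 : R)^'] --> l ->
  g k.+1%:R^-1 @[k --> \oo] --> l.
Proof.
move=> gl; move/cvgr_dnbhsP : gl => /(_ (fun k => k.+1%:R^-1)); apply; split.
  by move=> k; rewrite invr_eq0 pnatr_eq0.
exact: cvg_harmonic.
Qed.

(** Difference quotients of f have integral zero by translation invariance, and they converge to the
    partial derivative under a bounded majorant with bounded support. *)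
Lemma Rintegral_partial i f A : measurable A -> bounded_set A -> C1 f ->
  (forall x, ~ A x -> f x = 0) -> (forall x, ~ A x -> partial i f x = 0) ->
  \int[mu]_(x in A) partial i f x = 0.
Proof.
move=> mA bA [cf cdf df] f0 df0.
rewrite -Rintegral_setT//.
have fi : mu.-integrable setT (EFin \o f).
  by apply: (@integrable_setT _ A) => //; exact: continuous_integrable.
have [M M0 AM] := bounded_set_rbox bA.
pose B r : set 'rV[R]_n := rbox 0 (fun=> r).
have bB r : bounded_set (B r) by exact: (@rbox_bounded _ _ _ 0 r).
have mB r : measurable (B r) by exact: measurable_rbox.
(* The increments [q k] are at most 1: a difference quotient can be nonzero only in the box of
   radius M + 1, and its mean value point then lies in the box of radius M + 2. *)
have [K K0 dfK] := continuous_bounded (cdf i) (bB (M + 2)).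
pose q (k : nat) : R := k.+1%:R^-1.
have q0 k : 0 < q k by rewrite invr_gt0.
have q1 k : q k <= 1 by rewrite invf_le1// ler1n.
have d_1 (j : 'I_n) : `|d_ i ord0 j| <= 1.
  by rewrite mxE; case: (_ && _); rewrite ?normr1 ?normr0.
have shiftB (r s t : R) x : B r (x + t *: d_ i) -> `|t| <= s -> B (r + s) x.
  move=> rx ts j; have := rx j; rewrite !mxE !subr0 => xr.
  have := ler_normB (x ord0 j + t * d_ i ord0 j) (t * d_ i ord0 j).
  rewrite addrK !mxE => /le_lt_trans; apply.
  apply: ltr_leD => //; rewrite normrM (le_trans _ ts)// ler_piMr//.
  by have := d_1 j; rewrite mxE.
pose F k (x : 'rV[R]_n) : \bar R := ((q k)^-1 * (f (x + q k *: d_ i) - f x))%:E.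
have cF k : continuous (fun x : 'rV[R]_n => (q k)^-1 * (f (x + q k *: d_ i) - f x)).
  apply: continuous_mulr; first exact: continuous_const.
  apply: continuous_addr; last by move=> x; apply: continuousN; exact: cf.
  move=> x; apply: continuous_comp; last exact: cf.
  by apply: continuousD; [move=> ?|exact: cst_continuous].
have fq0 k x : ~ B (M + 1) x -> f (x + q k *: d_ i) = 0.
  move=> Bx; apply: f0 => /AM xM; apply: Bx; apply: shiftB xM _.
  by rewrite ger0_norm// ltW.
have fB0 x : ~ B (M + 1) x -> f x = 0.
  move=> Bx; apply: f0 => /AM xM; apply: Bx => j; apply: lt_le_trans (xM j) _.
  by rewrite lerDl.
have fqi k : mu.-integrable setT (EFin \o (fun x => f (x + q k *: d_ i))).
  apply: (@integrable_setT _ (B (M + 1))) => //; first exact: fq0.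
  apply: continuous_integrable => // x; apply: continuous_comp; last exact: cf.
  by apply: continuousD; [move=> ?|exact: cst_continuous].
have bdi : mu.-integrable setT (EFin \o ((fun=> K) \_ (B (M + 1)))).
  apply: (@integrable_setT _ (B (M + 1))) => //.
    by move=> x xB; rewrite patchE ifF//; apply/negP; rewrite inE.
  apply: (eq_integrable _ (EFin \o cst K)) => //.
    by move=> x xB; rewrite /= patchE xB.
  apply: continuous_integrable => //; exact: continuous_const.
have [] := @dominated_convergence _ _ _ mu setT measurableT F (EFin \o partial i f)
  (EFin \o ((fun=> K) \_ (B (M + 1)))).
- by move=> k; apply/measurable_EFinP; exact: continuous_rV_measurable.
- by apply/measurable_EFinP; exact: continuous_rV_measurable.
- apply/aeW => x _; apply/fine_cvgP; split; first by near=> k.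
  have [dfx _] := is_derive_partial (df i x).
  have := dfx; rewrite /derivable => /cvg_harmonic_dnbhs.
  rewrite -/(derive f x (d_ i)); apply: cvg_trans; apply: near_eq_cvg; near=> k.
  by rewrite /= (addrC _ x).
- exact: bdi.
- apply/aeW => x k _; rewrite /= lee_fin patchE; case: ifPn => xB; last first.
    have {}xB : ~ B (M + 1) x by move=> ?; move/negP : xB; apply; rewrite inE.
    by rewrite fq0// fB0// subrr mulr0 normr0.
  have [t tq ->] := mvt_coord x (q k) (df i).
  rewrite mulrCA mulVf ?mulr1 ?gt_eqF//; apply: dfK.
  rewrite (_ : M + 2 = M + 1 + 1); last by ring.
  apply: (@shiftB _ 1 (- t)); last by rewrite normrN (le_trans tq)// ger0_norm// ltW.
  by rewrite scaleNr addrK; move: xB; rewrite inE.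
move=> dfi _; have -> : [sequence (\int[mu]_x F k x)%E]_k = cst 0%E.
  apply/funext => k; rewrite /= /F.
  have qfi : mu.-integrable setT (EFin \o (fun x => f (x + q k *: d_ i) - f x)).
    exact: (integrableB measurableT (fqi k) fi).
  under eq_integral do rewrite EFinM.
  rewrite integralZl// -(fineK (integrable_fin_num _ qfi))//.
  rewrite -[fine _]/(Rintegral _ _ _) RintegralB//.
  by rewrite Rintegral_rV_shift// subrr mule0.
move=> /(cvg_lim (@ereal_hausdorff R)); rewrite lim_cst//= /Rintegral.
by move=> <-.
Unshelve. all: by end_near.
Qed.

End integration.

(** * Tonelli's theorem along the lines of a fixed direction *)

Section flow.
Local Open Scope ereal_scope.
Context (R : realType) (n : nat).
Local Notation mu := (lebesgue_rV R n).
Local Notation leb := (@lebesgue_measure R).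
Implicit Types (A : set 'rV[R]_n) (e x y : 'rV[R]_n).

Lemma ge0_integral_rV_shift e (h : 'rV[R]_n -> \bar R) :
  measurable_fun setT h -> (forall x, 0 <= h x) ->
  \int[mu]_x h (x + e)%R = \int[mu]_x h x.
Proof.
move=> mh h0; have := @ge0_integral_rV_affine _ _ 1 e h ltr01 mh h0.
by rewrite invr1 expr1n mul1e => <-; apply: eq_integral => x _; rewrite scale1r.
Qed.

Lemma measurable_flow (k : R) e :
  measurable_fun [set: 'rV[R]_n * measurableTypeR R] (fun z => z.1 + (k * z.2) *: e)%R.
Proof.
apply: measurable_rVP => i.
apply: (@eq_measurable_fun _ _ _ _ _ (fun z : 'rV[R]_n * measurableTypeR R =>
   z.1 ord0 i + k * z.2 * e ord0 i)%R); first by move=> x _; rewrite !mxE.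
apply: measurable_funD; first exact: (measurableT_comp (@measurable_coord R n i) measurable_fst).
by apply: measurable_funM => //; apply: measurable_funM.
Qed.

Lemma measurable_flow_section e A y : measurable A ->
  measurable [set t : measurableTypeR R | A (y + t *: e)%R].
Proof.
move=> mA; rewrite -[X in measurable X]setTI.
have : measurable_fun [set: measurableTypeR R] (fun t => y + t *: e)%R.
  have := measurableT_comp (measurable_flow 1 e) (pair1_measurable y).
  by apply: eq_measurable_fun => t _ /=; rewrite mul1r.
exact.
Qed.

Lemma measurable_flow_length e A (T : set (measurableTypeR R)) :
  measurable A -> measurable T ->
  measurable_fun [set: 'rV[R]_n] (fun y => leb (T `&` [set t : R | A (y + t *: e)%R])).
Proof.
move=> mA mT.
pose B : set ('rV[R]_n * measurableTypeR R) :=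
  (snd @^-1` T) `&` ((fun z => z.1 + z.2 *: e)%R @^-1` A).
have mB : measurable B.
  apply: measurableI; first by rewrite -[X in measurable X]setTI; exact: measurable_snd.
  rewrite -[X in measurable X]setTI.
  have : measurable_fun [set: 'rV[R]_n * measurableTypeR R] (fun z => z.1 + z.2 *: e)%R.
    by apply: eq_measurable_fun (measurable_flow 1 e) => t _ /=; rewrite mul1r.
  exact.
apply: eq_measurable_fun (measurable_fun_xsection leb mB) => y _ /=.
congr (leb _); apply/seteqP; split => t /=.
  by rewrite /xsection/= inE.
by rewrite /xsection/= inE.
Qed.

Lemma measurable_flow_integrand e A (T : set (measurableTypeR R)) (G : 'rV[R]_n -> R) :
  measurable A -> measurable T -> measurable_fun setT G ->
  measurable_fun [set: 'rV[R]_n * measurableTypeR R]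
    (fun z => (\1_A z.1 * \1_T z.2 * G (z.1 - z.2 *: e))%R%:E).
Proof.
move=> mA mT mG; apply/measurable_EFinP; apply: measurable_funM.
  apply: measurable_funM; first exact: (measurableT_comp (measurable_indic mA) measurable_fst).
  exact: (measurableT_comp (measurable_indic mT) measurable_snd).
have := measurableT_comp mG (measurable_flow (-1)%R e).
by apply: eq_measurable_fun => z _ /=; rewrite mulN1r scaleNr.
Qed.

Lemma measurable_flow_integral e A (T : set (measurableTypeR R)) (G : 'rV[R]_n -> R) :
  measurable A -> measurable T -> measurable_fun setT G -> (forall x, 0 <= G x)%R ->
  measurable_fun [set: 'rV[R]_n]
    (fun x => \int[leb]_t (\1_A x * \1_T t * G (x - t *: e))%R%:E).
Proof.
move=> mA mT mG G0.
apply: (measurable_fun_fubini_tonelli_F (m2 := leb) _ (measurable_flow_integrand e mA mT mG)).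
by move=> z; rewrite lee_fin !mulr_ge0.
Qed.

(* Fubini for the flow along e: replaces a rotation of coordinates. *)
Lemma tonelli_flow e A (T : set (measurableTypeR R)) (G : 'rV[R]_n -> R) :
  measurable A -> measurable T -> measurable_fun setT G -> (forall x, 0 <= G x)%R ->
  \int[mu]_x \int[leb]_t (\1_A x * \1_T t * G (x - t *: e))%R%:E =
  \int[mu]_y ((G y)%:E * leb (T `&` [set t : R | A (y + t *: e)%R])).
Proof.
move=> mA mT mG G0.
have mfl k (H : 'rV[R]_n -> R) : measurable_fun setT H ->
    measurable_fun [set: 'rV[R]_n * measurableTypeR R] (fun z => H (z.1 + (k * z.2) *: e)%R).
  by move=> mH; exact: (measurableT_comp mH (measurable_flow k e)).
have mT2 : measurable_fun [set: 'rV[R]_n * measurableTypeR R] (fun z => \1_T z.2 : R).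
  exact: (measurableT_comp (measurable_indic mT) measurable_snd).
pose f (z : 'rV[R]_n * measurableTypeR R) := (\1_A z.1 * \1_T z.2 * G (z.1 - z.2 *: e)%R)%:E.
pose g (z : 'rV[R]_n * measurableTypeR R) := (\1_A (z.1 + z.2 *: e)%R * \1_T z.2 * G z.1)%:E.
have mf : measurable_fun setT f.
  exact: measurable_flow_integrand.
have mg : measurable_fun setT g.
  apply/measurable_EFinP; apply: measurable_funM; last exact: (measurableT_comp mG measurable_fst).
  apply: measurable_funM => //.
  by have := mfl 1%R (\1_A) (measurable_indic mA); under eq_fun do rewrite mul1r.
have f0 z : 0 <= f z by rewrite lee_fin !mulr_ge0.
have g0 z : 0 <= g z by rewrite lee_fin !mulr_ge0.
rewrite (fubini_tonelli (m1 := mu) (m2 := leb) f mf f0).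
transitivity (\int[leb]_t \int[mu]_y g (y, t)).
  apply: eq_integral => t _.
  rewrite -(@ge0_integral_rV_shift (t *: e) (fun x => f (x, t))) //.
    by apply: eq_integral => y _; rewrite /f /g /= addrK.
  exact: (measurableT_comp mf (pair2_measurable _)).
rewrite -(fubini_tonelli (m1 := mu) (m2 := leb) g mg g0).
apply: eq_integral => y _; rewrite /g/=.
pose Ay := [set t : measurableTypeR R | A (y + t *: e)%R].
have mAy : measurable Ay by exact: measurable_flow_section.
have Ay1 t : \1_A (y + t *: e)%R = \1_Ay t :> R by [].
under eq_integral do rewrite Ay1 EFinM muleC.
rewrite ge0_integralZl//; last 2 first.
- apply/measurable_EFinP.
  by apply: measurable_funM; exact: measurable_indic.
- by rewrite lee_fin.
congr (_ * _).
rewrite -[in RHS](setIT (_ `&` _)) -integral_indic//; last exact: measurableI.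
by apply: eq_integral => t _; rewrite indicI/= mulrC.
Qed.

End flow.

(** * Inequalities and continuity for real powers *)

Section powers.
Context (R : realType) (p : R) (p1 : 1 < p).
Implicit Types a b m : R.

Let p0 : 0 < p. Proof. exact: lt_trans p1. Qed.

(** Young's inequality for the conjugate exponents p/(p-1) and p, with a^(p-1) as first factor: the
    shape in which the flux |g|^(p-2) g meets a gradient. *)
Lemma young_powR a b : 0 <= a -> 0 <= b ->
  a `^ (p - 1) * b <= (1 - p^-1) * a `^ p + p^-1 * b `^ p.
Proof.
move=> a0 b0; have q0 : 0 < p / (p - 1) by rewrite divr_gt0// subr_gt0.
have p_neq0 : p != 0 by rewrite gt_eqF.
have pm_neq0 : p - 1 != 0 by rewrite gt_eqF// subr_gt0.
have := @conjugate_powR _ (a `^ (p - 1)) b _ p (powR_ge0 _ _) b0 q0 p0.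
rewrite -powRrM mulrCA mulfV// mulr1 => H; apply: le_trans (H _) _.
  by field; rewrite p_neq0.
rewrite lerD// mulrC; last by rewrite mulrC.
by rewrite ler_wpM2r ?powR_ge0// le_eqVlt; apply/orP; left; apply/eqP; field; rewrite p_neq0.
Qed.

(** Convexity of t^p as a tangent line at m. It is Young's inequality rearranged, which covers m = 0
    as well. *)
Lemma tangent_powR a m : 0 <= a -> 0 <= m ->
  m `^ p + p * m `^ (p - 1) * (a - m) <= a `^ p.
Proof.
move=> a0 m0; have := young_powR m0 a0; have E := mulr_powRB1 m0 p0.
set x := m `^ (p - 1); set y := a `^ p => Y.
have Y2 : p * (x * a) <= (p - 1) * m `^ p + y.
  rewrite (_ : (p - 1) * _ + _ = p * ((1 - p^-1) * m `^ p + p^-1 * y)).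
    by rewrite ler_pM2l.
  by field; rewrite gt_eqF.
rewrite (_ : p * x * (a - m) = p * (x * a) - p * m `^ p); last by rewrite -E -/x; ring.
by move: Y2; rewrite mulrBl mul1r; lra.
Qed.

(** The absolute value is essential: at base 0 the power is continuous from the right only. Later
    continuity proofs pass through this function and drop the absolute value on nonnegative
    arguments. *)
Lemma continuous_powR_norm (r : R) : 0 < r -> continuous (fun t : R => `|t| `^ r).
Proof.
move=> r0 t; have [->|t0] := eqVneq t 0.
  rewrite /continuous_at normr0 powR0 ?gt_eqF//; apply/cvgrPdist_lt => e e0.
  near=> s; rewrite sub0r normrN ger0_norm ?powR_ge0//.
  rewrite -[ltRHS]powRr1 ?ltW// -(@mulVf _ r) ?gt_eqF// powRrM.
  apply: gt0_ltr_powR => //; rewrite ?nnegrE ?powR_ge0//.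
  near: s; apply/nbhs_ballP; exists (e `^ r^-1); first exact: powR_gt0.
  by move=> s; rewrite /= sub0r normrN.
apply: (@continuous_comp _ _ _ (fun t : R => `|t|) (fun t => t `^ r)).
  exact: norm_continuous.
have : derivable (fun t => t `^ r) `|t| 1.
  by apply: derivable_powR; rewrite in_itv/= andbT normr_gt0.
by move/derivable1_diffP => /differentiable_continuous.
Unshelve. all: by end_near. Qed.

End powers.

(** * Test functions: supports and integration by parts *)

Section test_functions.
Context (R : realType) (n : nat) (Omega : set 'rV[R]_n).
Implicit Types (f g phi psi : 'rV[R]_n -> R).
Local Notation mu := (lebesgue_rV R n).

Lemma continuous_enorm_comp (T : topologicalType) (G : T -> 'rV[R]_n) :
  (forall i, continuous (fun x => G x ord0 i)) -> continuous (fun x => enorm (G x)).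
Proof.
move=> cG; apply: continuous_compr; first exact: sqrt_continuous.
by apply: continuous_sumr => i; exact: continuous_mulr.
Qed.

Lemma continuous_dotr_comp (T : topologicalType) (F G : T -> 'rV[R]_n) :
  (forall i, continuous (fun x => F x ord0 i)) ->
  (forall i, continuous (fun x => G x ord0 i)) ->
  continuous (fun x => dotr (F x) (G x)).
Proof. by move=> cF cG; apply: continuous_sumr => i; exact: continuous_mulr. Qed.

Lemma continuous_grad f i : C1 f -> continuous (fun x => grad f x ord0 i).
Proof. by move=> [_ cdf _]; under eq_fun do rewrite mxE; exact: cdf. Qed.

Lemma continuous_enorm_powR (T : topologicalType) (G : T -> 'rV[R]_n) (r : R) : 0 < r ->
  (forall i, continuous (fun x => G x ord0 i)) ->
  continuous (fun x => enorm (G x) `^ r).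
Proof.
move=> r0 cG; have := continuous_compr (continuous_powR_norm r0) (continuous_enorm_comp cG).
by under eq_fun do rewrite ger0_norm ?enorm_ge0//.
Qed.

Lemma test_fun_smooth phi : test_fun Omega phi -> smooth phi.
Proof. by case. Qed.

Lemma test_fun_C1 phi : test_fun Omega phi -> C1 phi.
Proof. by move=> /test_fun_smooth; exact: smooth_C1. Qed.

Lemma test_fun_out phi x : test_fun Omega phi -> ~ Omega x -> phi x = 0.
Proof.
move=> [_ _ sO] Ox; apply: contrapT => /eqP px; apply: Ox; apply: sO.
exact: subset_closure.
Qed.

(** The support is closed and lies in Omega, so a point outside Omega has a whole neighbourhood on
    which phi vanishes. *)
Lemma test_partial_out phi i x : test_fun Omega phi -> ~ Omega x -> partial i phi x = 0.
Proof.
move=> [_ _ sO] Ox; rewrite /partial (near_eq_derive (g := cst 0)).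
  by have [_] := is_derive_cst (0 : R) x (delta_mx ord0 i : 'rV[R]_n).
have : (~` closure [set x | phi x != 0]) x by move=> /sO.
have /open_nbhs_nbhs : open_nbhs x (~` closure [set x | phi x != 0]).
  by split; [rewrite openC; exact: closed_closure|move=> /sO].
move=> + _; apply: filterS => y ys /=; apply: contrapT => /eqP py; apply: ys.
exact: subset_closure.
Qed.

Lemma test_grad_out phi x : test_fun Omega phi -> ~ Omega x -> grad phi x = 0.
Proof. by move=> tp Ox; apply/rowP => i; rewrite !mxE test_partial_out. Qed.

Lemma test_funD phi psi k : test_fun Omega phi -> test_fun Omega psi ->
  test_fun Omega (fun x => phi x + k * psi x).
Proof.
move=> [s1 c1 o1] [s2 c2 o2].
have sub : closure [set x | phi x + k * psi x != 0] `<=`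
    closure [set x | phi x != 0] `|` closure [set x | psi x != 0].
  rewrite -closureU; apply: closureS => x /=.
  by have [->|] := eqVneq (phi x) 0; [rewrite add0r mulf_eq0 negb_or => /andP[_]; right|left].
split; first exact: smoothD.
- apply: (subclosed_compact (@closed_closure _ _) (compactU c1 c2) sub).
- by move=> x /sub[/o1|/o2].
Qed.

Lemma test_fun0 : test_fun Omega (fun=> 0).
Proof.
have E : foldr (@partial R n) (fun=> 0) = fun=> (fun=> 0).
  apply/funext => s; elim: s => //= i s ->; apply/funext => x.
  by have [_] := is_derive_cst (0 : R) x (delta_mx ord0 i : 'rV[R]_n).
have S0 : closure [set x : 'rV[R]_n | (fun=> 0 : R) x != 0] = set0.
  rewrite (_ : [set x | _] = set0) ?closure0//.
  by apply/seteqP; split => x //=; rewrite eqxx.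
split; last 2 first.
- rewrite S0; exact: compact0.
- by rewrite S0.
- move=> s; rewrite /= E; split; first exact: continuous_const.
  by move=> i x; exact: derivable_cst.
Qed.

Lemma test_funZ phi k : test_fun Omega phi -> test_fun Omega (fun x => k * phi x).
Proof.
move=> tp; rewrite (_ : (fun x => _) = (fun x => 0 + k * phi x)).
  exact: (test_funD k test_fun0 tp).
by apply/funext => x; rewrite add0r.
Qed.

End test_functions.
Section bounded_open.
Context (R : realType) (n : nat) (Omega : set 'rV[R]_n).
Hypotheses (oO : open Omega) (bO : bounded_set Omega).
Implicit Types (f g phi psi : 'rV[R]_n -> R).
Local Notation mu := (lebesgue_rV R n).
Local Notation leb := (@lebesgue_measure R).

Let mO : measurable Omega. Proof. exact: open_rV_measurable. Qed.

Lemma open_integrable f : continuous f -> mu.-integrable Omega (EFin \o f).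
Proof. exact: continuous_integrable. Qed.

Lemma Rintegral_sumr (I : Type) (r : seq I) (f : I -> 'rV[R]_n -> R) :
  (forall i, continuous (f i)) ->
  \int[mu]_(x in Omega) (\sum_(i <- r) f i x) = \sum_(i <- r) \int[mu]_(x in Omega) f i x.
Proof.
move=> cf; elim: r => [|i r IH].
  rewrite big_nil -[RHS](mul0r (fine (mu Omega))) -Rintegral_cst//.
  by apply: eq_Rintegral => x _; rewrite big_nil.
rewrite big_cons -IH -RintegralD//; first last.
- exact/open_integrable/continuous_sumr.
- exact/open_integrable.
by apply: eq_Rintegral => x _; rewrite big_cons.
Qed.

Lemma test_ibp i phi psi : test_fun Omega phi -> test_fun Omega psi ->
  \int[mu]_(x in Omega) (phi x * partial i psi x) =
  - \int[mu]_(x in Omega) (partial i phi x * psi x).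
Proof.
move=> tphi tpsi; apply/eqP; rewrite -addr_eq0; apply/eqP.
have [cphi dphi d1] := test_fun_C1 tphi; have [cpsi dpsi d2] := test_fun_C1 tpsi.
rewrite -RintegralD//; try by apply/open_integrable; exact: continuous_mulr.
have E x : partial i (fun x => phi x * psi x) x = phi x * partial i psi x + psi x * partial i phi x.
  by have [_] := is_derive_mul (is_derive_partial (d1 i x)) (is_derive_partial (d2 i x)).
rewrite -(@Rintegral_partial _ _ i (fun x => phi x * psi x) Omega) //.
- by apply: eq_Rintegral => x _; rewrite E (mulrC (psi x)).
- exact: C1M (test_fun_C1 tphi) (test_fun_C1 tpsi).
- by move=> x xO; rewrite (test_fun_out tphi xO) mul0r.
- by move=> x xO; rewrite E (test_fun_out tphi xO) (test_fun_out tpsi xO) !mul0r addr0.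
Qed.

(** Divergence theorem for the field phi(x) x, whose divergence is n phi + x . grad phi. *)
Lemma test_field phi : test_fun Omega phi ->
  \int[mu]_(x in Omega) dotr x (grad phi x) = - n%:R * \int[mu]_(x in Omega) phi x.
Proof.
move=> tphi; have [cphi dphi d1] := test_fun_C1 tphi.
rewrite /dotr Rintegral_sumr; last first.
  move=> i; apply: continuous_mulr; first exact: coord_continuous.
  exact: continuous_grad (test_fun_C1 tphi).
set J := \int[mu]_(x in Omega) phi x.
have -> : - n%:R * J = \sum_(i < n) - J.
  by rewrite sumr_const card_ord mulNr mulr_natl mulNrn.
apply: eq_bigr => i _.
apply/eqP; rewrite -addr_eq0; apply/eqP; rewrite /J -RintegralD//; last 2 first.
- apply/open_integrable/continuous_mulr; first exact: coord_continuous.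
  exact: continuous_grad (test_fun_C1 tphi).
- exact/open_integrable.
have [_ _ dc] := @C1_coord R n i.
have E x : partial i (fun x => x ord0 i * phi x) x = x ord0 i * partial i phi x + phi x.
  have [_ dE] := is_derive_mul (is_derive_partial (dc i x)) (is_derive_partial (d1 i x)).
  apply: etrans dE _.
  congr (_ + _); rewrite (_ : partial i (fun x : 'rV[R]_n => x ord0 i) x = 1) ?mulr1//.
  have : is_derive x (delta_mx ord0 i) (fun x : 'rV[R]_n => x ord0 i) 1.
    apply/is_derive_line.
    rewrite (_ : (fun t : R => (x + t *: delta_mx ord0 i) ord0 i) =
      (fun t => x ord0 i + t * 1)); last by apply/funext => t; rewrite !mxE !eqxx.
    exact: is_derive_affine.
  by case.
rewrite -(@Rintegral_partial _ _ i (fun x => x ord0 i * phi x) Omega) //.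
- by apply: eq_Rintegral => x _; rewrite E mxE.
- exact: C1M (@C1_coord _ _ i) (test_fun_C1 tphi).
- by move=> x xO; rewrite (test_fun_out tphi xO) mulr0.
- by move=> x xO; rewrite E (test_fun_out tphi xO) (test_partial_out _ tphi xO) mulr0 addr0.
Qed.

End bounded_open.

(** * Estimates along lines and a Poincaré inequality *)

Section line_bound.
Context (R : realType) (n : nat).
Implicit Types (f g : 'rV[R]_n -> R) (x e : 'rV[R]_n).
Local Notation leb := (@lebesgue_measure R).

Lemma continuous_line (G : 'rV[R]_n -> R) x e : continuous G ->
  continuous (fun t : R => G (x - t *: e)).
Proof.
move=> cG; have cl : continuous (fun t : R => x - t *: e).
  move=> t; apply: (@cvgB _ _ _ (nbhs t) _ (fun=> x)); first exact: cvg_cst.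
  exact: scalel_continuous.
by move=> t; apply: continuous_comp; [exact: cl|exact: cG].
Qed.

(** The fundamental theorem of calculus, started at the far end of the segment where f vanishes. The
    bound is stated in the extended reals because it feeds Tonelli's theorem. *)
Lemma line_bound f x e (L : R) : C1 f -> 0 < L -> f (x - L *: e) = 0 ->
  ((`|f x|)%R%:E <= \int[leb]_(t in `[0%R, L]) (`|dotr (grad f (x - t *: e)) e|)%R%:E)%E.
Proof.
move=> Cf L0 fL.
have cd : continuous (fun t : R => dotr (grad f (x - t *: e)) e).
  have cG : continuous (fun y => dotr (grad f y) e).
    by apply: continuous_dotr_comp => i; [exact: continuous_grad|exact: continuous_const].
  exact: (@continuous_line _ x e cG).
have dF (t : R) : is_derive t (1 : R) (fun s => - f (x - s *: e)) (dotr (grad f (x - t *: e)) e).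
  have := is_derive_C1 (x + t *: (- e)) (- e) Cf.
  move/is_derive_line_at => /is_deriveN; rewrite dotrNr opprK scalerN.
  by under eq_fun do rewrite scalerN.
have H := @continuous_FTC2 R (fun t => dotr (grad f (x - t *: e)) e)
  (fun s => - f (x - s *: e)) 0 L L0.
have -> : (`|f x|)%R%:E = `|\int[leb]_(t in `[0%R, L]) (dotr (grad f (x - t *: e)) e)%:E|%E.
  rewrite H.
  - by rewrite fL oppr0 scale0r subr0 sub0e -EFinN opprK.
  - exact: continuous_subspaceT.
  - have cF : continuous (fun s : R => - f (x - s *: e)).
      by move=> t; apply/differentiable_continuous/derivable1_diffP; have [] := dF t.
    by split => [t _||]; [have [] := dF t|exact: cvg_at_right_filter (cF _)|exact: cvg_at_left_filter (cF _)].
  - by move=> t _; rewrite derive1E; have [_] := dF t.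
apply: le_trans (le_abse_integral _ _ _) _ => //.
by apply/measurable_EFinP; apply: measurable_funS (continuous_measurable_fun cd).
Qed.

End line_bound.

Section poincare.
Context (R : realType) (p : R) (p1 : 1 < p).
Local Notation leb := (@lebesgue_measure R).

Let p0 : 0 < p. Proof. exact: lt_trans p1. Qed.

(** The tangent line of t^p at the mean of h is integrated: its linear term has integral zero. *)
Lemma jensen_powR (h : R -> R) (L : R) : 0 < L -> continuous h -> (forall t, 0 <= h t) ->
  (\int[leb]_(t in `[0%R, L]) h t) `^ p <=
  L `^ (p - 1) * \int[leb]_(t in `[0%R, L]) (h t `^ p).
Proof.
move=> L0 ch h0; set a := \int[leb]_(t in _) h t.
have mT : measurable (`[0%R, L]%classic : set (measurableTypeR R)) by exact: measurable_itv.
have ci (g : R -> R) : continuous g -> leb.-integrable `[0%R, L] (EFin \o g).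
  move=> cg; apply: continuous_compact_integrable; first exact: segment_compact.
  exact: continuous_subspaceT.
have a0 : 0 <= a by apply: Rintegral_ge0 => t _.
have lT : fine (leb `[0%R, L]%classic) = L.
  by rewrite lebesgue_measure_itv/= lte_fin L0 -EFinD subr0.
pose m := a / L; have m0 : 0 <= m by rewrite divr_ge0// ltW.
have chp : continuous (fun t => h t `^ p).
  have := continuous_compr (continuous_powR_norm p0) ch.
  by under eq_fun do rewrite ger0_norm ?h0//.
have H : L * m `^ p <= \int[leb]_(t in `[0%R, L]) (h t `^ p).
  have -> : L * m `^ p = \int[leb]_(t in `[0%R, L]) (m `^ p + p * m `^ (p - 1) * (h t - m)).
    rewrite RintegralD//=; last 2 first.
    - exact/ci/continuous_const.
    - apply/ci/continuous_mulr; first exact: continuous_const.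
      by apply: continuous_addr => //; exact: continuous_const.
    rewrite RintegralZl//; last first.
      by apply/ci/continuous_addr => //; exact: continuous_const.
    rewrite RintegralB//; [|exact: ci|exact/ci/continuous_const].
    rewrite !Rintegral_cst// lT -/a /m.
    by rewrite divfK ?gt_eqF// subrr mulr0 addr0 mulrC.
  apply: le_Rintegral => //.
  - apply/ci/continuous_addr; first exact: continuous_const.
    apply: continuous_mulr; first exact: continuous_const.
    by apply: continuous_addr => //; exact: continuous_const.
  - exact: ci.
  - by move=> t _; exact: tangent_powR.
apply: le_trans (ler_wpM2l (powR_ge0 L (p - 1)) H).
rewrite mulrA (mulrC _ L) mulr_powRB1 ?(ltW L0)// -powRM ?(ltW L0)// /m.
by rewrite mulrCA mulfV ?gt_eqF// mulr1.
Qed.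

(** Every line parallel to the first axis leaves the box within length 2M. Jensen's inequality on
    that segment, then [tonelli_flow], give the constant; it is crude but enough for coercivity and
    for passing from convergence of gradients to convergence of values. *)
Lemma poincare n (Omega : set 'rV[R]_n.+1) (M : R) (phi : 'rV[R]_n.+1 -> R) :
  open Omega -> 0 < M -> Omega `<=` rbox 0 (fun=> M) -> test_fun Omega phi ->
  \int[lebesgue_rV R n.+1]_(x in Omega) (`|phi x| `^ p) <=
  (2 * M) `^ p * \int[lebesgue_rV R n.+1]_(x in Omega) (enorm (grad phi x) `^ p).
Proof.
move=> oO M0 OM tphi; set mu := lebesgue_rV R n.+1.
have mO := open_rV_measurable oO.
have bO : bounded_set Omega by exact: rbox_bounded OM.
have Cphi := test_fun_C1 tphi; have [cphi _ _] := Cphi.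
(* With L = 2M the point x - L e is outside the box, so phi vanishes there. *)
pose e : 'rV[R]_n.+1 := delta_mx ord0 ord0; pose L := 2 * M.
have L0 : 0 < L by rewrite mulr_gt0.
pose G y := `|dotr (grad phi y) e| `^ p.
have cd : continuous (fun y => dotr (grad phi y) e).
  by apply: continuous_dotr_comp => i; [exact: continuous_grad|exact: continuous_const].
have cG : continuous G by exact: continuous_compr (continuous_powR_norm p0) cd.
pose T : set (measurableTypeR R) := `[0%R, L]%classic.
have mT : measurable T by exact: measurable_itv.
have lT : leb T = L%:E by rewrite lebesgue_measure_itv/= lte_fin L0 -EFinD subr0.
have key x : Omega x -> ((`|phi x| `^ p)%:E <=
    (L `^ (p - 1))%:E * \int[leb]_(t in T) (G (x - t *: e))%:E)%E.
  move=> Ox; pose h (t : R) := `|dotr (grad phi (x - t *: e)) e|.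
  have ch : continuous h.
    by apply: (@continuous_line _ _ (fun y => `|dotr (grad phi y) e|)); exact: continuous_compr (@norm_continuous _ _) cd.
  have ci (g : R -> R) : continuous g -> leb.-integrable T (EFin \o g).
    move=> cg; apply: continuous_compact_integrable; first exact: segment_compact.
    exact: continuous_subspaceT.
  have pL : phi (x - L *: e) = 0.
    apply: (test_fun_out tphi) => /OM /(_ ord0); have /OM/(_ ord0) := Ox.
    rewrite !mxE !subr0 eqxx mulr1 /L ltr_norml => /andP[_ xM].
    by rewrite ltr_norml => /andP[+ _]; lra.
  have := line_bound Cphi L0 pL; rewrite -/(h _) => H1.
  have H2 : `|phi x| <= \int[leb]_(t in T) h t.
    by rewrite -lee_fin [leRHS]fineK// (integrable_fin_num _ (ci _ ch)).
  have chp : continuous (fun t => h t `^ p).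
    by apply: (@continuous_line _ _ G).
  rewrite [X in (_ * X)%E](_ : _ = (\int[leb]_(t in T) (h t `^ p))%:E); last first.
    by rewrite [RHS]fineK// (integrable_fin_num _ (ci _ chp)).
  rewrite -EFinM lee_fin; apply: le_trans (jensen_powR L0 ch (fun t => normr_ge0 _)).
  by apply: ge0_ler_powR; rewrite ?nnegrE ?(ltW p0)// (le_trans _ H2).
have iO f : continuous f -> mu.-integrable Omega (EFin \o f) by exact: open_integrable.
have ip : mu.-integrable Omega (EFin \o (fun x => `|phi x| `^ p)).
  exact/iO/(continuous_compr (continuous_powR_norm p0) cphi).
have cg : continuous (fun x => enorm (grad phi x) `^ p).
  by apply: continuous_enorm_powR => // i; exact: continuous_grad.
pose F x : \bar R := (\int[leb]_t (\1_Omega x * \1_T t * G (x - t *: e))%:E)%E.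
have FE x : Omega x -> F x = (\int[leb]_(t in T) (G (x - t *: e))%:E)%E.
  move=> Ox; rewrite [RHS]integral_mkcond; apply: eq_integral => t _.
  rewrite patchE !indicE (mem_set Ox) mul1r.
  by case: ifPn => _; rewrite ?mul1r ?mul0r.
have mF : measurable_fun setT F.
  apply: measurable_flow_integral => //; first exact: continuous_rV_measurable.
  by move=> x; exact: powR_ge0.
have F0 x : (0 <= F x)%E.
  by apply: integral_ge0 => t _; rewrite lee_fin !mulr_ge0// powR_ge0.
rewrite -(@lee_fin R) EFinM !fineK ?(integrable_fin_num mO)//; last exact: iO.
apply: (@le_trans _ _ (\int[mu]_x ((L `^ (p - 1))%:E * F x))%E).
  rewrite integral_mkcond; apply: ge0_le_integral => //.
  - by move=> x _; rewrite patchE; case: ifPn => // _; rewrite lee_fin powR_ge0.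
  - apply/(measurable_restrictT _ mO).
    by case/integrableP : ip.
  - exact: emeasurable_funM.
  - move=> x _; rewrite patchE; case: ifPn => [|_].
      by rewrite inE => Ox; rewrite FE//; exact: key.
    by rewrite mule_ge0// lee_fin powR_ge0.
rewrite ge0_integralZl//; last by rewrite lee_fin powR_ge0.
rewrite tonelli_flow//; last 2 first.
- exact: continuous_rV_measurable.
- by move=> x; exact: powR_ge0.
apply: (@le_trans _ _ ((L `^ (p - 1))%:E * \int[mu]_x (L%:E * (G x)%:E))%E).
  apply: lee_wpmul2l; first by rewrite lee_fin powR_ge0.
  apply: ge0_le_integral => //.
  - by move=> x _; rewrite mule_ge0// lee_fin powR_ge0.
  - apply: emeasurable_funM; first by apply/measurable_EFinP; exact: continuous_rV_measurable.
    exact: measurable_flow_length.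
  - apply: emeasurable_funM => //.
    by apply/measurable_EFinP; exact: continuous_rV_measurable.
  - move=> x _; rewrite muleC; apply: lee_wpmul2r; first by rewrite lee_fin powR_ge0.
    by rewrite -lT; apply: le_measure; rewrite ?inE//; apply: measurableI => //; exact: measurable_flow_section.
rewrite ge0_integralZl//; last 3 first.
- by apply/measurable_EFinP; exact: continuous_rV_measurable.
- by move=> x _; rewrite lee_fin powR_ge0.
- by rewrite lee_fin ltW.
rewrite muleA -EFinM mulrC mulr_powRB1 ?(ltW L0)//.
apply: lee_wpmul2l; first by rewrite lee_fin powR_ge0.
rewrite [leRHS]integral_mkcond; apply: ge0_le_integral => //.
- by move=> x _; rewrite lee_fin powR_ge0.
- by apply/measurable_EFinP; exact: continuous_rV_measurable.
- apply/(measurable_restrictT _ mO).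
  by case/integrableP : (iO _ cg).
- move=> x _; rewrite patchE; case: ifPn => xO; rewrite lee_fin /G.
    apply: ge0_ler_powR; rewrite ?nnegrE ?(ltW p0) ?enorm_ge0//.
    by rewrite dotr_delta mxE; have := enorm_coord (grad phi x) ord0; rewrite mxE.
  rewrite (test_grad_out tphi); last by move=> Ox; move: xO; rewrite mem_set.
  by rewrite dotr0l normr0 powR0// gt_eqF.
Qed.

End poincare.

(** * Uniform convexity of the p-th power of the Euclidean norm *)

Section strict_convexity.
Context (R : realType) (p : R) (p1 : 1 < p).

Let p0 : 0 < p. Proof. exact: lt_trans p1. Qed.

Lemma powR_midpoint_lt (a b : R) : 0 <= a -> a < b ->
  ((a + b) / 2) `^ p < (a `^ p + b `^ p) / 2.
Proof.
move=> a0 ab; pose m := (a + b) / 2.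
have am : a < m by rewrite /m; lra.
have mb : m < b by rewrite /m; lra.
have m0 : 0 < m by exact: le_lt_trans am.
have D (x : R) : 0 < x -> is_derive x (1 : R) (fun t => t `^ p) (p * x `^ (p - 1)).
  by move=> x0; exact: is_derive1_powR.
have C (x y : R) : 0 <= x -> {within `[x, y], continuous (fun t => t `^ p)}.
  move=> x0; apply: (@subspace_eq_continuous _ _ _ (fun t : R => `|t| `^ p)).
    by move=> t; rewrite inE /= in_itv/= => /andP[xt _]; rewrite ger0_norm// (le_trans x0).
  by apply: continuous_subspaceT; exact: continuous_powR_norm.
have Dam x : x \in `]a, m[ -> is_derive x (1 : R) (fun t => t `^ p) (p * x `^ (p - 1)).
  by rewrite in_itv/= => /andP[ax _]; apply: D; exact: le_lt_trans ax.
have Dmb x : x \in `]m, b[ -> is_derive x (1 : R) (fun t => t `^ p) (p * x `^ (p - 1)).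
  by rewrite in_itv/= => /andP[mx _]; apply: D; exact: lt_trans mx.
have [x xi E1] := MVT am Dam (C a m a0).
have [y yi E2] := MVT mb Dmb (C m b (ltW m0)).
move: xi yi; rewrite !in_itv/= => /andP[ax xm] /andP[my yb].
have xy : x `^ (p - 1) < y `^ (p - 1).
  apply: gt0_ltr_powR; rewrite ?subr_gt0 ?nnegrE//; last exact: lt_trans my.
  - by rewrite (le_trans a0)// ltW.
  - by rewrite ltW// (lt_trans m0).
have E : m - a = b - m by rewrite /m; lra.
rewrite -/m; suff : m `^ p - a `^ p < b `^ p - m `^ p by lra.
by rewrite E1 E2 E ltr_pM2r ?subr_gt0// ltr_pM2l.
Qed.

Lemma powR_midpoint_le (a b : R) : 0 <= a -> 0 <= b ->
  ((a + b) / 2) `^ p <= (a `^ p + b `^ p) / 2.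
Proof.
move=> a0 b0; have [ab|ba|->] := ltgtP a b.
- exact/ltW/powR_midpoint_lt.
- by rewrite addrC (addrC (_ `^ _)); exact/ltW/powR_midpoint_lt.
- by have E (x : R) : (x + x) / 2 = x; [lra|rewrite !E].
Qed.

(** Midpoint convexity defect of the p-th power of the norm. Integrated over the gradients of two
    functions it measures how much energy their average saves. *)
Definition convexity_gap n (a b : 'rV[R]_n) : R :=
  (enorm a `^ p + enorm b `^ p) / 2 - enorm (2^-1 *: (a + b)) `^ p.

Lemma convexity_gap_ge0 n (a b : 'rV[R]_n) : 0 <= convexity_gap a b.
Proof.
rewrite subr_ge0; apply: le_trans (powR_midpoint_le (enorm_ge0 a) (enorm_ge0 b)).
apply: ge0_ler_powR; rewrite ?nnegrE ?(ltW p0) ?enorm_ge0//.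
  by rewrite divr_ge0// addr_ge0// enorm_ge0.
by rewrite enormZ ger0_norm ?invr_ge0// mulrC ler_pM2r ?invr_gt0// enormD.
Qed.

(** If the norms differ, strict convexity of t^p decides; if they agree, |a - b|^2 > 0 makes the
    midpoint strictly shorter than either vector. *)
Lemma convexity_gap_gt0 n (a b : 'rV[R]_n) : a != b -> 0 < convexity_gap a b.
Proof.
move=> ab; rewrite subr_gt0.
have cle : enorm (2^-1 *: (a + b)) <= (enorm a + enorm b) / 2.
  by rewrite enormZ ger0_norm ?invr_ge0// mulrC ler_pM2r ?invr_gt0// enormD.
have H : enorm (2^-1 *: (a + b)) `^ p <= ((enorm a + enorm b) / 2) `^ p.
  apply: ge0_ler_powR; rewrite ?nnegrE ?(ltW p0) ?enorm_ge0//.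
  by rewrite divr_ge0// addr_ge0// enorm_ge0.
have [lab|lba|eab] := ltgtP (enorm a) (enorm b).
- by apply: le_lt_trans H _; apply: powR_midpoint_lt => //; exact: enorm_ge0.
- apply: le_lt_trans H _; rewrite addrC (addrC (_ `^ _)).
  by apply: powR_midpoint_lt => //; exact: enorm_ge0.
rewrite eab (_ : (_ + _) / 2 = enorm b `^ p); last by lra.
apply: gt0_ltr_powR; rewrite ?nnegrE ?enorm_ge0//.
rewrite -(@ltr_pXn2r _ 2)// ?nnegrE ?enorm_ge0//.
have := exprn_gt0 2; have : 0 < enorm (a - b) by rewrite enorm_gt0 subr_eq0.
move=> /[swap] _ /(exprn_gt0 2); rewrite enormZ exprMn !sqr_enorm.
have : dotr a a = dotr b b by rewrite -!sqr_enorm eab.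
rewrite !(dotrDl, dotrDr, dotrNl, dotrNr) (dotrC b a) real_normK ?num_real//; lra.
Qed.

(** A compactness argument that treats all p > 1 alike: among pairs with |a|^p + |b|^p = 1 and |a -
    b|^p >= eps the gap has a positive minimum, and both sides are homogeneous of degree p. A pair
    is encoded as a row vector of length n + n so that the extreme value theorem applies. *)
Lemma uniform_convexity n (eps : R) : 0 < eps -> exists2 C : R, 0 <= C &
  forall a b : 'rV[R]_n, enorm (a - b) `^ p <=
    eps * (enorm a `^ p + enorm b `^ p) + C * convexity_gap a b.
Proof.
move=> eps0.
have csub (G : 'rV[R]_(n + n) -> 'rV[R]_n) : (forall i, continuous (fun z => G z ord0 i)) ->
    continuous (fun z => enorm (G z) `^ p) by exact: continuous_enorm_powR.
have cl i : continuous (fun z : 'rV[R]_(n + n) => lsubmx z ord0 i).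
  by under eq_fun do rewrite mxE; exact: coord_continuous.
have cr i : continuous (fun z : 'rV[R]_(n + n) => rsubmx z ord0 i).
  by under eq_fun do rewrite mxE; exact: coord_continuous.
pose N (z : 'rV[R]_(n + n)) := enorm (lsubmx z) `^ p + enorm (rsubmx z) `^ p.
pose Q (z : 'rV[R]_(n + n)) := enorm (lsubmx z - rsubmx z) `^ p.
pose P (z : 'rV[R]_(n + n)) := convexity_gap (lsubmx z) (rsubmx z).
have cN : continuous N by apply: continuous_addr; exact: csub.
have cQ : continuous Q.
  apply: csub => i; under eq_fun do rewrite !mxE.
  apply: continuous_addr; first exact: coord_continuous.
  by apply: continuous_oppr; exact: coord_continuous.
have cP : continuous P.
  apply: continuous_addr; first by apply: continuous_mulr => //; exact: continuous_const.
  apply: continuous_oppr; apply: csub => i; under eq_fun do rewrite !mxE.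
  apply: continuous_mulr; first exact: continuous_const.
  by apply: continuous_addr; exact: coord_continuous.
pose K := [set z | N z = 1 /\ eps <= Q z].
have scale (r : R) (v : 'rV[R]_n) : 0 < r -> enorm (r *: v) `^ p = r `^ p * enorm v `^ p.
  by move=> r0; rewrite enormZ gtr0_norm// powRM ?enorm_ge0 ?ltW.
have N1 z : N z = 1 -> enorm (lsubmx z) <= 1 /\ enorm (rsubmx z) <= 1.
  have le1 (x : R) : 0 <= x -> x `^ p <= 1 -> x <= 1.
    move=> x0 xp; rewrite leNgt; apply/negP => x1; move: xp; rewrite leNgt => /negP; apply.
    by have := @gt0_ltr_powR R p p0 1 x; rewrite powR1; apply; rewrite ?nnegrE.
  move=> Nz; have := powR_ge0 (enorm (lsubmx z)) p; have := powR_ge0 (enorm (rsubmx z)) p.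
  move=> h1 h2; split; apply: le1; rewrite ?enorm_ge0// -Nz; first by rewrite lerDl.
  by rewrite lerDr.
have Q2 z : N z = 1 -> Q z <= 2 `^ p.
  move=> /N1[l1 r1]; apply: ge0_ler_powR; rewrite ?nnegrE ?(ltW p0) ?enorm_ge0//.
  by rewrite (le_trans (enormD _ _))// enormN; lra.
have compK : compact K.
  apply: bounded_closed_compact.
    apply: (@rbox_bounded _ _ _ 0 2) => z [/N1[l1 r1] _] i; rewrite mxE subr0.
    apply: (@le_lt_trans _ _ 1); last by rewrite ltr1n.
    case: (split_ordP i) => j ->.
      by have := enorm_coord (lsubmx z) j; rewrite mxE => /le_trans; apply.
    by have := enorm_coord (rsubmx z) j; rewrite mxE => /le_trans; apply.
  rewrite (_ : K = N @^-1` [set x | x = 1] `&` Q @^-1` [set x | eps <= x])//.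
  apply: closedI.
    by apply: preimage_closed; [move=> z _; exact: cN|exact: closed_eq].
  by apply: preimage_closed; [move=> z _; exact: cQ|exact: closed_ge].
have [C C0 HC] : exists2 C : R, 0 <= C & forall z, N z = 1 -> Q z <= eps + C * P z.
  have [K0|/set0P K0] := eqVneq K set0.
    exists 0 => // z Nz; rewrite mul0r addr0 leNgt; apply/negP => /ltW Qz.
    by have : K z by []; rewrite K0.
  have [|z0 + z0P] := @EVT_min_rV R _ P K K0 compK; first exact: continuous_subspaceT.
  rewrite inE => -[Nz0 Qz0].
  have P0 : 0 < P z0.
    apply: convexity_gap_gt0; apply/eqP => E; move: Qz0.
    by rewrite /Q E subrr enorm0 powR0 ?gt_eqF// leNgt eps0.
  (* On normalized pairs |a - b|^p is at most 2^p, and the gap is at least its minimum [P z0]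
     wherever |a - b|^p >= eps. *)
  exists (2 `^ p / P z0); first by rewrite divr_ge0 ?powR_ge0 ?ltW.
  move=> z Nz; have [Qz|/ltW Qz] := lerP eps (Q z).
    apply: (@le_trans _ _ (2 `^ p / P z0 * P z)); last by rewrite lerDr ltW.
    apply: le_trans (Q2 z Nz) _; rewrite -[leLHS](divfK (lt0r_neq0 P0)).
    by apply: ler_wpM2l; [rewrite divr_ge0 ?powR_ge0 ?ltW|apply: z0P; rewrite inE].
  apply: (le_trans Qz); rewrite lerDl; apply: mulr_ge0; last exact: convexity_gap_ge0.
  by apply: divr_ge0; [exact: powR_ge0|exact: ltW].
exists C => // a b; pose s := enorm a `^ p + enorm b `^ p.
have s0 : 0 <= s by rewrite addr_ge0// powR_ge0.
have [sE|sN] := eqVneq s 0.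
  move: sE; rewrite /s => /eqP; rewrite paddr_eq0 ?powR_ge0// !powR_eq0 !enorm_eq0.
  move=> /andP[/andP[/eqP-> _] /andP[/eqP-> _]].
  rewrite subrr enorm0 powR0 ?gt_eqF// addr0 mulr0 add0r.
  by rewrite mulr_ge0// convexity_gap_ge0.
have {}s0 : 0 < s by rewrite lt_neqAle eq_sym sN.
(* Scaling by r normalizes the pair, since r^p = 1/s. *)
pose r := s `^ (- p^-1); have r0 : 0 < r by exact: powR_gt0.
have rps : r `^ p * s = 1.
  rewrite -powRrM mulNr mulVf ?gt_eqF// powRN powRr1 ?(ltW s0)//.
  by rewrite mulVf// gt_eqF.
have rp0 : 0 < r `^ p by exact: powR_gt0.
have := HC (row_mx (r *: a) (r *: b)).
rewrite /N /Q /P row_mxKl row_mxKr /convexity_gap -scalerBr -scalerDr !scale//.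
have rE : r `^ p * enorm a `^ p + r `^ p * enorm b `^ p = 1 by rewrite -mulrDr.
move=> /(_ rE) H.
rewrite -(ler_pM2l rp0); apply: le_trans H _.
rewrite [leRHS]mulrDr (mulrCA (r `^ p) eps) rps mulr1 lerD2l.
by rewrite le_eqVlt; apply/orP; left; apply/eqP; ring.
Qed.

End strict_convexity.

(** * The p-Laplace flux *)

Section flux.
Context (R : realType) (n : nat) (p : R) (p1 : 1 < p).
Implicit Types z h a b : 'rV[R]_n.

Let p0 : 0 < p. Proof. exact: lt_trans p1. Qed.

Definition pflux z h : R := enorm z `^ (p - 2) * dotr z h.

(** At z = 0 both sides vanish because p > 1, whatever value 0^(p-2) takes. *)
Lemma enorm_powR_sub1 z : enorm z `^ (p - 2) * enorm z = enorm z `^ (p - 1).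
Proof.
have [->|z0] := eqVneq z 0.
  by rewrite enorm0 mulr0 powR0// gt_eqF// subr_gt0.
rewrite (_ : p - 1 = p - 2 + 1); last by lra.
rewrite [RHS]powRD; last by rewrite enorm_eq0 z0 implybT.
by rewrite powRr1// enorm_ge0.
Qed.

Lemma pflux_le z h : `|pflux z h| <= enorm z `^ (p - 1) * enorm h.
Proof.
rewrite /pflux normrM ger0_norm ?powR_ge0// -enorm_powR_sub1 -mulrA.
by rewrite ler_wpM2l ?powR_ge0// cauchy_schwarz.
Qed.

Lemma pflux_diag z : pflux z z = enorm z `^ p.
Proof.
rewrite /pflux -sqr_enorm expr2 mulrA enorm_powR_sub1 mulrC.
by rewrite mulr_powRB1// enorm_ge0.
Qed.

Lemma pflux_young z h : pflux z h <= (1 - p^-1) * enorm z `^ p + p^-1 * enorm h `^ p.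
Proof.
apply: le_trans (ler_norm _) _; apply: le_trans (pflux_le _ _) _.
by apply: young_powR => //; exact: enorm_ge0.
Qed.

Lemma pfluxBr z a b : pflux z (a - b) = pflux z a - pflux z b.
Proof. by rewrite /pflux dotrBr mulrBr. Qed.

Lemma pfluxZr z k a : pflux z (k *: a) = k * pflux z a.
Proof. by rewrite /pflux dotrZr mulrCA. Qed.

(** p times the flux is the gradient of |.|^p; this is its subgradient inequality. It replaces
    differentiation of the energy in the derivation of the weak equation. *)
Lemma pflux_tangent a b : enorm a `^ p + p * pflux a (b - a) <= enorm b `^ p.
Proof.
rewrite pfluxBr pflux_diag; have := pflux_young a b.
set A := enorm a `^ p; set B := enorm b `^ p; set F := pflux a b => Y.
have Y2 : p * F <= (p - 1) * A + B.
  rewrite (_ : (p - 1) * _ + _ = p * ((1 - p^-1) * A + p^-1 * B)).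
    by rewrite ler_pM2l.
  by field; rewrite gt_eqF.
by rewrite mulrBr; move: Y2; rewrite mulrBl mul1r; lra.
Qed.

(** For p < 2 the factor |z|^(p-2) is unbounded near 0; continuity there comes from the bound
    |z|^(p-1) |h|. *)
Lemma continuous_pflux h : continuous (pflux ^~ h).
Proof.
move=> z; have [->|z0] := eqVneq z 0.
  have c : continuous (fun z => enorm z `^ (p - 1) * enorm h).
    apply: continuous_mulr; last exact: continuous_const.
    apply: (@continuous_enorm_powR _ _ _ id); first by rewrite subr_gt0.
    by move=> i; exact: coord_continuous.
  have := c 0; rewrite /continuous_at enorm0 powR0 ?mul0r ?gt_eqF ?subr_gt0// => c0.
  have E0 : pflux 0 h = 0 by rewrite /pflux dotr0l mulr0.
  rewrite /continuous_at E0.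
  apply/(@cvgrPdist_lt _ _ _ (nbhs (0 : 'rV[R]_n)) (nbhs_filter _)) => e e0.
  move/cvgrPdist_lt : c0 => /(_ e e0); apply: filterS => y.
  rewrite !sub0r !normrN; apply: le_lt_trans.
  by apply: le_trans (ler_norm _); exact: pflux_le.
apply: (@continuousM _ _ (fun z => enorm z `^ (p - 2)) (fun z => dotr z h)).
  apply: (@continuous_comp _ _ _ (@enorm R n) (fun t => t `^ (p - 2))).
    exact: continuous_enorm.
  have : derivable (fun t => t `^ (p - 2)) (enorm z) 1.
    by apply: derivable_powR; rewrite in_itv/= andbT enorm_gt0.
  by move/derivable1_diffP => /differentiable_continuous.
exact: continuous_dotr.
Qed.

Lemma cvg_rV (u : nat -> 'rV[R]_n) (l : 'rV[R]_n) :
  (forall i, u k ord0 i @[k --> \oo] --> l ord0 i) -> u k @[k --> \oo] --> l.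
Proof.
move=> ul; apply/cvg_ballP => e e0.
have : \forall k \near \oo, forall i : 'I_n, `|l ord0 i - u k ord0 i| < e.
  by apply: filter_forall => i; have /cvgrPdist_lt/(_ e e0) := ul i.
apply: filterS => k H; rewrite ball_rV// => i; rewrite distrC; exact: H.
Qed.

Lemma measurable_enorm d (T : measurableType d) (D : set T) (G : T -> 'rV[R]_n) :
  measurable_fun D G -> measurable_fun D (fun x => enorm (G x)).
Proof.
by move=> mG; apply: (measurableT_comp (continuous_rV_measurable (@continuous_enorm R n))).
Qed.

Lemma measurable_dotr d (T : measurableType d) (D : set T) (G H : T -> 'rV[R]_n) :
  measurable_fun D G -> measurable_fun D H -> measurable_fun D (fun x => dotr (G x) (H x)).
Proof.
move=> mG mH; apply: measurable_sum => i.
by apply: measurable_funM; apply: (measurableT_comp (@measurable_coord R n i)).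
Qed.

Lemma measurable_pflux d (T : measurableType d) (D : set T) (G H : T -> 'rV[R]_n) :
  measurable_fun D G -> measurable_fun D H -> measurable_fun D (fun x => pflux (G x) (H x)).
Proof.
move=> mG mH; apply: measurable_funM; last exact: measurable_dotr.
exact: (measurableT_comp (measurable_powR (p - 2)) (measurable_enorm mG)).
Qed.

Lemma continuous_vector_measurable (G : 'rV[R]_n -> 'rV[R]_n) :
  (forall i, continuous (fun x => G x ord0 i)) -> measurable_fun setT G.
Proof. by move=> cG; apply: measurable_rVP => i; exact: continuous_rV_measurable. Qed.

End flux.

(** * Dominated convergence and fast Cauchy sequences in L^p *)

Section real_dominated_convergence.
Context d (T : measurableType d) (R : realType) (mu : {measure set T -> \bar R}).

Lemma Rintegral_dominated_cvg (D : set T) (h : nat -> T -> R) (l H : T -> R) :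
  measurable D -> (forall k, measurable_fun D (h k)) -> measurable_fun D l ->
  (\forall x \ae mu, D x -> h k x @[k --> \oo] --> l x) ->
  mu.-integrable D (EFin \o H) ->
  (\forall x \ae mu, D x -> forall k, `|h k x| <= H x) ->
  mu.-integrable D (EFin \o l) /\
  \int[mu]_(x in D) h k x @[k --> \oo] --> \int[mu]_(x in D) l x.
Proof.
move=> mD mh ml hl iH hH.
have [] := @dominated_convergence _ _ _ mu D mD (fun k => EFin \o h k) (EFin \o l) (EFin \o H).
- by move=> k; exact/measurable_EFinP.
- exact/measurable_EFinP.
- move: hl; apply: filterS => x xl Dx; apply/fine_cvgP; split; first by near=> k.
  exact: xl.
- exact: iH.
- by move: hH; apply: filterS => x xH k Dx; rewrite /= lee_fin; exact: xH.
move=> il _; rewrite -(fineK (integrable_fin_num mD il)) => hc; split => //.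
exact: fine_cvg hc.
Unshelve. all: by end_near. Qed.

End real_dominated_convergence.

Section fast_cauchy.
Context d (T : measurableType d) (R : realType) (mu : {measure set T -> \bar R}).

Lemma le_powR_inv (p a b : R) : 0 < p -> 0 <= a -> 0 <= b -> a `^ p <= b `^ p -> a <= b.
Proof.
move=> p0 a0 b0 ab; rewrite leNgt; apply/negP => ba.
by have := gt0_ltr_powR p0 b0 a0 ba; rewrite ltNge ab.
Qed.

Lemma geometric_cauchy (u : nat -> R) (B : R) : 0 <= B ->
  (forall k, `|u k.+1 - u k| <= 2^-1 ^+ k * B) ->
  cvgn u /\ forall k, `|u k - limn u| <= 2 * 2^-1 ^+ k * B.
Proof.
move=> B0 uB.
have half1 : `|2^-1 : R| < 1 by rewrite ger0_norm ?invr_ge0// invf_lt1 ?ltr1n.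
have cu : cvgn u.
  have : cvgn (series (telescope u)).
    apply: normed_cvg; apply: (@series_le_cvg _ _ (geometric B 2^-1)) => //.
    - by move=> k; exact: normr_ge0.
    - by move=> k; apply: mulr_ge0 => //; rewrite exprn_ge0// invr_ge0.
    - by move=> k; rewrite /telescope /geometric /= mulrC; exact: uB.
    - exact: is_cvg_geometric_series.
  rewrite telescopeK => /cvg_ex[l ul]; apply/cvg_ex; exists (l + u 0%N).
  have ul2 : (u k - u 0%N) + u 0%N @[k --> \oo] --> l + u 0%N.
    by apply: cvgD => //; exact: cvg_cst.
  by move: ul2; under eq_fun do rewrite subrK.
split => // k.
have bnd j : `|u k - u (k + j)%N| <= 2 * 2^-1 ^+ k * (1 - 2^-1 ^+ j) * B.
  elim: j => [|j IH]; first by rewrite addn0 subrr normr0 expr0 subrr mulr0 mul0r.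
  rewrite (_ : u k - _ = (u k - u (k + j)%N) + (u (k + j)%N - u (k + j.+1)%N)); last by ring.
  apply: le_trans (ler_normD _ _) _.
  rewrite (distrC (u (k + j)%N)) addnS.
  apply: le_trans (lerD IH (uB (k + j)%N)) _.
  rewrite exprD le_eqVlt; apply/orP; left; apply/eqP.
  by rewrite exprSr; field.
apply: (@closed_cvg _ _ \oo _ (fun j => u (k + j)%N)
  (fun y => `|u k - y| <= 2 * 2^-1 ^+ k * B)).
- have c : continuous (fun y : R => `|u k - y|).
    apply: (continuous_compr (@norm_continuous _ _)).
    by apply: continuous_addr; [exact: continuous_const|apply: continuous_oppr => y; exact: cvg_id].
  apply: (@preimage_closed _ _ (fun y : R => `|u k - y|) [set x | x <= 2 * 2^-1 ^+ k * B]).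
    by move=> y _; exact: c.
  exact: closed_le.
- near=> j; apply: le_trans (bnd j) _; apply: ler_wpM2r => //.
  apply: ler_piMr; first by rewrite mulr_ge0// exprn_ge0// invr_ge0.
  by rewrite lerBlDr lerDl exprn_ge0// invr_ge0.
- have := cu; rewrite -(cvg_shiftn k); under eq_fun do rewrite addnC.
  by rewrite -[X in _ -> _ --> X](cvg_lim _ cu)//.
Unshelve. all: by end_near. Qed.

(** The Riesz-Fischer argument with an explicit rate. Of the decay (2^p 2)^-k, the part 2^(-pk) pays
    for the pointwise rate 2^-k and the remaining 2^-k makes the integrals summable. The finite
    index set lets a function and all its partial derivatives share one majorant [G]. *)
Lemma fast_cauchy_Lp (D : set T) (p C : R) (I : finType) (f : I -> nat -> T -> R) :
  0 < p -> 0 <= C -> measurable D ->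
  (forall i k, measurable_fun setT (f i k)) ->
  (forall i k, (\int[mu]_(x in D) (`|f i k.+1 x - f i k x| `^ p)%:E <=
    (C * (2 `^ p * 2)^-1 ^+ k)%:E)%E) ->
  exists (l : I -> T -> R) (G : T -> R),
  [/\ forall i, measurable_fun setT (l i), measurable_fun setT G, forall x, 0 <= G x,
      mu.-integrable D (EFin \o (fun x => G x `^ p)) &
      \forall x \ae mu, D x -> forall i k, `|f i k x - l i x| <= 2 * 2^-1 ^+ k * G x].
Proof.
move=> p0 C0 mD mf fC.
(* Differences weighted by 2^(pk). Their sum [W] over i and k is integrable, and [G] = [W]^(1/p)
   then bounds each difference by 2^-k [G]. *)
pose w i k x : R := (2 `^ p) ^+ k * `|f i k.+1 x - f i k x| `^ p.
have w0 i k x : 0 <= w i k x by rewrite mulr_ge0 ?exprn_ge0 ?powR_ge0.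
have mw i k : measurable_fun setT (w i k).
  apply: measurable_funM => //.
  apply: (measurableT_comp (measurable_powR p)).
  by apply: measurableT_comp => //; exact: measurable_funB.
pose v k x : \bar R := (\sum_(i <- enum I) (w i k x)%:E)%E.
have v0 k x : (0 <= v k x)%E by apply: sume_ge0 => i _; rewrite lee_fin.
have mv k : measurable_fun setT (v k).
  by apply: emeasurable_sum => i; exact/measurable_EFinP.
pose W x : \bar R := (\sum_(0 <= k <oo) v k x)%E.
have mW : measurable_fun setT W.
  apply: (@emeasurable_fun_cvg _ _ _ _ (fun n x => \sum_(0 <= k < n) v k x)%E).
    by move=> n; exact: emeasurable_sum.
  by move=> x _; exact: is_cvg_nneseries.
have W0 x : (0 <= W x)%E by exact: nneseries_ge0.
have mDf (g : T -> \bar R) : measurable_fun setT g -> measurable_fun D g.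
  by move=> mg; exact: measurable_funS mg.
have iv k : (\int[mu]_(x in D) v k x <= (#|I|%:R * C * 2^-1 ^+ k)%:E)%E.
  rewrite ge0_integral_sum//; last 2 first.
  - by move=> i; apply: mDf; exact/measurable_EFinP.
  - by move=> i x _; rewrite lee_fin.
  apply: (@le_trans _ _ (\sum_(i <- enum I) (C * 2^-1 ^+ k)%:E)%E).
    apply: lee_sum => i _; rewrite /w; under eq_integral do rewrite EFinM.
    rewrite ge0_integralZl//; last first.
      apply: mDf; apply/measurable_EFinP; apply: (measurableT_comp (measurable_powR p)).
      by apply: measurableT_comp => //; exact: measurable_funB.
    apply: (@le_trans _ _ (((2 `^ p) ^+ k)%:E * (C * (2 `^ p * 2)^-1 ^+ k)%:E)%E).
      by apply: lee_wpmul2l; rewrite ?fC// lee_fin exprn_ge0// powR_ge0.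
    rewrite -EFinM lee_fin mulrCA -exprMn.
    rewrite (_ : 2 `^ p * (2 `^ p * 2)^-1 = 2^-1 :> R)//.
    by rewrite invfM mulrA mulfV ?mul1r// gt_eqF// powR_gt0.
  by rewrite big_tnth sumEFin sumr_const card_ord -cardE lee_fin -mulrA mulr_natl.
have iW : (\int[mu]_(x in D) W x < +oo)%E.
  rewrite integral_nneseries//; last by move=> k; exact: mDf.
  apply: (@le_lt_trans _ _ (#|I|%:R * C * 2)%:E); last exact: ltry.
  apply: lime_le; first by apply: is_cvg_nneseries => k _ _; exact: integral_ge0.
  near=> n; apply: (@le_trans _ _ (\sum_(0 <= k < n) (#|I|%:R * C * 2^-1 ^+ k)%:E)%E).
    by apply: lee_sum => k _; exact: iv.
  rewrite sumEFin lee_fin -mulr_sumr ler_wpM2l ?mulr_ge0//.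
  have := subrX1 (2^-1 : R) n; rewrite big_mkord.
  have : 0 <= (2^-1 : R) ^+ n by rewrite exprn_ge0// invr_ge0.
  set S := \sum_(i < n) _; lra.
have {}iW : mu.-integrable D W.
  apply/integrableP; split; first exact: mDf.
  by rewrite (eq_integral W)// => x _; rewrite gee0_abs.
pose N : set T := [set x | W x \is a fin_num].
have NE x : N x = (W x < +oo)%E :> Prop by rewrite /N /= ge0_fin_numE.
have mN : measurable N.
  rewrite (_ : N = W @^-1` [set y | (y < +oo)%E]); last first.
    by apply/seteqP; split => x; rewrite NE.
  by rewrite -[X in measurable X]setTI; apply: mW => //; rewrite -set_itvNyo; exact: emeasurable_itv.
pose G x := fine (W x) `^ p^-1.
have Gp x : G x `^ p = fine (W x).
  by rewrite /G -powRrM mulVf ?gt_eqF// powRr1// fine_ge0.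
have mfW : measurable_fun setT (fine \o W).
  by apply: measurableT_comp => //; exact: fine_measurable.
(* Multiplying by the indicator of {W finite} makes the sequence converge at every point, so the
   limit is measurable on the whole space. *)
pose l i x := limn (fun k => f i k x * \1_N x).
have key x i : N x -> cvgn (f i ^~ x) /\
    forall k, `|f i k x - limn (f i ^~ x)| <= 2 * 2^-1 ^+ k * G x.
  move=> Nx; apply: geometric_cauchy; first exact: powR_ge0.
  move=> k; apply: (le_powR_inv p0) => //.
    by rewrite mulr_ge0 ?powR_ge0// exprn_ge0// invr_ge0.
  have h : w i k x <= fine (W x).
    rewrite -lee_fin fineK//; apply: (@le_trans _ _ (v k x)).
      rewrite /v (perm_big _ (perm_to_rem (mem_enum _ i)))/= big_cons leeDl//.
      by apply: sume_ge0 => j _; rewrite lee_fin.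
    apply: (@le_trans _ _ (\sum_(0 <= j < k.+1) v j x)%E).
      by rewrite big_nat_recr//= leeDr// sume_ge0.
    exact: nneseries_lim_ge.
  have h0 : 0 <= 2^-1 ^+ k :> R by rewrite exprn_ge0// invr_ge0.
  rewrite powRM ?powR_ge0// Gp -(ler_pM2l (_ : 0 < (2 `^ p) ^+ k)); last first.
    by rewrite exprn_gt0// powR_gt0.
  apply: le_trans h _.
  rewrite mulrA -{1}(mul1r (fine _)) ler_wpM2r ?fine_ge0//.
  rewrite -powR_mulrn ?powR_ge0// -(@powR_mulrn _ (2^-1)) ?invr_ge0//.
  rewrite -!powRrM (mulrC _ p) -powRM ?invr_ge0// mulfV ?powR1//.
exists l, G; split.
- move=> i; apply: (@measurable_fun_cvg _ _ _ _ (fun k x => f i k x * \1_N x)).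
    by move=> k; apply: measurable_funM => //; exact: measurable_indic.
  move=> x _; have [Nx|Nx] := pselect (N x).
    have [c _] := key x i Nx; rewrite /l indicE mem_set//.
    by under eq_fun do rewrite mulr1.
  rewrite /l indicE memNset//; under eq_fun do rewrite mulr0.
  by rewrite lim_cst//; exact: cvg_cst.
- exact: (measurableT_comp (measurable_powR _) mfW).
- by move=> x; exact: powR_ge0.
- apply: (le_integrable mD _ _ iW).
    by apply: mDf; apply/measurable_EFinP; under eq_fun do rewrite Gp.
  move=> x _ /=; rewrite Gp ger0_norm ?fine_ge0// gee0_abs//.
  by case: (W x) (W0 x) => //= r; rewrite lexx.
- move: (integrable_ae mD iW); apply: filterS => x Wx Dx i k.
  have [_ H] := key x i (Wx Dx).
  rewrite /l indicE mem_set; last exact: Wx.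
  by under eq_fun do rewrite mulr1.
Unshelve. all: by end_near. Qed.

End fast_cauchy.

Lemma gradE (R : realType) n (f : 'rV[R]_n -> R) x i : grad f x ord0 i = partial i f x.
Proof. by rewrite mxE. Qed.

(* Left transparent, these make unification unfold limits and diverge. *)
Local Opaque partial grad.

(** * Existence of the torsion function *)

Section minimization.
Context (R : realType) (p : R) (p1 : 1 < p) (m : nat) (Omega : set 'rV[R]_m.+1).
Hypotheses (oO : open Omega) (bO : bounded_set Omega).
Local Notation mu := (lebesgue_rV R m.+1).
Implicit Types phi psi : 'rV[R]_m.+1 -> R.

Let p0 : 0 < p. Proof. exact: lt_trans p1. Qed.
Let mO : measurable Omega. Proof. exact: open_rV_measurable. Qed.

Definition penergy phi : R := \int[mu]_(x in Omega) (enorm (grad phi x) `^ p).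

Definition torsion_energy phi : R :=
  p^-1 * penergy phi - \int[mu]_(x in Omega) phi x.

Local Notation J := torsion_energy.
Local Notation test := (test_fun Omega).

Lemma test_integrable phi : test phi -> mu.-integrable Omega (EFin \o phi).
Proof. by move=> /test_fun_C1[c _ _]; exact: open_integrable. Qed.

Lemma test_grad_continuous phi : test phi ->
  continuous (fun x => enorm (grad phi x) `^ p).
Proof.
move=> tphi; apply: continuous_enorm_powR => // i.
exact: continuous_grad (test_fun_C1 tphi).
Qed.

Lemma test_penergy_integrable phi : test phi ->
  mu.-integrable Omega (EFin \o (fun x => enorm (grad phi x) `^ p)).
Proof. by move=> tphi; exact: open_integrable (test_grad_continuous tphi). Qed.

Lemma test_grad_coord_continuous phi i : test phi ->
  continuous (fun x => grad phi x ord0 i).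
Proof. by move=> tphi; exact: continuous_grad (test_fun_C1 tphi). Qed.

Lemma test_gradB_continuous phi psi : test phi -> test psi ->
  continuous (fun x => enorm (grad phi x - grad psi x) `^ p).
Proof.
move=> tphi tpsi; apply: continuous_enorm_powR => // i.
under eq_fun do rewrite mxE [X in _ + X]mxE.
apply: continuous_addr; first exact: test_grad_coord_continuous.
by apply: continuous_oppr; exact: test_grad_coord_continuous.
Qed.

Lemma test_gap_continuous phi psi : test phi -> test psi ->
  continuous (fun x => convexity_gap p (grad phi x) (grad psi x)).
Proof.
move=> tphi tpsi; apply: continuous_addr; last apply: continuous_oppr.
  apply: continuous_mulr; last exact: continuous_const.
  by apply: continuous_addr; exact: test_grad_continuous.
apply: continuous_enorm_powR => // i.
under eq_fun do rewrite mxE [X in _ * X]mxE.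
apply: continuous_mulr; first exact: continuous_const.
by apply: continuous_addr; exact: test_grad_coord_continuous.
Qed.

Lemma penergy_ge0 phi : 0 <= penergy phi.
Proof. by apply: Rintegral_ge0 => x _; exact: powR_ge0. Qed.

Lemma linear_le_powR (K t : R) : 0 < K -> 0 <= t ->
  K * t <= (1 - p^-1) * (K `^ (p - 1)^-1) `^ p + p^-1 * t `^ p.
Proof.
move=> K0 t0; have := young_powR p1 (powR_ge0 K (p - 1)^-1) t0.
by rewrite -powRrM mulVf ?gt_eqF ?subr_gt0// powRr1// ltW.
Qed.

Lemma poincare_bounded : exists2 P : R, 0 < P & forall phi, test phi ->
  \int[mu]_(x in Omega) (`|phi x| `^ p) <= P * penergy phi.
Proof.
have [M M0 OM] := bounded_set_rbox bO.
exists ((2 * M) `^ p); first by rewrite powR_gt0// mulr_gt0.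
by move=> phi tphi; exact: poincare.
Qed.

(** Young's inequality absorbs the linear term: through Poincaré it costs at most half of the
    p-energy. *)
Lemma torsion_energy_coercive : exists C : R, forall phi, test phi ->
  (2 * p)^-1 * penergy phi - C <= J phi.
Proof.
have [P P0 HP] := poincare_bounded.
(* Dividing by K = 2P turns P/p, the coefficient left by Young and Poincaré, into 1/(2p). *)
pose K := 2 * P; have K0 : 0 < K by rewrite mulr_gt0.
pose c := (1 - p^-1) * (K `^ (p - 1)^-1) `^ p.
exists (K^-1 * (c * fine (mu Omega))) => phi tphi; have [cphi _ _] := test_fun_C1 tphi.
have cp : continuous (fun x => `|phi x| `^ p) by exact: continuous_compr (continuous_powR_norm p0) cphi.
have H : \int[mu]_(x in Omega) (K * phi x) <= c * fine (mu Omega) + p^-1 * (P * penergy phi).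
  apply: (@le_trans _ _ (\int[mu]_(x in Omega) (c + p^-1 * `|phi x| `^ p))).
    apply: le_Rintegral => //.
    - by apply: open_integrable => //; apply: continuous_mulr => //; exact: continuous_const.
    - apply: open_integrable => //; apply: continuous_addr; first exact: continuous_const.
      by apply: continuous_mulr => //; exact: continuous_const.
    - move=> x _; apply: le_trans (linear_le_powR K0 (normr_ge0 _)).
      by apply: ler_wpM2l; [exact: ltW|exact: ler_norm].
  rewrite RintegralD//=; last 2 first.
  - by apply: open_integrable => //; exact: continuous_const.
  - by apply: open_integrable => //; apply: continuous_mulr => //; exact: continuous_const.
  rewrite Rintegral_cst// RintegralZl//; last exact: open_integrable.
  by rewrite lerD2l ler_wpM2l ?HP// invr_ge0 ltW.
move: H; rewrite RintegralZl//; last exact: test_integrable.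
rewrite /torsion_energy -(ler_pM2l (_ : 0 < K^-1)) ?invr_gt0// mulrA mulVf ?gt_eqF// mul1r.
rewrite mulrDr (_ : K^-1 * (p^-1 * _) = (2 * p)^-1 * penergy phi); last first.
  by rewrite /K; field; rewrite !gt_eqF.
have -> : p^-1 * penergy phi = (2 * p)^-1 * penergy phi + (2 * p)^-1 * penergy phi.
  by field; rewrite gt_eqF.
lra.
Qed.

(** The term int phi is linear, so it cancels in the midpoint defect of the energy and only the gap
    of the gradients remains. *)
Lemma torsion_energy_midpoint phi psi : test phi -> test psi ->
  \int[mu]_(x in Omega) convexity_gap p (grad phi x) (grad psi x) =
  p * ((J phi + J psi) / 2 - J (fun x => 2^-1 * phi x + 2^-1 * psi x)).
Proof.
move=> tphi tpsi.
have tZ := test_funZ 2^-1 tphi.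
have tmid : test (fun x => 2^-1 * phi x + 2^-1 * psi x) by exact: test_funD.
have gmid x : grad (fun x => 2^-1 * phi x + 2^-1 * psi x) x = 2^-1 *: (grad phi x + grad psi x).
  rewrite gradD; [|exact: test_fun_C1 tZ|exact: test_fun_C1 tpsi].
  rewrite scalerDr; congr (_ + _).
  have := @gradD _ _ (fun=> 0) phi 2^-1 x; rewrite (_ : (fun x => 0 + 2^-1 * phi x) = (fun x => 2^-1 * phi x)).
    move=> ->; [|exact: test_fun_C1 (test_fun0 Omega)|exact: test_fun_C1 tphi].
    rewrite (_ : grad _ x = 0) ?add0r//; apply/rowP => i; rewrite gradE mxE.
    by have [_] := is_derive_cst (0 : R) x (delta_mx ord0 i : 'rV[R]_m.+1).
  by apply/funext => y; rewrite add0r.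
pose mid x := 2^-1 * phi x + 2^-1 * psi x.
have Em : penergy mid = \int[mu]_(x in Omega) (enorm (2^-1 *: (grad phi x + grad psi x)) `^ p).
  by apply: eq_Rintegral => x _; rewrite gmid.
pose A x := enorm (grad phi x) `^ p; pose B x := enorm (grad psi x) `^ p.
pose C x := enorm (2^-1 *: (grad phi x + grad psi x)) `^ p.
have iA : mu.-integrable Omega (EFin \o A) by exact: test_penergy_integrable.
have iB : mu.-integrable Omega (EFin \o B) by exact: test_penergy_integrable.
have iC : mu.-integrable Omega (EFin \o C).
  apply: (eq_integrable mO _ _ _ (test_penergy_integrable tmid)).
  by move=> x _; rewrite /= gmid.
have iAB : mu.-integrable Omega (EFin \o (fun x => A x + B x)).
  exact: (integrableD mO iA iB).
have iAB2 : mu.-integrable Omega (EFin \o (fun x => (A x + B x) / 2)).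
  apply: (open_integrable oO bO); apply: continuous_mulr; last exact: continuous_const.
  by apply: continuous_addr; exact: test_grad_continuous.
have E1 : \int[mu]_(x in Omega) convexity_gap p (grad phi x) (grad psi x) =
    (penergy phi + penergy psi) / 2 - penergy mid.
  rewrite Em -[LHS]/(\int[mu]_(x in Omega) ((A x + B x) / 2 - C x)).
  by rewrite (RintegralB mO iAB2 iC) (RintegralZr _ mO iAB) (RintegralD mO iA iB).
have E2 : \int[mu]_(x in Omega) mid x =
    2^-1 * \int[mu]_(x in Omega) phi x + 2^-1 * \int[mu]_(x in Omega) psi x.
  have i1 := test_integrable (test_funZ 2^-1 tphi).
  have i2 := test_integrable (test_funZ 2^-1 tpsi).
  rewrite /mid (RintegralD mO i1 i2).
  by rewrite (RintegralZl _ mO (test_integrable tphi)) (RintegralZl _ mO (test_integrable tpsi)).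
rewrite E1 /torsion_energy E2.
move: (penergy phi) (penergy psi) (penergy mid) (Rintegral _ _ phi) (Rintegral _ _ psi) => a b c u v.
by field; rewrite gt_eqF.
Qed.

Let values : set R := [set J phi | phi in test].

Let I := inf values.

Lemma torsion_energy_has_inf : has_inf values.
Proof.
split; first by exists (J (fun=> 0)); exists (fun=> 0) => //; exact: test_fun0.
have [C HC] := torsion_energy_coercive; exists (- C) => _ [phi tphi <-].
apply: le_trans (HC _ tphi); rewrite lerBrDl subrr mulr_ge0 ?penergy_ge0//.
by rewrite invr_ge0 mulr_ge0// ltW.
Qed.

Lemma torsion_energy_inf_le phi : test phi -> I <= J phi.
Proof. by move=> tphi; apply: ge_inf; [case: torsion_energy_has_inf|exists phi]. Qed.

Lemma torsion_energy_near_inf (e : R) : 0 < e -> exists2 phi, test phi & J phi < I + e.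
Proof.
move=> e0; have [_ [phi tphi <-] H] := inf_adherent e0 torsion_energy_has_inf.
by exists phi.
Qed.

(** The midpoint of two near-minimizers is a competitor with energy at least the infimum, so the
    integrated convexity gap is small; uniform convexity turns this into closeness of the gradients
    in L^p. *)
Lemma near_min_cauchy (eta : R) : 0 < eta -> exists2 del : R, 0 < del &
  forall phi psi, test phi -> test psi -> J phi < I + del -> J psi < I + del ->
    \int[mu]_(x in Omega) (enorm (grad phi x - grad psi x) `^ p) <= eta.
Proof.
move=> eta0; have [C HC] := torsion_energy_coercive.
(* By coercivity, a bound for the p-energy of every function with energy below I + 1. *)
pose B := 2 * p * (`|I| + 1 + `|C|).
have B0 : 0 < B by rewrite mulr_gt0 ?mulr_gt0// -addrA ltr_wpDl// ltr_pwDl.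
have HB phi : test phi -> J phi < I + 1 -> penergy phi <= B.
  move=> tphi Jphi; have := HC _ tphi.
  rewrite /B -ler_pdivrMl ?mulr_gt0//.
  have := ler_norm I; have := ler_norm C; lra.
have eps0 : 0 < eta / (4 * B) by rewrite divr_gt0 ?mulr_gt0.
have [K K0 HK] := uniform_convexity p1 m.+1 eps0.
(* The target eta is split evenly: eta/(4B) times the two p-energies is at most eta/2, and K times
   the integrated gap is at most K p eta/(2 p (K + 1)). *)
exists (Num.min 1 (eta / (2 * p * (K + 1)))).
  by rewrite lt_min ltr01/= divr_gt0// !mulr_gt0// ltr_wpDl.
move=> phi psi tphi tpsi; rewrite -!ltrBlDl !lt_min => /andP[J1 J1'] /andP[J2 J2'].
have {}J1 : J phi < I + 1 by rewrite -ltrBlDl.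
have {}J2 : J psi < I + 1 by rewrite -ltrBlDl.
have tmid : test (fun x => 2^-1 * phi x + 2^-1 * psi x) by apply: test_funD => //; exact: test_funZ.
have igap := open_integrable oO bO (test_gap_continuous tphi tpsi).
have isub := open_integrable oO bO (test_gradB_continuous tphi tpsi).
have i1 := test_penergy_integrable tphi; have i2 := test_penergy_integrable tpsi.
have i12 : mu.-integrable Omega (EFin \o (fun x => enorm (grad phi x) `^ p + enorm (grad psi x) `^ p)).
  exact: (integrableD mO i1 i2).
set ep := eta / (4 * B).
have ieps : mu.-integrable Omega (EFin \o (fun x => ep * (enorm (grad phi x) `^ p + enorm (grad psi x) `^ p))).
  exact: (integrableZl mO ep i12).
have iK : mu.-integrable Omega (EFin \o (fun x => K * convexity_gap p (grad phi x) (grad psi x))).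
  exact: (integrableZl mO K igap).
apply: (@le_trans _ _ (\int[mu]_(x in Omega) (ep * (enorm (grad phi x) `^ p + enorm (grad psi x) `^ p) +
   K * convexity_gap p (grad phi x) (grad psi x)))).
  apply: (le_Rintegral mO isub); first exact: (integrableD mO ieps iK).
  by move=> x _; exact: HK.
have -> : \int[mu]_(x in Omega) (ep * (enorm (grad phi x) `^ p + enorm (grad psi x) `^ p) +
   K * convexity_gap p (grad phi x) (grad psi x)) =
   ep * (penergy phi + penergy psi) + K * \int[mu]_(x in Omega) convexity_gap p (grad phi x) (grad psi x).
  rewrite (RintegralD mO ieps iK) (RintegralZl _ mO i12) (RintegralZl _ mO igap).
  by rewrite (RintegralD mO i1 i2).
rewrite torsion_energy_midpoint//.
have := torsion_energy_inf_le tmid; move: (J (fun x => _)) => Jm hJ.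
have := HB _ tphi J1; have := HB _ tpsi J2; move: (penergy phi) (penergy psi) => P2 P1 hP1 hP2.
have h1 : ep * (P2 + P1) <= eta / 2.
  rewrite /ep (_ : eta / 2 = eta / (4 * B) * (2 * B)); last by field; rewrite gt_eqF.
  by apply: ler_wpM2l; [exact: ltW|lra].
have h2 : (J phi + J psi) / 2 - Jm <= eta / (2 * p * (K + 1)) by lra.
have h3 : K * (p * ((J phi + J psi) / 2 - Jm)) <= eta / 2.
  apply: (@le_trans _ _ (K * (p * (eta / (2 * p * (K + 1)))))).
    by rewrite !ler_wpM2l// ltW.
  rewrite (_ : K * _ = eta / 2 * (K / (K + 1))); last first.
    by field; rewrite !gt_eqF// ltr_wpDl.
  apply: ler_piMr; first by rewrite divr_ge0// ltW.
  by rewrite ler_pdivrMr ?ltr_wpDl// mul1r lerDl.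
by lra.
Qed.

End minimization.

(** * Membership and convergence in L^p as integrals over the domain *)

Section Lp_bridge.
Context (R : realType) (p : R) (p0 : 0 < p) (n : nat) (Omega : set 'rV[R]_n).
Hypothesis mO : measurable Omega.
Local Notation mu := (lebesgue_rV R n).
Implicit Types f u : 'rV[R]_n -> R.

Lemma Lnorm_restrict f :
  ('N[mu]_(p%:E)[EFin \o f \_ Omega] =
   (\int[mu]_(x in Omega) (`|f x| `^ p)%:E) `^ p^-1)%E.
Proof.
rewrite unlock; suff -> : (\int[mu]_(x in Omega) (`|f x| `^ p)%:E =
  \int[mu]_x `|(EFin \o f \_ Omega) x| `^ p)%E by [].
rewrite integral_mkcond.
apply: eq_integral => x _; rewrite /= !patchE; case: ifPn => _ //=.
by rewrite normr0 powR0// gt_eqF.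
Qed.

Lemma Lp_of_integral f : measurable_fun setT f ->
  mu.-integrable Omega (EFin \o (fun x => `|f x| `^ p)) -> Lp p Omega f.
Proof.
move=> mf iF; rewrite /Lp inE /=; apply/andP; split.
  by rewrite inE /= ; apply/(measurable_restrictT _ mO); exact: measurable_funS mf.
rewrite inE /= /finite_norm Lnorm_restrict; apply: poweR_lty.
case/integrableP : iF => _; apply: le_lt_trans.
by rewrite le_eqVlt; apply/orP; left; apply/eqP; apply: eq_integral => x _; rewrite gee0_abs// lee_fin powR_ge0.
Qed.

Lemma Lp_measurable f : Lp p Omega f -> measurable_fun Omega f.
Proof.
by rewrite /Lp inE /= => /andP[+ _]; rewrite inE /= => /(measurable_restrictT _ mO).
Qed.

Lemma Lp_integrable f : Lp p Omega f ->
  mu.-integrable Omega (EFin \o (fun x => `|f x| `^ p)).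
Proof.
move=> Lf; apply/integrableP; split.
  apply/measurable_EFinP; apply: (measurableT_comp (measurable_powR p)).
  by apply: measurableT_comp => //; exact: Lp_measurable.
have : finite_norm mu p%:E (f \_ Omega).
  by move: Lf; rewrite /Lp inE /= => /andP[_]; rewrite inE.
rewrite /finite_norm => H.
have E : (\int[mu]_(x in Omega) (`|f x| `^ p)%:E = 'N[mu]_(p%:E)[EFin \o f \_ Omega] `^ p)%E.
  rewrite Lnorm_restrict -poweRrM mulVf ?gt_eqF// poweRe1//.
  by apply: integral_ge0 => x _; rewrite lee_fin powR_ge0.
under eq_integral do rewrite gee0_abs ?lee_fin ?powR_ge0//.
by rewrite E; exact: poweR_lty.
Qed.

Lemma poweR_cvg0 (s : R) (f : nat -> \bar R) : 0 < s -> (forall k, 0 <= f k)%E ->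
  f k @[k --> \oo] --> 0%E -> (f k `^ s)%E @[k --> \oo] --> 0%E.
Proof.
move=> s0 f0 /fine_cvgP[ff fc]; apply/fine_cvgP; split.
  by move: ff; apply: filterS => k fk; rewrite -(fineK fk) poweR_EFin.
have H : `|fine (f k)| `^ s @[k --> \oo] --> (0 : R).
  have c : {for (0 : R), continuous (fun t : R => `|t| `^ s)} by exact: continuous_powR_norm.
  have s_neq0 : s != 0 by rewrite gt_eqF.
  have := continuous_cvg _ c fc; rewrite normr0 powR0//; apply.
apply: cvg_trans H; apply: near_eq_cvg; move: ff; apply: filterS => k fk.
by rewrite /= -{2}(fineK fk) poweR_EFin/= ger0_norm// fine_ge0.
Qed.

Lemma Lp_cvg_of_integral v u :
  (\int[mu]_(x in Omega) (`|v k x - u x| `^ p)%:E)%E @[k --> \oo] --> 0%E ->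
  Lp_cvg p Omega v u.
Proof.
move=> H; rewrite /Lp_cvg; under eq_fun do rewrite Lnorm_restrict.
apply: poweR_cvg0 => //; first by rewrite invr_gt0.
by move=> k; apply: integral_ge0 => x _; rewrite lee_fin powR_ge0.
Qed.

Lemma Lp_cvg_integral v u : Lp_cvg p Omega v u ->
  (\int[mu]_(x in Omega) (`|v k x - u x| `^ p)%:E)%E @[k --> \oo] --> 0%E.
Proof.
move=> /(poweR_cvg0 p0) H; have {H} := H (fun k => Lnorm_ge0 _ _ _).
apply: cvg_trans; apply: near_eq_cvg; near=> k.
rewrite Lnorm_restrict -poweRrM mulVf ?gt_eqF// poweRe1//.
by apply: integral_ge0 => x _; rewrite lee_fin powR_ge0.
Unshelve. all: by end_near. Qed.

End Lp_bridge.

Section power_sums.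
Context (R : realType) (p : R) (p1 : 1 < p).
Implicit Types a b t : R.

Let p0 : 0 < p. Proof. exact: lt_trans p1. Qed.

Lemma powR_add_le a b : 0 <= a -> 0 <= b ->
  (a + b) `^ p <= 2 `^ p * (a `^ p + b `^ p).
Proof.
move=> a0 b0; wlog ab : a b a0 b0 / a <= b.
  move=> H; have [ab|/ltW ba] := leP a b; first exact: H.
  by rewrite addrC (addrC (a `^ p)); exact: H.
apply: (@le_trans _ _ ((2 * b) `^ p)).
  by apply: ge0_ler_powR; rewrite ?nnegrE ?(ltW p0) ?addr_ge0 ?mulr_ge0//; lra.
by rewrite powRM// ler_wpM2l ?powR_ge0// lerDr powR_ge0.
Qed.

Lemma le_1powR t : 0 <= t -> t <= 1 + t `^ p.
Proof.
move=> t0; have [t1|/ltW t1] := leP t 1; first by rewrite (le_trans t1)// lerDl powR_ge0.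
by apply: (le_trans (le1r_powR t1 (ltW p1))); rewrite lerDr.
Qed.

Lemma powRB1_le t : 0 <= t -> t `^ (p - 1) <= 1 + t `^ p.
Proof.
move=> t0; have [t1|/ltW t1] := leP t 1.
  apply: (@le_trans _ _ 1); last by rewrite lerDl powR_ge0.
  have E : 1 `^ (p - 1) = 1 :> R by rewrite powR1.
  rewrite -[leRHS]E.
  by apply: ge0_ler_powR; rewrite ?nnegrE ?subr_ge0 ?(ltW p1)//.
apply: (@le_trans _ _ (t `^ p)); last by rewrite lerDr.
by apply: ler_powR => //; rewrite gerBl.
Qed.

(** Young's inequality with a small parameter and a non-sharp constant: either b <= del a, or a is
    below b/del. *)
Lemma mul_powRB1_le (del a b : R) : 0 < del -> 0 <= a -> 0 <= b ->
  a `^ (p - 1) * b <= del * a `^ p + del `^ (1 - p) * b `^ p.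
Proof.
move=> d0 a0 b0; have [ab|ba] := leP b (del * a).
  apply: (@le_trans _ _ (del * a `^ p)); last by rewrite lerDl mulr_ge0 ?powR_ge0.
  rewrite -(mulr_powRB1 a0 p0) mulrA mulrC ler_wpM2r ?powR_ge0//.
have adb : a <= del^-1 * b by rewrite ler_pdivlMl// ltW.
apply: (@le_trans _ _ (del `^ (1 - p) * b `^ p)); last by rewrite lerDr mulr_ge0 ?powR_ge0// ltW.
apply: (@le_trans _ _ ((del^-1 * b) `^ (p - 1) * b)).
  apply: ler_wpM2r => //; apply: ge0_ler_powR; rewrite ?nnegrE ?subr_ge0 ?(ltW p1)//.
  by rewrite mulr_ge0// invr_ge0 ltW.
rewrite powRM// ?invr_ge0 ?(ltW d0)// -powR_inv1 ?(ltW d0)// -powRrM mulN1r opprB.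
by rewrite -mulrA (mulrC _ b) mulr_powRB1.
Qed.

(** Same dichotomy as in [mul_powRB1_le]. The point is the leading factor, which tends to 1 with
    del: it keeps the energy of approximations sharp in the limit. *)
Lemma powR_add_le_eps (del a b : R) : 0 < del -> 0 <= a -> 0 <= b ->
  (a + b) `^ p <= (1 + del) `^ p * a `^ p + (1 + del^-1) `^ p * b `^ p.
Proof.
move=> d0 a0 b0; have di0 : 0 <= 1 + del^-1 by rewrite addr_ge0// invr_ge0 ltW.
have d1 : 0 <= 1 + del by rewrite addr_ge0// ltW.
have [ba|ab] := leP b (del * a).
  apply: (@le_trans _ _ ((1 + del) `^ p * a `^ p)); last by rewrite lerDl mulr_ge0 ?powR_ge0.
  rewrite -powRM//; apply: ge0_ler_powR; rewrite ?nnegrE ?(ltW p0) ?addr_ge0 ?mulr_ge0//.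
  by rewrite mulrDl mul1r lerD2l.
apply: (@le_trans _ _ ((1 + del^-1) `^ p * b `^ p)); last by rewrite lerDr mulr_ge0 ?powR_ge0.
rewrite -powRM//; apply: ge0_ler_powR; rewrite ?nnegrE ?(ltW p0) ?addr_ge0 ?mulr_ge0//.
by rewrite mulrDl mul1r addrC lerD2l ler_pdivlMl// ltW.
Qed.

End power_sums.

Section integrable_real.
Context d (T : measurableType d) (R : realType) (mu : {measure set T -> \bar R}).
Variables (D : set T) (mD : measurable D).
Implicit Types f g : T -> R.

Lemma integrable_addr f g : mu.-integrable D (EFin \o f) -> mu.-integrable D (EFin \o g) ->
  mu.-integrable D (EFin \o (fun x => f x + g x)).
Proof. by move=> iF ig; exact: (integrableD mD iF ig). Qed.

Lemma integrable_mull k f : mu.-integrable D (EFin \o f) ->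
  mu.-integrable D (EFin \o (fun x => k * f x)).
Proof. by move=> iF; exact: (integrableZl mD k iF). Qed.

Lemma integrable_subr f g : mu.-integrable D (EFin \o f) -> mu.-integrable D (EFin \o g) ->
  mu.-integrable D (EFin \o (fun x => f x - g x)).
Proof. by move=> iF ig; exact: (integrableB mD iF ig). Qed.

End integrable_real.

(** * Minimizing sequences and their almost everywhere limit *)

Section torsion_existence.
Context (R : realType) (p : R) (p1 : 1 < p) (m : nat) (Omega : set 'rV[R]_m.+1).
Hypotheses (oO : open Omega) (bO : bounded_set Omega).
Local Notation mu := (lebesgue_rV R m.+1).
Local Notation J := (torsion_energy p Omega).
Local Notation test := (test_fun Omega).
Local Notation I := (inf [set J phi | phi in test]).
Implicit Types phi psi : 'rV[R]_m.+1 -> R.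

Let p0 : 0 < p. Proof. exact: lt_trans p1. Qed.
Let mO : measurable Omega. Proof. exact: open_rV_measurable. Qed.

(** The excess over the infimum is the square of 1/(k+1) because the weak equation is extracted
    later with a perturbation of size 1/(k+1), and the excess is divided by that size. *)
Lemma minimizing_sequence (eta : nat -> R) : (forall k, 0 < eta k) ->
  exists phi : nat -> 'rV[R]_m.+1 -> R,
  [/\ forall k, test (phi k), forall k, J (phi k) < I + (k.+1%:R^-1) ^+ 2 &
    forall k, \int[mu]_(x in Omega) (enorm (grad (phi k.+1) x - grad (phi k) x) `^ p) <= eta k].
Proof.
move=> eta0.
have /choice[del hdel] : forall k, exists del : R, 0 < del /\
  forall phi psi, test phi -> test psi -> J phi < I + del -> J psi < I + del ->
    \int[mu]_(x in Omega) (enorm (grad phi x - grad psi x) `^ p) <= eta k.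
  by move=> k; have [del d0 H] := near_min_cauchy p1 oO bO (eta0 k); exists del.
(* Tolerances decreasing in k, below both [del k] and (k+1)^-2; monotonicity makes phi_(k+1) a
   near-minimizer at level k too, so consecutive terms can be compared. *)
pose dm := fix dm (k : nat) : R := if k is j.+1
  then Num.min (dm j) (Num.min (del k) ((k.+1%:R^-1) ^+ 2))
  else Num.min (del 0%N) 1.
have dm0 k : 0 < dm k.
  elim: k => [|k IH] /=; rewrite !lt_min; first by rewrite ltr01 andbT; have [] := hdel 0%N.
  by rewrite IH exprn_gt0 ?invr_gt0// andbT; have [] := hdel k.+1.
have dmS k : dm k.+1 <= dm k by rewrite /= ge_min lexx.
have dmd k : dm k <= del k.
  by case: k => [|k] /=; rewrite !ge_min lexx// orbT.
have dmk k : dm k <= (k.+1%:R^-1) ^+ 2.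
  case: k => [|k] /=; first by rewrite invr1 expr1n ge_min lexx orbT.
  by rewrite !ge_min lexx !orbT.
have /choice[phi hphi] : forall k, exists phi, test phi /\ J phi < I + dm k.
  by move=> k; have [phi tphi H] := torsion_energy_near_inf p1 oO bO (dm0 k); exists phi.
exists phi; split => k.
- by have [] := hphi k.
- by have [_ H] := hphi k; apply: lt_le_trans H _; rewrite lerD2l.
- have [_ H] := hdel k; have [t1 J1] := hphi k.+1; have [t2 J2] := hphi k; apply: H => //.
    by apply: lt_le_trans J1 _; rewrite lerD2l (le_trans (dmS k)).
  by apply: lt_le_trans J2 _; rewrite lerD2l.
Qed.

Lemma torsion_limit : exists (phi : nat -> 'rV[R]_m.+1 -> R) (u : 'rV[R]_m.+1 -> R)
    (g : 'rV[R]_m.+1 -> 'rV[R]_m.+1) (G : 'rV[R]_m.+1 -> R),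
  [/\ forall k, test (phi k) /\ J (phi k) < I + (k.+1%:R^-1) ^+ 2,
      measurable_fun setT u /\ measurable_fun setT g,
      measurable_fun setT G /\ forall x, 0 <= G x,
      mu.-integrable Omega (EFin \o (fun x => G x `^ p)) &
      \forall x \ae mu, Omega x -> forall k, `|phi k x - u x| <= 2 * 2^-1 ^+ k * G x /\
        forall i, `|grad (phi k) x ord0 i - g x ord0 i| <= 2 * 2^-1 ^+ k * G x].
Proof.
have th0 k : 0 < ((2 `^ p * 2)^-1 : R) ^+ k by rewrite exprn_gt0// invr_gt0 mulr_gt0// powR_gt0.
have [phi [tphi Jphi dphi]] := minimizing_sequence th0.
have [P P0 HP] := poincare_bounded p1 oO bO.
(* [None] stands for the function itself and [Some j] for its j-th partial derivative, so one call
   of [fast_cauchy_Lp] serves all. *)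
pose f (i : option 'I_m.+1) k x := if i is Some j then grad (phi k) x ord0 j else phi k x.
have cf i k : continuous (f i k).
  case: i => [i|] /=; first exact: test_grad_coord_continuous (tphi k).
  by have [] := test_fun_C1 (tphi k).
have tB k : test (fun x => phi k.+1 x + (-1) * phi k x) by exact: test_funD.
have gB k x : grad (fun x => phi k.+1 x + (-1) * phi k x) x = grad (phi k.+1) x - grad (phi k) x.
  by rewrite gradD ?scaleN1r//; exact: test_fun_C1 (tphi _).
have eB k : penergy p Omega (fun x => phi k.+1 x + (-1) * phi k x) <= (2 `^ p * 2)^-1 ^+ k.
  apply: le_trans (dphi k); rewrite le_eqVlt; apply/orP; left; apply/eqP.
  by apply: eq_Rintegral => x _; rewrite gB.
have [|||l [G [ml mG G0 iG aeG]]] := @fast_cauchy_Lp _ _ _ mu Omega p (P + 1) (option 'I_m.+1) f p0 _ mO.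
- by rewrite addr_ge0// ltW.
- by move=> i k; exact: continuous_rV_measurable.
- move=> i k; have ci : mu.-integrable Omega (EFin \o (fun x => `|f i k.+1 x - f i k x| `^ p)).
    apply: (open_integrable oO bO); apply: (continuous_compr (continuous_powR_norm p0)).
    by apply: continuous_addr; [exact: cf|apply: continuous_oppr; exact: cf].
  rewrite -(fineK (integrable_fin_num mO ci)) lee_fin.
  have h0 := ltW (th0 k).
  apply: (@le_trans _ _ (Num.max P 1 * (2 `^ p * 2)^-1 ^+ k)); last first.
    by apply: ler_wpM2r => //; rewrite ge_max lerDl ler01 lerDr ltW.
  case: i ci => [i|] /= ci.
    apply: (@le_trans _ _ (1 * (2 `^ p * 2)^-1 ^+ k)); last first.
      by apply: ler_wpM2r => //; rewrite le_max lexx orbT.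
    rewrite mul1r; apply: le_trans (dphi k).
    apply: (le_Rintegral mO ci (open_integrable oO bO (test_gradB_continuous p1 (tphi _) (tphi _)))).
    move=> x _; apply: ge0_ler_powR; rewrite ?nnegrE ?(ltW p0) ?enorm_ge0//.
    by have := enorm_coord (grad (phi k.+1) x - grad (phi k) x) i; rewrite mxE [X in _ + X]mxE.
  apply: (@le_trans _ _ (P * (2 `^ p * 2)^-1 ^+ k)); last first.
    by apply: ler_wpM2r => //; rewrite le_max lexx.
  apply: (@le_trans _ _ (P * penergy p Omega (fun x => phi k.+1 x + (-1) * phi k x))); last first.
    by apply: ler_wpM2l; [exact: ltW|exact: eB].
  apply: le_trans (HP _ (tB k)).
  rewrite le_eqVlt; apply/orP; left; apply/eqP.
  by apply: eq_Rintegral => x _; rewrite mulN1r.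
exists phi, (l None), (fun x => \row_i l (Some i) x), G; split => //.
- split; first exact: ml.
  by apply: measurable_rVP => i; under eq_fun do rewrite mxE; exact: ml.
- move: aeG; apply: filterS => x H Ox k; have {}H := H Ox; split; first exact: H None k.
  by move=> i; rewrite mxE; exact: H (Some i) k.
Qed.

Lemma finite_integrable_cst (c : R) : mu.-integrable Omega (EFin \o cst c).
Proof. by apply: (open_integrable oO bO (f := fun=> c)) => x; exact: cst_continuous. Qed.

Lemma integrable_ae_le (f h : 'rV[R]_m.+1 -> R) : measurable_fun setT f ->
  (forall x, 0 <= f x) -> measurable_fun setT h -> (forall x, 0 <= h x) ->
  mu.-integrable Omega (EFin \o h) -> (\forall x \ae mu, Omega x -> f x <= h x) ->
  mu.-integrable Omega (EFin \o f).
Proof.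
move=> mf f0 mh h0 ih fh; apply/integrableP; split.
  by apply/measurable_EFinP; exact: measurable_funS mf.
case/integrableP : ih => _; apply: le_lt_trans.
apply: ae_ge0_le_integral => //.
- by apply/measurable_EFinP; apply: measurableT_comp => //; exact: measurable_funS mf.
- by apply/measurable_EFinP; apply: measurableT_comp => //; exact: measurable_funS mh.
- move: fh; apply: filterS => x fh Ox /=; rewrite lee_fin !ger0_norm//.
  exact: fh.
Qed.

Lemma torsion_approximation : exists (phi : nat -> 'rV[R]_m.+1 -> R) (u : 'rV[R]_m.+1 -> R)
    (g : 'rV[R]_m.+1 -> 'rV[R]_m.+1) (H : 'rV[R]_m.+1 -> R),
  [/\ forall k, test (phi k) /\ J (phi k) < I + (k.+1%:R^-1) ^+ 2,
      measurable_fun setT u /\ measurable_fun setT g,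
      measurable_fun setT H /\ forall x, 0 <= H x,
      mu.-integrable Omega (EFin \o (fun x => H x `^ p)) &
      \forall x \ae mu, Omega x ->
        [/\ phi k x @[k --> \oo] --> u x, grad (phi k) x @[k --> \oo] --> g x,
            `|u x| <= H x /\ enorm (g x) <= H x &
            forall k, `|phi k x| <= H x /\ enorm (grad (phi k) x) <= H x] ].
Proof.
have [phi [u [g [G [tphi [mu' mg] [mG G0] iG aeG]]]]] := torsion_limit.
pose c x := `|phi 0%N x| + enorm (grad (phi 0%N) x).
pose N : R := m.+1%:R; have N1 : 1 <= N by rewrite ler1n.
(* Passing from phi_0 to the limit costs 2G per coordinate, and from the limit to phi_k another 2G;
   the norm of the gradient sums N coordinates. *)
pose H x := c x + 4 * N * G x.
have t0 k := (tphi k).1.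
have cc : continuous c.
  apply: continuous_addr.
    by apply: (continuous_compr (@norm_continuous _ _)); have [] := test_fun_C1 (t0 0%N).
  by apply: continuous_enorm_comp => i; exact: test_grad_coord_continuous (t0 0%N).
have c0 x : 0 <= c x by rewrite addr_ge0// enorm_ge0.
have NG0 x : 0 <= 4 * N * G x by rewrite !mulr_ge0// (le_trans ler01).
have mH : measurable_fun setT H.
  apply: measurable_funD; first exact: continuous_rV_measurable.
  exact: measurable_funM.
exists phi, u, g, H; split => //.
- by split => // x; rewrite addr_ge0.
- have icp : mu.-integrable Omega (EFin \o (fun x => 2 `^ p * (c x `^ p + (4 * N) `^ p * G x `^ p))).
    apply: (integrable_mull mO); apply: (integrable_addr mO).
      apply: (open_integrable oO bO).
      have := continuous_compr (continuous_powR_norm p0) cc.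
      by under eq_fun do rewrite ger0_norm ?c0//.
    exact: (integrable_mull mO _ iG).
  apply: integrable_ae_le icp _.
  + exact: (measurableT_comp (measurable_powR p) mH).
  + by move=> x; exact: powR_ge0.
  + apply: measurable_funM => //; apply: measurable_funD.
      by apply: (measurableT_comp (measurable_powR p)); exact: continuous_rV_measurable.
    by apply: measurable_funM => //; exact: (measurableT_comp (measurable_powR p)).
  + by move=> x; rewrite !(mulr_ge0, addr_ge0, powR_ge0).
  + apply: aeW => x _; apply: le_trans (powR_add_le p1 (c0 x) (NG0 x)) _.
    rewrite ler_wpM2l ?powR_ge0// lerD2l powRM//.
    by rewrite mulr_ge0// (le_trans ler01).
- move: aeG; apply: filterS => x H0 Ox; have {}H0 := H0 Ox.
  have cv0 : 2 * 2^-1 ^+ k * G x @[k --> \oo] --> 0.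
    rewrite -[X in _ --> X](mul0r (G x)); apply: cvgM; last exact: cvg_cst.
    rewrite -[X in _ --> X](mulr0 2); apply: cvgM; first exact: cvg_cst.
    by apply: cvg_expr; rewrite ger0_norm ?invr_ge0// invf_lt1 ?ltr1n.
  have sq (v : nat -> R) (l : R) : (forall k, `|v k - l| <= 2 * 2^-1 ^+ k * G x) ->
      v k @[k --> \oo] --> l.
    move=> vl; apply/cvgrPdist_le => e e0; move/cvgr0_norm_le : cv0 => /(_ e e0).
    apply: filterS => k; rewrite distrC; apply: le_trans.
    by apply: le_trans (vl k) _; exact: ler_norm.
  have q1 k : (2^-1 : R) ^+ k <= 1 by rewrite exprn_ile1 ?invr_ge0// invf_le1 ?ler1n.
  have q0 k : 0 <= (2^-1 : R) ^+ k by rewrite exprn_ge0// invr_ge0.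
  have gx := G0 x.
  have H2 k : `|phi k x - u x| <= 2 * G x.
    by have [h _] := H0 k; apply: le_trans h _; rewrite ler_wpM2r// ler_piMr.
  have H3 k : enorm (grad (phi k) x - g x) <= 2 * N * G x.
    apply: le_trans (enorm_le_sum _) _.
    apply: (@le_trans _ _ (\sum_(i < m.+1) 2 * G x)); last first.
      by rewrite sumr_const card_ord -mulr_natr -/N; lra.
    apply: ler_sum => i _; rewrite mxE [X in _ + X]mxE.
    by have [_ h] := H0 k; apply: le_trans (h i) _; rewrite ler_wpM2r// ler_piMr.
  have NG : G x <= N * G x by rewrite ler_peMl.
  have e0 := enorm_ge0 (grad (phi 0%N) x); have n0 := normr_ge0 (phi 0%N x).
  have Hu : `|u x| <= `|phi 0%N x| + 2 * G x.
    have := H2 0%N; rewrite distrC => h.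
    by rewrite -[u x](subrK (phi 0%N x)) addrC (le_trans (ler_normD _ _))// lerD2l.
  have Hg : enorm (g x) <= enorm (grad (phi 0%N) x) + 2 * N * G x.
    have := H3 0%N; rewrite enormB => h.
    by rewrite -[g x](subrK (grad (phi 0%N) x)) addrC (le_trans (enormD _ _))// lerD2l.
  split.
  + by apply: sq => k; have [] := H0 k.
  + by apply: cvg_rV => i; apply: sq => k; have [_] := H0 k.
  + by rewrite /H /c; split; lra.
  + move=> k; rewrite /H /c; split.
      have := ler_normD (phi k x - u x) (u x); rewrite subrK; have := H2 k; lra.
    have := enormD (grad (phi k) x - g x) (g x); rewrite subrK; have := H3 k; lra.
Qed.

End torsion_existence.

(** * The limit solves the weak equation *)

Section existence.
Context (R : realType) (p : R) (p1 : 1 < p) (m : nat) (Omega : set 'rV[R]_m.+1).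
Hypotheses (oO : open Omega) (bO : bounded_set Omega).
Local Notation mu := (lebesgue_rV R m.+1).
Local Notation test := (test_fun Omega).
Implicit Types (f h : 'rV[R]_m.+1 -> R).

Let p0 : 0 < p. Proof. exact: lt_trans p1. Qed.
Let mO : measurable Omega. Proof. exact: open_rV_measurable. Qed.

Variable H : 'rV[R]_m.+1 -> R.
Hypotheses (mH : measurable_fun setT H) (H0 : forall x, 0 <= H x)
  (iH : mu.-integrable Omega (EFin \o (fun x => H x `^ p))).

Let mHp : measurable_fun setT (fun x => H x `^ p).
Proof. exact: (measurableT_comp (measurable_powR p) mH). Qed.

Lemma powR_norm_measurable f : measurable_fun setT f ->
  measurable_fun setT (fun x => `|f x| `^ p).
Proof.
by move=> mf; apply: (measurableT_comp (measurable_powR p)); exact: measurableT_comp.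
Qed.

Lemma Lp_ae_le f : measurable_fun setT f ->
  (\forall x \ae mu, Omega x -> `|f x| <= H x) -> Lp p Omega f.
Proof.
move=> mf fH; apply: Lp_of_integral => //.
apply: (integrable_ae_le oO (powR_norm_measurable mf) _ mHp _ iH) => [x|x|].
- exact: powR_ge0.
- exact: powR_ge0.
- by move: fH; apply: filterS => x fH Ox; apply: ge0_ler_powR; rewrite ?nnegrE ?(ltW p0)//; exact: fH.
Qed.

Lemma Lp_cvg_dominated (h : nat -> 'rV[R]_m.+1 -> R) f :
  (forall k, measurable_fun setT (h k)) -> measurable_fun setT f ->
  (\forall x \ae mu, Omega x -> [/\ h k x @[k --> \oo] --> f x, `|f x| <= H x &
    forall k, `|h k x| <= H x]) -> Lp_cvg p Omega h f.
Proof.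
move=> mh mf hf; apply: Lp_cvg_of_integral => //.
pose K x := 2 `^ p * H x `^ p.
have iK : mu.-integrable Omega (EFin \o K) by exact: integrable_mull.
have mK : measurable_fun setT K by apply: measurable_funM.
have mhf k : measurable_fun setT (fun x => `|h k x - f x| `^ p).
  by apply: powR_norm_measurable; exact: measurable_funB.
have hfK : \forall x \ae mu, Omega x -> forall k, `|h k x - f x| `^ p <= K x.
  move: hf; apply: filterS => x hf Ox k; have [_ fx hx] := hf Ox.
  rewrite /K -powRM//; apply: ge0_ler_powR; rewrite ?nnegrE ?(ltW p0) ?mulr_ge0//.
  by apply: (le_trans (ler_normB _ _)); have := hx k; lra.
have ihf k : mu.-integrable Omega (EFin \o (fun x => `|h k x - f x| `^ p)).
  apply: (integrable_ae_le oO (mhf k) _ mK _ iK) => [x|x|].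
  - exact: powR_ge0.
  - by rewrite mulr_ge0 ?powR_ge0.
  - by move: hfK; apply: filterS => x hfK Ox; exact: hfK.
have [|||||_ C] := @Rintegral_dominated_cvg _ _ _ mu Omega (fun k x => `|h k x - f x| `^ p)
  (fun=> 0) K mO.
- by move=> k; exact: measurable_funS (mhf k).
- exact: measurable_cst.
- move: hf; apply: filterS => x hf Ox; have [hx _ _] := hf Ox.
  have c : {for (0 : R), continuous (fun t : R => `|t| `^ p)} by exact: continuous_powR_norm.
  have hx0 : h k x - f x @[k --> \oo] --> (0 : R).
    by rewrite -(subrr (f x)); apply: cvgB => //; exact: cvg_cst.
  have p_neq0 : p != 0 by rewrite gt_eqF.
  by have := continuous_cvg _ c hx0; rewrite normr0 powR0//; apply.
- exact: iK.
- move: hfK; apply: filterS => x hfK Ox k.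
  by rewrite ger0_norm ?powR_ge0//; exact: hfK.
rewrite Rintegral_cst// mul0r in C.
suff -> : (fun k => \int[mu]_(x in Omega) (`|h k x - f x| `^ p)%:E)%E =
  (fun k => (\int[mu]_(x in Omega) (`|h k x - f x| `^ p))%:E) by apply: cvg_EFin => //; exact: nearW.
by apply/funext => k; rewrite fineK// (integrable_fin_num mO (ihf k)).
Qed.

(** Both t and t^(p-1) are at most 1 + t^p, so this single majorant serves for values, gradients and
    fluxes tested against bounded functions. *)
Lemma integrable_dominated (K : R) : 0 <= K ->
  mu.-integrable Omega (EFin \o (fun x => K * (1 + H x `^ p))).
Proof.
move=> K0; apply: (integrable_mull mO); apply: (integrable_addr mO) => //.
exact: finite_integrable_cst.
Qed.

Lemma weak_gradient_limit (phi : nat -> 'rV[R]_m.+1 -> R)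
    (u : 'rV[R]_m.+1 -> R) (g : 'rV[R]_m.+1 -> 'rV[R]_m.+1) i (psi : 'rV[R]_m.+1 -> R) :
  (forall k, test (phi k)) -> measurable_fun setT u -> measurable_fun setT g ->
  (\forall x \ae mu, Omega x ->
    [/\ phi k x @[k --> \oo] --> u x, grad (phi k) x @[k --> \oo] --> g x,
        `|u x| <= H x /\ enorm (g x) <= H x &
        forall k, `|phi k x| <= H x /\ enorm (grad (phi k) x) <= H x]) ->
  test psi ->
  \int[mu]_(x in Omega) (u x * partial i psi x) =
  - \int[mu]_(x in Omega) (g x ord0 i * psi x).
Proof.
move=> tphi mu' mg ae tpsi.
have [cpsi dpsi _] := test_fun_C1 tpsi.
have [K1 K10 HK1] := continuous_bounded cpsi bO.
have [K2 K20 HK2] := continuous_bounded (dpsi i) bO.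
have mgi : measurable_fun setT (fun x => g x ord0 i).
  exact: (measurableT_comp (measurable_coord i) mg).
have mphi k : measurable_fun setT (phi k).
  by apply: continuous_rV_measurable; have [] := test_fun_C1 (tphi k).
have mdphi k : measurable_fun setT (partial i (phi k)).
  by apply: continuous_rV_measurable; have [] := test_fun_C1 (tphi k).
have mpsi : measurable_fun setT psi by exact: continuous_rV_measurable.
have mdpsi : measurable_fun setT (partial i psi) by exact: continuous_rV_measurable.
have [|||||_ C1'] := @Rintegral_dominated_cvg _ _ _ mu Omega
  (fun k x => phi k x * partial i psi x) (fun x => u x * partial i psi x)
  (fun x => K2 * (1 + H x `^ p)) mO.
- by move=> k; apply: (@measurable_funS _ _ _ _ setT) => //; exact: measurable_funM.
- by apply: (@measurable_funS _ _ _ _ setT) => //; exact: measurable_funM.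
- move: ae; apply: filterS => x ae Ox; have [h _ _ _] := ae Ox.
  by apply: cvgM; [exact: h|exact: cvg_cst].
- exact: integrable_dominated (ltW K20).
- move: ae; apply: filterS => x ae Ox k; have [_ _ _ /(_ k)[h _]] := ae Ox.
  rewrite normrM mulrC; apply: ler_pM; rewrite ?normr_ge0//; first exact: HK2.
  by apply: (le_trans h); exact: le_1powR.
have [|||||_ C2'] := @Rintegral_dominated_cvg _ _ _ mu Omega
  (fun k x => partial i (phi k) x * psi x) (fun x => g x ord0 i * psi x)
  (fun x => K1 * (1 + H x `^ p)) mO.
- by move=> k; apply: (@measurable_funS _ _ _ _ setT) => //; exact: measurable_funM.
- by apply: (@measurable_funS _ _ _ _ setT) => //; exact: measurable_funM.
- move: ae; apply: filterS => x ae Ox; have [_ h _ _] := ae Ox.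
  apply: cvgM; last exact: cvg_cst.
  have c : {for g x, continuous (fun y : 'rV[R]_m.+1 => y ord0 i)} by exact: coord_continuous.
  by under eq_fun do rewrite -gradE; exact: (continuous_cvg _ c h).
- exact: integrable_dominated (ltW K10).
- move: ae; apply: filterS => x ae Ox k; have [_ _ _ /(_ k)[_ h]] := ae Ox.
  rewrite normrM mulrC; apply: ler_pM; rewrite ?normr_ge0//; first exact: HK1.
  apply: le_trans (le_1powR p1 (H0 x)); apply: le_trans h.
  by rewrite -gradE; exact: enorm_coord.
have C3 : \int[mu]_(x in Omega) (phi k x * partial i psi x) @[k --> \oo] -->
    - \int[mu]_(x in Omega) (g x ord0 i * psi x).
  under eq_fun do rewrite (test_ibp oO bO i (tphi _) tpsi).
  exact: (cvgN C2').
exact: (cvg_unique _ C1' C3).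
Qed.

(** Euler-Lagrange inequality at a near-minimizer: the tangent inequality at grad (phi + t psi)
    bounds the p-energy of phi from below, near-minimality allows a drop of at most t^2, and
    division by t leaves the error t. *)
Lemma near_min_flux_ge (phi psi : 'rV[R]_m.+1 -> R) (t : R) : test phi -> test psi -> 0 < t ->
  torsion_energy p Omega phi < inf [set torsion_energy p Omega phi | phi in test] + t ^+ 2 ->
  \int[mu]_(x in Omega) psi x - t <=
  \int[mu]_(x in Omega) pflux p (grad phi x + t *: grad psi x) (grad psi x).
Proof.
move=> tphi tpsi t0 Jphi.
have tv : test (fun x => phi x + t * psi x) by exact: test_funD.
have Ev x : grad (fun x => phi x + t * psi x) x = grad phi x + t *: grad psi x.
  by rewrite gradD//; [exact: test_fun_C1 tphi|exact: test_fun_C1 tpsi].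
pose F x := pflux p (grad phi x + t *: grad psi x) (grad psi x).
have mG f : test f -> measurable_fun setT (grad f).
  by move=> tf; apply: continuous_vector_measurable => i; exact: test_grad_coord_continuous tf.
have mF : measurable_fun setT F.
  apply: measurable_pflux; last exact: mG.
  have -> : (fun x => grad phi x + t *: grad psi x) = grad (fun x => phi x + t * psi x).
    by apply/funext => x; rewrite Ev.
  exact: mG.
have iv := test_penergy_integrable p1 oO bO tv.
have ipsi := test_penergy_integrable p1 oO bO tpsi.
have iphi := test_penergy_integrable p1 oO bO tphi.
have iF : mu.-integrable Omega (EFin \o F).
  pose B x := 1 * enorm (grad (fun x => phi x + t * psi x) x) `^ p +
     1 `^ (1 - p) * enorm (grad psi x) `^ p.
  have iB : mu.-integrable Omega (EFin \o B).
    exact: (integrable_addr mO (integrable_mull mO 1 iv) (integrable_mull mO (1 `^ (1 - p)) ipsi)).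
  apply: (le_integrable mO _ _ iB).
    by apply/measurable_EFinP; exact: measurable_funS mF.
  move=> x _ /=; rewrite lee_fin [leRHS]ger0_norm; last first.
    by rewrite addr_ge0// mulr_ge0 ?powR_ge0.
  rewrite /B Ev; apply: (le_trans (pflux_le p1 _ _)).
  by apply: mul_powRB1_le => //; exact: enorm_ge0.
have JI := torsion_energy_inf_le p1 oO bO tv.
have Ephi : \int[mu]_(x in Omega) (phi x + t * psi x) =
    \int[mu]_(x in Omega) phi x + t * \int[mu]_(x in Omega) psi x.
  have i1 := test_integrable oO bO tphi; have i2 := test_integrable oO bO tpsi.
  by rewrite (RintegralD mO i1 (integrable_mull mO t i2)) (RintegralZl _ mO i2).
have tangent : penergy p Omega (fun x => phi x + t * psi x) +
    (- (p * t)) * \int[mu]_(x in Omega) F x <= penergy p Omega phi.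
  rewrite -(RintegralZl _ mO iF) -(RintegralD mO iv (integrable_mull mO _ iF)).
  apply: (le_Rintegral mO (integrable_addr mO iv (integrable_mull mO _ iF)) iphi) => x _.
  have := pflux_tangent p1 (grad phi x + t *: grad psi x) (grad phi x).
  rewrite opprD addrA subrr add0r -scaleNr pfluxZr -/(F x) Ev.
  by apply: le_trans; rewrite lerD2l mulrA mulrN.
move: Jphi JI; rewrite /torsion_energy Ephi.
move: tangent.
have -> : \int[mu]_(x in Omega) pflux p (grad phi x + t *: grad psi x) (grad psi x) =
  \int[mu]_(x in Omega) F x by [].
move: (inf _) (penergy _ _ _) (penergy _ _ _) (Rintegral _ _ F) (Rintegral _ _ phi) (Rintegral _ _ psi).
move=> I B A F' a b tan Jphi JI.
rewrite -(ler_pM2l t0); have {}tan : p^-1 * A - t * F' <= p^-1 * B.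
  have pi0 : 0 <= p^-1 by rewrite invr_ge0 ltW.
  have -> : p^-1 * A - t * F' = p^-1 * (A + - (p * t) * F') by field; rewrite gt_eqF.
  exact: ler_wpM2l.
rewrite mulrBr -expr2; move: Jphi JI tan; set X := p^-1 * A; set Y := p^-1 * B; set Z := t * b; set W := t * F'; lra.
Qed.

(** [near_min_flux_ge] with t = 1/(k+1), passed to the limit by dominated convergence; continuity of
    the flux in its first argument identifies the limit. *)
Lemma weak_equation_limit (phi : nat -> 'rV[R]_m.+1 -> R)
    (u : 'rV[R]_m.+1 -> R) (g : 'rV[R]_m.+1 -> 'rV[R]_m.+1) (psi : 'rV[R]_m.+1 -> R) :
  (forall k, test (phi k) /\ torsion_energy p Omega (phi k) <
    inf [set torsion_energy p Omega phi | phi in test] + (k.+1%:R^-1) ^+ 2) ->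
  measurable_fun setT g ->
  (\forall x \ae mu, Omega x ->
    [/\ phi k x @[k --> \oo] --> u x, grad (phi k) x @[k --> \oo] --> g x,
        `|u x| <= H x /\ enorm (g x) <= H x &
        forall k, `|phi k x| <= H x /\ enorm (grad (phi k) x) <= H x]) ->
  test psi ->
  mu.-integrable Omega (EFin \o (fun x => pflux p (g x) (grad psi x))) /\
  \int[mu]_(x in Omega) psi x <= \int[mu]_(x in Omega) pflux p (g x) (grad psi x).
Proof.
move=> tphi mg ae tpsi; pose t (k : nat) : R := k.+1%:R^-1.
have t0 k : 0 < t k by rewrite invr_gt0.
have t1 k : t k <= 1 by rewrite invf_le1 ?ler1n.
pose F k x := pflux p (grad (phi k) x + t k *: grad psi x) (grad psi x).
have mG f : test f -> measurable_fun setT (grad f).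
  by move=> tf; apply: continuous_vector_measurable => i; exact: test_grad_coord_continuous tf.
have mF k : measurable_fun setT (F k).
  apply: measurable_pflux; last exact: mG.
  have -> : (fun x => grad (phi k) x + t k *: grad psi x) = grad (fun x => phi k x + t k * psi x).
    by apply/funext => x; rewrite gradD//; [exact: test_fun_C1 (tphi k).1|exact: test_fun_C1 tpsi].
  by apply: mG; apply: test_funD => //; exact: (tphi k).1.
have [K K0 HK] : exists2 K : R, 0 < K & forall x, Omega x -> enorm (grad psi x) <= K.
  have [|K K0 HK] := @continuous_bounded _ _ (fun x => enorm (grad psi x)) Omega _ bO.
    by apply: continuous_enorm_comp => i; exact: test_grad_coord_continuous tpsi.
  by exists K => // x Ox; apply: le_trans (HK x Ox); exact: ler_norm.
(* The flux is at most K (H + K)^(p-1) <= K (1 + 2^p (H^p + K^p)), which is below C (1 + H^p). *)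
pose C := K * (1 + 2 `^ p * (1 + K `^ p)).
have C0 : 0 <= C.
  by rewrite !(mulr_ge0, addr_ge0, powR_ge0)// ltW.
have [|||||iL L] := @Rintegral_dominated_cvg _ _ _ mu Omega F
  (fun x => pflux p (g x) (grad psi x)) (fun x => C * (1 + H x `^ p)) mO.
- by move=> k; exact: measurable_funS (mF k).
- apply: (@measurable_funS _ _ _ _ setT) => //; apply: measurable_pflux => //; exact: mG.
- move: ae; apply: filterS => x ae Ox; have [_ h _ _] := ae Ox.
  have c : {for g x, continuous (fun z => pflux p z (grad psi x))} by exact: continuous_pflux.
  apply: (continuous_cvg _ c); apply: cvg_rV => i.
  under eq_fun do rewrite mxE [X in _ + X]mxE.
  have ci : {for g x, continuous (fun y : 'rV[R]_m.+1 => y ord0 i)} by exact: coord_continuous.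
  have hi : grad (phi k) x ord0 i @[k --> \oo] --> g x ord0 i by exact: (continuous_cvg _ ci h).
  have -> : g x ord0 i = g x ord0 i + 0 * grad psi x ord0 i by rewrite mul0r addr0.
  exact: (cvgD hi (cvgM (@cvg_harmonic R) (cvg_cst _))).
- exact: integrable_dominated.
- move: ae; apply: filterS => x ae Ox k; have [_ _ _ /(_ k)[_ h]] := ae Ox.
  have a0 := enorm_ge0 (grad (phi k) x + t k *: grad psi x).
  have Hp0 := powR_ge0 (H x) p; have Kp0 := powR_ge0 K p; have p20 := powR_ge0 2 p.
  have A : enorm (grad (phi k) x + t k *: grad psi x) <= H x + K.
    apply: (le_trans (enormD _ _)); apply: lerD => //; rewrite enormZ gtr0_norm//.
    rewrite -[K]mul1r; apply: ler_pM; rewrite ?enorm_ge0 ?(ltW (t0 k))//; exact: HK.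
  apply: (le_trans (pflux_le p1 _ _)).
  apply: (@le_trans _ _ ((1 + 2 `^ p * (H x `^ p + K `^ p)) * K)); last first.
    rewrite /C mulrC -mulrA ler_pM2l//.
    have hk : 0 <= 2 `^ p * K `^ p * H x `^ p by rewrite !mulr_ge0.
    move: hk Hp0 Kp0 p20; move: (2 `^ p) (K `^ p) (H x `^ p) => P k' h' *; nra.
  apply: ler_pM; rewrite ?powR_ge0 ?enorm_ge0//; last exact: HK.
  apply: (le_trans (powRB1_le p1 a0)); rewrite lerD2l.
  apply: le_trans (powR_add_le p1 (H0 x) (ltW K0)).
  by apply: ge0_ler_powR; rewrite ?nnegrE ?(ltW p0) ?(addr_ge0 (H0 x) (ltW K0)).
have L' : \int[mu]_(x in Omega) psi x - t k @[k --> \oo] --> \int[mu]_(x in Omega) psi x.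
  have cc : (fun=> \int[mu]_(x in Omega) psi x) @ \oo --> \int[mu]_(x in Omega) psi x by exact: cvg_cst.
  have := cvgB cc (@cvg_harmonic R); rewrite subr0 => CC; exact: CC.
split; first exact: iL.
apply: (ler_cvg_to L' L); apply: nearW => k.
by apply: near_min_flux_ge => //; have [] := tphi k.
Qed.

End existence.

Section existence_theorem.
Context (R : realType) (p : R) (p1 : 1 < p) (m : nat) (Omega : set 'rV[R]_m.+1).
Hypotheses (oO : open Omega) (bO : bounded_set Omega).
Local Notation mu := (lebesgue_rV R m.+1).

Lemma torsion_solution_exists : exists u, torsion_solution p Omega u.
Proof.
have p0 : 0 < p := lt_trans ltr01 p1.
have [phi [u [g [H [tphi [mu' mg] [mH H0] iH ae]]]]] := torsion_approximation p1 oO bO.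
have t0 k := (tphi k).1.
have mgi i : measurable_fun setT (fun x => g x ord0 i).
  exact: (measurableT_comp (measurable_coord i) mg).
exists u, g; split; first split; first split.
- apply: (Lp_ae_le p1 oO mH H0 iH mu').
  by move: ae; apply: filterS => x ae Ox; have [_ _ [h _] _] := ae Ox.
- move=> i; apply: (Lp_ae_le p1 oO mH H0 iH (mgi i)).
  move: ae; apply: filterS => x ae Ox; have [_ _ [_ h] _] := ae Ox.
  by apply: le_trans h; exact: enorm_coord.
- move=> i psi tpsi; exact: (weak_gradient_limit p1 oO bO H0 iH i t0 mu' mg ae tpsi).
- exists phi; split; first exact: t0.
    apply: (Lp_cvg_dominated p1 oO mH H0 iH _ mu').
      by move=> k; apply: continuous_rV_measurable; have [] := test_fun_C1 (t0 k).
    move: ae; apply: filterS => x ae Ox; have [h1 _ [h2 _] h3] := ae Ox.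
    by split => // k; have [] := h3 k.
  move=> i; apply: (Lp_cvg_dominated p1 oO mH H0 iH _ (mgi i)).
    by move=> k; apply: continuous_rV_measurable; have [_] := test_fun_C1 (t0 k).
  move: ae; apply: filterS => x ae Ox; have [_ h1 [_ h2] h3] := ae Ox; split.
  + have ci : {for g x, continuous (fun y : 'rV[R]_m.+1 => y ord0 i)} by exact: coord_continuous.
    by under eq_fun do rewrite -gradE; exact: (continuous_cvg _ ci h1).
  + by apply: le_trans h2; exact: enorm_coord.
  + move=> k; have [_] := h3 k; apply: le_trans; rewrite -gradE; exact: enorm_coord.
- move=> psi tpsi; apply/eqP; rewrite eq_le; apply/andP; split; last first.
    exact: (weak_equation_limit p1 oO bO H0 iH tphi mg ae tpsi).2.
  (* The limit gave an inequality for every test function; applied to -psi it is the reverse one. *)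
  have tN : test_fun Omega (fun x => (-1) * psi x) by exact: test_funZ.
  have [_] := weak_equation_limit p1 oO bO H0 iH tphi mg ae tN.
  have gN x : grad (fun x => (-1) * psi x) x = (-1) *: grad psi x.
    have := @gradD _ _ (fun=> 0) psi (-1) x (test_fun_C1 (test_fun0 Omega)) (test_fun_C1 tpsi).
    rewrite (_ : grad (fun=> 0) x = 0) ?add0r; last first.
      by apply/rowP => i; rewrite gradE mxE; exact: derive_cst.
    by move=> <-; congr (grad _ x); apply/funext => y; rewrite add0r.
  rewrite (RintegralZl _ (open_rV_measurable oO) (test_integrable oO bO tpsi)).
  have [ig _] := weak_equation_limit p1 oO bO H0 iH tphi mg ae tpsi.
  have -> : \int[mu]_(x in Omega) pflux p (g x) (grad (fun x => (-1) * psi x) x) =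
      \int[mu]_(x in Omega) ((-1) * pflux p (g x) (grad psi x)).
    by apply: eq_Rintegral => x _; rewrite gN pfluxZr.
  by rewrite (RintegralZl _ (open_rV_measurable oO) ig) !mulN1r lerN2.
Qed.

End existence_theorem.

Lemma measurable_rV_on d (T : measurableType d) (R : realType) n (A : set T) (g : T -> 'rV[R]_n) :
  measurable A -> (forall i, measurable_fun A (fun x => g x ord0 i)) -> measurable_fun A g.
Proof.
move=> mA mg.
have mg' : measurable_fun setT (fun x => \row_i ((fun x => g x ord0 i) \_ A) x : 'rV[R]_n).
  apply: measurable_rVP => i; under eq_fun do rewrite mxE.
  by have /(measurable_restrictT _ mA) := mg i.
apply: (eq_measurable_fun _ _ (measurable_funS measurableT (@subsetT _ A) mg')) => x Ax.
by apply/rowP => i; rewrite mxE patchE Ax.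
Qed.

(** Made for bounds produced by Young's inequality with a parameter: del times a fixed quantity,
    plus a constant depending on del times something that tends to 0. *)
Lemma cvg0_of_family (R : realType) (a d : nat -> R) (V : R) : 0 <= V ->
  d @ \oo --> (0 : R) ->
  (forall del : R, 0 < del -> exists C : R, forall k, `|a k| <= del * V + C * d k) ->
  a @ \oo --> (0 : R).
Proof.
move=> V0 d0 H; apply/cvgrPdist_le => e e0.
have V1 : 0 < V + 1 by rewrite ltr_wpDl.
have [|C HC] := H (e / 2 / (V + 1)); first by rewrite !divr_gt0.
have C1 : 0 < `|C| + 1 by rewrite ltr_wpDl.
move/cvgr0_norm_le : d0 => /(_ (e / 2 / (`|C| + 1))) [|N _ HN]; first by rewrite !divr_gt0.
exists N => // k Nk /=; rewrite sub0r normrN; apply: (le_trans (HC k)).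
rewrite [leRHS](splitr e); apply: lerD.
  by rewrite mulrAC ler_pdivrMr// ler_pM2l ?divr_gt0// lerDl.
apply: (le_trans (ler_norm _)); rewrite normrM.
have := HN k Nk; rewrite ler_pdivlMr// mulrC; apply: le_trans.
by rewrite ler_wpM2r// lerDl.
Qed.

Lemma enorm_powR_le_sum (R : realType) (p : R) n : 1 < p ->
  exists2 C : R, 0 <= C & forall v : 'rV[R]_n, enorm v `^ p <= C * \sum_(i < n) `|v ord0 i| `^ p.
Proof.
move=> p1; have p0 : 0 < p := lt_trans ltr01 p1.
have P1 : (1 : R) <= 2 `^ p by rewrite -[leLHS](powRr0 2) ler_powR ?ler1n ?(ltW p0).
have H (s : seq 'I_n) (v : 'rV[R]_n) : (\sum_(i <- s) `|v ord0 i|) `^ p <=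
    (2 `^ p) ^+ size s * \sum_(i <- s) `|v ord0 i| `^ p.
  elim: s => [|i s IH]; first by rewrite !big_nil powR0 ?gt_eqF// mulr0.
  have s0 : 0 <= \sum_(j <- s) `|v ord0 j| by rewrite sumr_ge0.
  have t0 : 0 <= \sum_(j <- s) `|v ord0 j| `^ p by rewrite sumr_ge0// => *; exact: powR_ge0.
  rewrite !big_cons/=; apply: (le_trans (powR_add_le p1 (normr_ge0 _) s0)).
  rewrite exprS -mulrA ler_wpM2l ?powR_ge0// mulrDr lerD//.
  by rewrite ler_peMl ?powR_ge0// exprn_ege1.
exists ((2 `^ p) ^+ size (index_enum 'I_n)); first by rewrite exprn_ge0 ?powR_ge0.
move=> v; apply: le_trans (H _ v); apply: ge0_ler_powR; rewrite ?nnegrE ?(ltW p0) ?enorm_ge0 ?sumr_ge0//.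
exact: enorm_le_sum.
Qed.

(** * Variational bounds for the torsional rigidity *)

Section interface.
Context (R : realType) (p : R) (p1 : 1 < p) (m : nat) (Omega : set 'rV[R]_m.+1).
Hypotheses (oO : open Omega) (bO : bounded_set Omega).
Local Notation mu := (lebesgue_rV R m.+1).
Local Notation test := (test_fun Omega).

Let p0 : 0 < p. Proof. exact: lt_trans p1. Qed.
Let mO : measurable Omega. Proof. exact: open_rV_measurable. Qed.

Lemma integrable_le (f h : 'rV[R]_m.+1 -> R) : measurable_fun Omega f ->
  (forall x, Omega x -> `|f x| <= h x) -> mu.-integrable Omega (EFin \o h) ->
  mu.-integrable Omega (EFin \o f).
Proof.
move=> mf fh ih; apply: (le_integrable mO _ _ ih); first exact/measurable_EFinP.
by move=> x Ox /=; rewrite lee_fin (le_trans (fh x Ox))// ler_norm.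
Qed.

Lemma integrable_sumr (I : Type) (s : seq I) (f : I -> 'rV[R]_m.+1 -> R) :
  (forall i, mu.-integrable Omega (EFin \o f i)) ->
  mu.-integrable Omega (EFin \o (fun x => \sum_(i <- s) f i x)) /\
  \int[mu]_(x in Omega) (\sum_(i <- s) f i x) = \sum_(i <- s) \int[mu]_(x in Omega) f i x.
Proof.
move=> iF; elim: s => [|i s [IH1 IH2]].
  under [X in Rintegral _ _ X]eq_fun do rewrite big_nil.
  under eq_fun do rewrite big_nil; rewrite big_nil Rintegral_cst// mul0r; split => //.
  exact: finite_integrable_cst.
under [X in Rintegral _ _ X]eq_fun do rewrite big_cons.
under eq_fun do rewrite big_cons; rewrite big_cons; split.
  exact: (integrable_addr mO (iF i) IH1).
by rewrite (RintegralD mO (iF i) IH1) IH2.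
Qed.

Lemma normr_Rintegral_le (f h : 'rV[R]_m.+1 -> R) :
  mu.-integrable Omega (EFin \o f) -> mu.-integrable Omega (EFin \o h) ->
  (forall x, `|f x| <= h x) -> `|\int[mu]_(x in Omega) f x| <= \int[mu]_(x in Omega) h x.
Proof.
move=> iF ih fh; apply: (le_trans (le_normr_Rintegral mO iF)).
by apply: (le_Rintegral mO (integrable_norm iF) ih) => x _; exact: fh.
Qed.

Lemma Lp_integrable_diff (f h : 'rV[R]_m.+1 -> R) : Lp p Omega f -> continuous h ->
  mu.-integrable Omega (EFin \o (fun x => `|h x - f x| `^ p)).
Proof.
move=> Lf ch; have mf := Lp_measurable mO Lf.
have mh : measurable_fun Omega h.
  by apply: (@measurable_funS _ _ _ _ setT) => //; exact: continuous_rV_measurable.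
apply: (integrable_le (h := fun x => 2 `^ p * (`|h x| `^ p + `|f x| `^ p))).
- apply: (measurableT_comp (measurable_powR p)); apply: measurableT_comp => //.
  exact: measurable_funB.
- move=> x _; rewrite ger0_norm ?powR_ge0//.
  apply: le_trans (powR_add_le p1 (normr_ge0 _) (normr_ge0 _)).
  by apply: ge0_ler_powR; rewrite ?nnegrE ?(ltW p0) ?addr_ge0//; exact: ler_normB.
- apply: (integrable_mull mO); apply: (integrable_addr mO); last exact: Lp_integrable.
  exact: (open_integrable oO bO (continuous_compr (continuous_powR_norm p0) ch)).
Qed.

Lemma Lp_cvg_Rintegral (h : nat -> 'rV[R]_m.+1 -> R) f : Lp_cvg p Omega h f ->
  \int[mu]_(x in Omega) (`|h k x - f x| `^ p) @[k --> \oo] --> (0 : R).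
Proof. by move=> /(Lp_cvg_integral p0) /fine_cvgP[]. Qed.

Lemma normr_young (del x : R) : 0 < del -> `|x| <= del * 1 + del `^ (1 - p) * `|x| `^ p.
Proof.
move=> d0; have E : 1 `^ (p - 1) = 1 :> R by rewrite powR1.
have E' : 1 `^ p = 1 :> R by rewrite powR1.
by have := mul_powRB1_le p1 d0 ler01 (normr_ge0 x); rewrite E E' mul1r.
Qed.

(** Testing the weak equation with approximations of u is the substitute for testing with u, which
    is no test function. The integrals of phi_k tend both to int u and to int |g|^p, so the two
    agree, while the p-energies of phi_k exceed int |g|^p by an arbitrarily small amount. *)
Lemma torsion_solution_limits u g : sobolev0 p Omega u g ->
  (forall phi, test phi ->
    \int[mu]_(x in Omega) pflux p (g x) (grad phi x) = \int[mu]_(x in Omega) phi x) ->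
  exists (phi : nat -> 'rV[R]_m.+1 -> R) (e : nat -> R),
  [/\ forall k, test (phi k),
      \int[mu]_(x in Omega) phi k x @[k --> \oo] --> \int[mu]_(x in Omega) u x,
      \int[mu]_(x in Omega) phi k x @[k --> \oo] --> \int[mu]_(x in Omega) enorm (g x) `^ p,
      e @ \oo --> (0 : R) &
      mu.-integrable Omega (EFin \o (fun x => enorm (g x) `^ p)) /\
      forall del : R, 0 < del -> forall k, penergy p Omega (phi k) <=
        (1 + del) `^ p * \int[mu]_(x in Omega) enorm (g x) `^ p + (1 + del^-1) `^ p * e k].
Proof.
move=> [[Lu Lg _] [phi [tphi cu cg]]] weq.
have cphi k : continuous (phi k) by have [] := test_fun_C1 (tphi k).
have cdphi i k : continuous (partial i (phi k)) by have [_] := test_fun_C1 (tphi k).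
have mgi i := Lp_measurable mO (Lg i).
have mg : measurable_fun Omega g by exact: measurable_rV_on.
have mgr f : test f -> measurable_fun Omega (grad f).
  move=> tf; apply: (@measurable_funS _ _ _ _ setT) => //.
  by apply: continuous_vector_measurable => i; exact: test_grad_coord_continuous tf.
have mgB k : measurable_fun Omega (fun x => grad (phi k) x - g x).
  apply: measurable_rV_on => // i.
  have -> : (fun x => (grad (phi k) x - g x) ord0 i) = (fun x => partial i (phi k) x - g x ord0 i).
    by apply/funext => x; rewrite mxE gradE [X in _ + X]mxE.
  apply: measurable_funB => //; apply: (@measurable_funS _ _ _ _ setT) => //.
  exact: continuous_rV_measurable.
pose w k x := \sum_(i < m.+1) `|partial i (phi k) x - g x ord0 i| `^ p.
have [C C0 HC] := enorm_powR_le_sum m.+1 p1.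
have igp : mu.-integrable Omega (EFin \o (fun x => enorm (g x) `^ p)).
  apply: (integrable_le (h := fun x => C * \sum_(i < m.+1) `|g x ord0 i| `^ p)).
  - by apply: (measurableT_comp (measurable_powR p)); exact: measurable_enorm.
  - by move=> x _; rewrite ger0_norm ?powR_ge0.
  - by apply: (integrable_mull mO); apply: (integrable_sumr _ _).1 => i; exact: (Lp_integrable p0 mO (Lg i)).
have iwi k i : mu.-integrable Omega (EFin \o (fun x => `|partial i (phi k) x - g x ord0 i| `^ p)).
  exact: Lp_integrable_diff.
have [iw wE] := all_and2 (fun k => integrable_sumr (index_enum 'I_m.+1) (iwi k)).
(* Convergence of the gradients is given coordinate by coordinate; C w_k dominates |grad phi_k -
   g|^p and its integral tends to 0. *)
pose e k := C * \int[mu]_(x in Omega) w k x.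
have e0 : e @ \oo --> (0 : R).
  have S : \sum_(i < m.+1) \int[mu]_(x in Omega) (`|partial i (phi k) x - g x ord0 i| `^ p)
      @[k --> \oo] --> \sum_(i < m.+1) (0 : R).
    by apply: cvg_sumr => i; exact: (Lp_cvg_Rintegral (cg i)).
  have cC : (fun _ : nat => C) @ \oo --> C by exact: cvg_cst.
  have := cvgM cC S; rewrite big1// mulr0.
  rewrite (_ : e = (fun k => C * \sum_(i < m.+1)
    \int[mu]_(x in Omega) (`|partial i (phi k) x - g x ord0 i| `^ p))) => [h|]; first exact: h.
  by apply/funext => k; rewrite /e wE.
have Dle k x : enorm (grad (phi k) x - g x) `^ p <= C * w k x.
  apply: (le_trans (HC _)); rewrite le_eqVlt; apply/orP; left; apply/eqP; congr (_ * _).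
  by apply: eq_bigr => i _; rewrite mxE gradE [X in _ + X]mxE.
have iD k : mu.-integrable Omega (EFin \o (fun x => C * w k x)) by exact: (integrable_mull mO C (iw k)).
have De k : \int[mu]_(x in Omega) (C * w k x) = e k by rewrite (RintegralZl _ mO (iw k)).
have iphi k := test_integrable oO bO (tphi k).
have iflux k : mu.-integrable Omega (EFin \o (fun x => pflux p (g x) (grad (phi k) x))).
  apply: (integrable_le (h := fun x => 1 * enorm (g x) `^ p +
     1 `^ (1 - p) * enorm (grad (phi k) x) `^ p)).
  - by apply: measurable_pflux => //; exact: mgr.
  - move=> x _; apply: (le_trans (pflux_le p1 _ _)).
    by apply: mul_powRB1_le => //; exact: enorm_ge0.
  - exact: (integrable_addr mO (integrable_mull mO 1 igp)
      (integrable_mull mO (1 `^ (1 - p)) (test_penergy_integrable p1 oO bO (tphi k)))).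
pose V := fine (mu Omega).
have V0 : 0 <= V by exact: fine_ge0.
have cgap (a b : nat -> R) (l : R) : b @ \oo --> (0 : R) -> (forall k, a k = l + b k) -> a @ \oo --> l.
  move=> b0 ab; rewrite (_ : a = (fun k => l + b k)); last exact/funext.
  have cl : (fun _ : nat => l) @ \oo --> l by exact: cvg_cst.
  by have := cvgD cl b0; rewrite addr0 => h; exact: h.
have iu : mu.-integrable Omega (EFin \o u).
  apply: (integrable_le (h := fun x => 1 * 1 + 1 `^ (1 - p) * `|u x| `^ p)).
  - exact: Lp_measurable Lu.
  - by move=> x _; exact: normr_young.
  - apply: (integrable_addr mO); first exact: finite_integrable_cst.
    exact: (integrable_mull mO _ (Lp_integrable p0 mO Lu)).
exists phi, e; split => //.
- apply: (cgap _ (fun k => \int[mu]_(x in Omega) (phi k x - u x))); last first.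
    by move=> k; rewrite (RintegralB mO (iphi k) iu) addrC subrK.
  apply: (cvg0_of_family V0 (Lp_cvg_Rintegral cu)) => del d0.
  exists (del `^ (1 - p)) => k.
  have id := Lp_integrable_diff Lu (cphi k).
  have ipu := integrable_subr mO (iphi k) iu.
  have ic : mu.-integrable Omega (EFin \o cst del) by exact: finite_integrable_cst.
  apply: (le_trans (normr_Rintegral_le ipu (integrable_addr mO ic (integrable_mull mO (del `^ (1 - p)) id)) _)).
    by move=> x; have := normr_young (phi k x - u x) d0; rewrite mulr1.
  by rewrite (RintegralD mO ic (integrable_mull mO _ id)) (RintegralZl _ mO id) Rintegral_cst.
- apply: (cgap _ (fun k => \int[mu]_(x in Omega) pflux p (g x) (grad (phi k) x - g x))); last first.
    move=> k; rewrite -weq//; have E x : pflux p (g x) (grad (phi k) x - g x) =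
        pflux p (g x) (grad (phi k) x) - enorm (g x) `^ p by rewrite pfluxBr pflux_diag.
    rewrite (eq_Rintegral _ (fun x _ => E x)) (RintegralB mO (iflux k) igp) addrC subrK//.
  apply: (cvg0_of_family (V := \int[mu]_(x in Omega) enorm (g x) `^ p) _ e0).
    by apply: Rintegral_ge0 => x _; exact: powR_ge0.
  move=> del d0; exists (del `^ (1 - p)) => k.
  have ib := integrable_addr mO (integrable_mull mO del igp) (integrable_mull mO (del `^ (1 - p)) (iD k)).
  have B x : `|pflux p (g x) (grad (phi k) x - g x)| <=
      del * enorm (g x) `^ p + del `^ (1 - p) * (C * w k x).
    apply: (le_trans (pflux_le p1 _ _)).
    apply: (le_trans (mul_powRB1_le p1 d0 (enorm_ge0 _) (enorm_ge0 _))).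
    by rewrite lerD2l ler_wpM2l ?powR_ge0.
  have ifl : mu.-integrable Omega (EFin \o (fun x => pflux p (g x) (grad (phi k) x - g x))).
    by apply: (integrable_le _ (fun x _ => B x) ib); apply: measurable_pflux.
  apply: (le_trans (normr_Rintegral_le ifl ib B)).
  rewrite (RintegralD mO (integrable_mull mO del igp) (integrable_mull mO _ (iD k))).
  by rewrite (RintegralZl _ mO igp) (RintegralZl _ mO (iD k)) De.
- split; first exact: igp.
  move=> del d0 k.
  have ib := integrable_addr mO (integrable_mull mO ((1 + del) `^ p) igp)
    (integrable_mull mO ((1 + del^-1) `^ p) (iD k)).
  rewrite -De -(RintegralZl _ mO igp) -(RintegralZl _ mO (iD k)).
  rewrite -(RintegralD mO (integrable_mull mO _ igp) (integrable_mull mO _ (iD k))).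
  apply: (le_Rintegral mO (test_penergy_integrable p1 oO bO (tphi k)) ib) => x _.
  apply: (@le_trans _ _ ((1 + del) `^ p * enorm (g x) `^ p +
     (1 + del^-1) `^ p * enorm (grad (phi k) x - g x) `^ p)); last first.
    by rewrite lerD2l ler_wpM2l ?powR_ge0.
  apply: le_trans (powR_add_le_eps p1 d0 (enorm_ge0 _) (enorm_ge0 _)).
  apply: ge0_ler_powR; rewrite ?nnegrE ?(ltW p0) ?addr_ge0 ?enorm_ge0//.
  by have := enormD (g x) (grad (phi k) x - g x); rewrite addrC subrK.
Qed.

Let q := p / (p - 1).
Let qE : q * (1 - p^-1) = 1.
Proof. by rewrite /q; field; rewrite gt_eqF//= subr_eq0 gt_eqF. Qed.

Let q0 : 0 < q. Proof. by rewrite divr_gt0 ?subr_gt0. Qed.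

Lemma torsional_rigidity_solution : exists u g, [/\ torsional_rigidity p Omega =
   \int[mu]_(x in Omega) u x, sobolev0 p Omega u g & forall phi, test phi ->
    \int[mu]_(x in Omega) pflux p (g x) (grad phi x) = \int[mu]_(x in Omega) phi x].
Proof.
have [g [Sg weq]] : torsion_solution p Omega (torsion_function p Omega).
  by rewrite /torsion_function; apply: xgetPex; exact: torsion_solution_exists.
by exists (torsion_function p Omega), g.
Qed.

(** The rigidity equals int |g|^p. Young's inequality for the flux of g against grad v bounds int v
    by (1 - 1/p) int |g|^p plus 1/p times the energy of v; q is the inverse of 1 - 1/p. *)
Lemma torsional_rigidity_ge v : test v ->
  q * (\int[mu]_(x in Omega) v x - p^-1 * penergy p Omega v) <= torsional_rigidity p Omega.
Proof.
move=> tv; have [u [g [-> Sg weq]]] := torsional_rigidity_solution.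
have [phi [e [_ h1 h2 _ [ig _]]]] := torsion_solution_limits Sg weq.
rewrite (cvg_unique _ h1 h2)// -(ler_pM2l (_ : 0 < 1 - p^-1)); last first.
  by rewrite subr_gt0 invf_lt1.
rewrite mulrA [_ * q]mulrC qE mul1r lerBlDr -weq//.
have iv := test_penergy_integrable p1 oO bO tv.
rewrite -(RintegralZl _ mO ig) -(RintegralZl _ mO iv).
rewrite -(RintegralD mO (integrable_mull mO _ ig) (integrable_mull mO _ iv)).
have ib := integrable_addr mO (integrable_mull mO (1 - p^-1) ig) (integrable_mull mO p^-1 iv).
have mg : measurable_fun Omega g.
  by apply: measurable_rV_on => // i; apply: (Lp_measurable mO (p := p)); have [[_ h _] _] := Sg.
apply: (le_Rintegral mO _ ib) => [|x _]; last exact: pflux_young.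
apply: (integrable_le (h := fun x => 1 * enorm (g x) `^ p +
     1 `^ (1 - p) * enorm (grad v x) `^ p)).
- apply: measurable_pflux => //; apply: (@measurable_funS _ _ _ _ setT) => //.
  by apply: continuous_vector_measurable => i; exact: test_grad_coord_continuous tv.
- move=> x _; apply: (le_trans (pflux_le p1 _ _)).
  by apply: mul_powRB1_le => //; exact: enorm_ge0.
- exact: (integrable_addr mO (integrable_mull mO 1 ig) (integrable_mull mO (1 `^ (1 - p)) iv)).
Qed.

(** The assumption, applied to approximations of the solution, becomes T <= (1 - 1/p) A + T/p once
    the factor (1 + del)^p has been sent to 1. *)
Lemma torsional_rigidity_le A :
  (forall v, test v -> \int[mu]_(x in Omega) v x <= (1 - p^-1) * A + p^-1 * penergy p Omega v) ->
  torsional_rigidity p Omega <= A.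
Proof.
move=> HA; have [u [g [-> Sg weq]]] := torsional_rigidity_solution.
have [phi [e [tphi h1 h2 e0 [ig He]]]] := torsion_solution_limits Sg weq.
have E := cvg_unique (@Rhausdorff R) h1 h2; rewrite E.
set T := Rintegral _ _ _ in h2 E *.
have H (del : R) : 0 < del -> T <= (1 - p^-1) * A + p^-1 * ((1 + del) `^ p * T).
  move=> d0; pose r k := (1 - p^-1) * A + p^-1 * ((1 + del) `^ p * T + (1 + del^-1) `^ p * e k).
  have rc : r @ \oo --> (1 - p^-1) * A + p^-1 * ((1 + del) `^ p * T + (1 + del^-1) `^ p * 0).
    apply: cvgD; first exact: cvg_cst.
    apply: cvgM; first exact: cvg_cst.
    apply: cvgD; first exact: cvg_cst.
    by apply: cvgM; first exact: cvg_cst.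
  rewrite mulr0 addr0 in rc; apply: (ler_cvg_to h2 rc); apply: nearW => k.
  apply: (le_trans (HA _ (tphi k))); rewrite lerD2l ler_pM2l ?invr_gt0//; exact: He.
have c : (1 - p^-1) * A + p^-1 * ((`|1 + k.+1%:R^-1|) `^ p * T) @[k --> \oo] -->
    (1 - p^-1) * A + p^-1 * (`|1 + 0| `^ p * T).
  apply: cvgD; first exact: cvg_cst.
  apply: cvgM; first exact: cvg_cst.
  apply: cvgM; last exact: cvg_cst.
  have c1 : {for (1 + 0 : R), continuous (fun t : R => `|t| `^ p)} by exact: continuous_powR_norm.
  by apply: (continuous_cvg _ c1); apply: cvgD; [exact: cvg_cst|exact: cvg_harmonic].
have E1 : 1 `^ p = 1 :> R by rewrite powR1.
rewrite addr0 normr1 E1 mul1r in c.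
have cT : (fun _ : nat => T) @ \oo --> T by exact: cvg_cst.
have : T <= (1 - p^-1) * A + p^-1 * T.
  apply: (ler_cvg_to cT c); apply: nearW => k; rewrite ger0_norm ?addr_ge0 ?invr_ge0//.
  by apply: H; rewrite invr_gt0.
have pp : 0 < 1 - p^-1 by rewrite subr_gt0 invf_lt1.
by rewrite -lerBlDr -[X in X - _]mul1r -mulrBl ler_pM2l.
Qed.

End interface.

(** * Smooth test functions built from affine functions *)

Section flat_function.
Context (R : realType) (kap : R) (kap0 : 0 < kap).

(** The standard flat function exp(-kap/s), with negative powers of s attached so that the family is
    closed under differentiation, also at 0. *)
Definition flat (n : nat) (s : R) : R :=
  if 0 < s then s^-1 ^+ n * expR (- (kap * s^-1)) else 0.

Lemma pow_expRN_le n (X : R) : 0 < X ->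
  X ^+ n * expR (- (kap * X)) <= (n.+1)`!%:R / kap ^+ n.+1 * X^-1.
Proof.
move=> X0; have kX : 0 < kap * X by rewrite mulr_gt0.
have := expR_ge1Dxn n (ltW kX); rewrite exprMn => H.
have f0 : 0 < (n.+1)`!%:R :> R by rewrite ltr0n fact_gt0.
have k0 : 0 < kap ^+ n.+1 by rewrite exprn_gt0.
have {}H : X ^+ n.+1 <= (n.+1)`!%:R / kap ^+ n.+1 * expR (kap * X).
  rewrite mulrAC ler_pdivlMr// mulrC [leRHS]mulrC -ler_pdivrMr//.
  by apply: le_trans H; rewrite lerDr.
rewrite expRN ler_pdivrMr ?expR_gt0// mulrAC ler_pdivlMr// -exprSr.
exact: H.
Qed.

Lemma is_derive_flat (n : nat) (s : R) :
  is_derive s (1 : R) (flat n) (kap * flat n.+2 s - n%:R * flat n.+1 s).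
Proof.
have [s0|s0|->] := ltgtP s 0.
- rewrite [flat n.+2 _]/flat [flat n.+1 _]/flat !(lt_gtF s0) !mulr0 subrr.
  apply: (near_eq_is_derive (f := cst (0 : R))).
  near=> t; rewrite /flat lt_gtF//; near: t; exact: lt_nbhsl.
- have sn : s != 0 by rewrite gt_eqF.
  have dV : is_derive s (1 : R) (fun t : R => t^-1) (- s ^- 2 *: 1) by exact: is_deriveV.
  have dZ : is_derive s (1 : R) (fun t : R => - (kap * t^-1)) (- (kap * (- s ^- 2 * 1))).
    exact: (is_deriveN (is_deriveZ kap dV)).
  have dE := @is_derive1_comp _ expR (fun t : R => - (kap * t^-1)) s _ _ (is_derive_expR _) dZ.
  have dX := is_deriveX n dV; rewrite exprfctE in dX.
  have D := is_deriveM dX dE.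
  have N : \near s, (fun t : R => t^-1 ^+ n * expR (- (kap * t^-1))) s = flat n s.
    near=> t; rewrite /flat ifT//; near: t; exact: lt_nbhsr.
  apply: (is_derive_eq (near_eq_is_derive N D)).
  rewrite /flat s0 /GRing.scale /comp /= !mulr1 !exprVn.
  move: (expR _) => X; case: n {dX D N} => [|k]; first by rewrite /= !exprS expr0; field.
  rewrite /= -[k.+1%:R]natr1 !exprS; have : s ^+ k != 0 by rewrite expf_neq0.
  by move: (s ^+ k) (k%:R) => P K P0; field; rewrite sn P0.
- rewrite [flat n.+2 _]/flat [flat n.+1 _]/flat !ltxx !mulr0 subrr.
  (* Dividing by h raises the power of 1/h from n to n + 1; this is the constant of [pow_expRN_le]
     for n + 1, and it bounds the difference quotient by C h. *)
  pose C : R := (n.+2)`!%:R / kap ^+ n.+2.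
  have C0 : 0 <= C by rewrite divr_ge0// exprn_ge0// ltW.
  have H : h^-1 *: ((flat n \o shift 0) (h *: (1 : R)) - flat n 0) @[h --> (0 : R)^'] --> (0 : R).
    apply/cvgrPdist_le => e e0; near=> h.
    rewrite sub0r normrN /= addr0 /flat ltxx subr0 [h *: 1]mulr1 /GRing.scale/=.
    have [h0|h0] := ltP 0 h; last by rewrite mulr0 normr0 ltW.
    rewrite mulrA -exprS ger0_norm; last by rewrite mulr_ge0 ?expR_ge0// exprn_ge0// invr_ge0 ltW.
    apply: (le_trans (pow_expRN_le _ _)); first by rewrite invr_gt0.
    rewrite invrK -/C; apply: (@le_trans _ _ ((C + 1) * h)).
      by rewrite ler_wpM2r ?(ltW h0)// lerDl.
    rewrite mulrC -ler_pdivlMr ?ltr_wpDl//; apply: (le_trans (ler_norm _)).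
    near: h; apply: dnbhs0_le; by rewrite divr_gt0// ltr_wpDl.
  apply: DeriveDef; first by apply/cvg_ex; exists 0.
  exact: cvg_lim H.
Unshelve. all: by end_near. Qed.

End flat_function.

Section generated.
Context (R : realType) (n : nat).
Implicit Types f g : 'rV[R]_n -> R.

(** [smooth] speaks of all iterated partial derivatives. A syntactic class containing its own
    partial derivatives reduces smoothness to one induction over the constructors. *)
Inductive elementary : ('rV[R]_n -> R) -> Prop :=
| elementary_cst (c : R) : elementary (fun=> c)
| elementary_coord i : elementary (fun x => x ord0 i)
| elementaryD f g : elementary f -> elementary g -> elementary (fun x => f x + g x)
| elementaryM f g : elementary f -> elementary g -> elementary (fun x => f x * g x)
| elementary_exp f : elementary f -> elementary (fun x => expR (f x))
| elementaryV f : (forall x, 0 < f x) -> elementary f -> elementary (fun x => (f x)^-1)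
| elementary_ln f : (forall x, 0 < f x) -> elementary f -> elementary (fun x => ln (f x))
| elementary_flat kap k f : 0 < kap -> elementary f -> elementary (fun x => flat kap k (f x)).

Lemma is_derive_chain (F : R -> R) f x v a b : is_derive (f x) (1 : R) F b ->
  is_derive x v f a -> is_derive x v (fun y => F (f y)) (b * a).
Proof.
move=> dF /is_derive_line df; apply/is_derive_line.
apply: (@is_derive1_comp _ F (fun t : R => f (x + t *: v))) => //.
by rewrite scale0r addr0.
Qed.

Let diff f := [/\ continuous f, forall i x, derivable f x (delta_mx ord0 i) &
  forall i, elementary (partial i f)].

Lemma elementary_diff f : elementary f -> diff f.
Proof.
move: f.
have step f (d : 'I_n -> 'rV[R]_n -> R) : continuous f ->
    (forall i x, is_derive x (delta_mx ord0 i) f (d i x)) ->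
    (forall i, elementary (d i)) -> diff f.
  move=> cf df ed; split; [exact: cf|by move=> i x; have [] := df i x|move=> i].
  rewrite (_ : partial i f = d i)//; apply/funext => x.
  by have [_] := df i x.
have chain (F F' : R -> R) f : (forall x, is_derive (f x) (1 : R) F (F' (f x))) ->
    elementary (fun x => F' (f x)) -> diff f -> diff (fun x => F (f x)).
  move=> dF eF' [cf df ef]; apply: (step _ (fun i x => F' (f x) * partial i f x)).
  - move=> x; apply: continuous_comp; first exact: cf.
    by apply/differentiable_continuous/derivable1_diffP; have [] := dF x.
  - by move=> i x; apply: is_derive_chain => //; exact: is_derive_partial.
  - by move=> i; exact: elementaryM.
move=> f; elim=> {f} [c|j|h g _ [cf df ef] _ [cg dg eg]|h g Ef [cf df ef] Eg [cg dg eg]|h Ef If|h f0 Ef If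
    |h f0 Ef If|kap k h k0 Ef If].
- apply: (step (fun=> c) (fun _ _ => 0)).
  + exact: continuous_const.
  + by move=> i; exact: elementary_cst.
- have [cj dj Dj] := @C1_coord R n j.
  apply: (step _ (fun i _ => (delta_mx ord0 i : 'rV[R]_n) ord0 j)) => // [i x|i].
    apply/is_derive_line.
    rewrite (_ : (fun t : R => (x + t *: (delta_mx ord0 i : 'rV[R]_n)) ord0 j) =
      (fun t => x ord0 j + t * (delta_mx ord0 i : 'rV[R]_n) ord0 j)); last by apply/funext => t; rewrite !mxE.
    exact: is_derive_affine.
  exact: elementary_cst.
- apply: (step _ (fun i x => partial i h x + partial i g x)) => [|i x|i].
  + exact: continuous_addr.
  + by apply: is_deriveD; exact: is_derive_partial.
  + exact: elementaryD.
- apply: (step _ (fun i x => h x * partial i g x + g x * partial i h x)) => [|i x|i].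
  + exact: continuous_mulr.
  + by apply: is_derive_mul; exact: is_derive_partial.
  + by apply: elementaryD; exact: elementaryM.
- apply: (chain expR expR) => //; exact: elementary_exp.
- apply: (chain (fun t => t^-1) (fun t => (-1) * (t^-1 * t^-1))) => // [x|].
    have fx : h x != 0 by rewrite gt_eqF.
    have := @is_deriveV R id (h x) 1 1 fx (is_derive_id _ _).
    by move=> DV; apply: (is_derive_eq DV); rewrite /GRing.scale/= mulr1 mulN1r exprS expr1 invfM.
  by apply: elementaryM; [exact: elementary_cst|apply: elementaryM; exact: elementaryV].
- apply: (chain _ (fun t => t^-1)) => // [x|]; first exact: is_derive1_ln.
  exact: elementaryV.
- apply: (chain _ (fun s => kap * flat kap k.+2 s - k%:R * flat kap k.+1 s)) => // [x|].
    exact: is_derive_flat.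
  have -> : (fun x => kap * flat kap k.+2 (h x) - k%:R * flat kap k.+1 (h x)) =
    (fun x => kap * flat kap k.+2 (h x) + (- k%:R) * flat kap k.+1 (h x)).
    by apply/funext => x; rewrite mulNr.
  by apply: elementaryD; apply: elementaryM; (exact: elementary_cst || exact: elementary_flat).
Qed.

Lemma elementary_smooth f : elementary f -> smooth f.
Proof.
move=> ef s; have : elementary (foldr (@partial R n) f s).
  by elim: s => //= i s IH; have [_ _] := elementary_diff IH.
by move=> /elementary_diff[].
Qed.

Lemma elementary_sum (I : Type) (r : seq I) (F : I -> 'rV[R]_n -> R) :
  (forall i, elementary (F i)) -> elementary (fun x => \sum_(i <- r) F i x).
Proof.
move=> eF; elim: r => [|i r IH].
  by under eq_fun do rewrite big_nil; exact: elementary_cst.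
by under eq_fun do rewrite big_cons; exact: elementaryD.
Qed.

End generated.

Section flat_id.
Context (R : realType) (kap : R) (kap0 : 0 < kap).

(** s exp(-kap/s) is the smooth positive part: it loses at most kap, and its slope lies in [0,1] by
    [flat_id_derive_itv]. Both facts are 1 + x <= exp x. *)
Lemma flat_id_ge (s : R) : s - kap <= s * flat kap 0 s.
Proof.
rewrite /flat; case: ifPn => [s0|]; last first.
  by rewrite -leNgt mulr0 => s0; rewrite (le_trans _ s0)// gerBl ltW.
rewrite expr0 mul1r.
have -> : s - kap = s * (1 + - (kap * s^-1)) by field; rewrite gt_eqF.
by rewrite ler_pM2l//; exact: expR_ge1Dx.
Qed.

Lemma flat_id_derive_itv (s : R) :
  0 <= flat kap 0 s + s * (kap * flat kap 2 s - 0 * flat kap 1 s) <= 1.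
Proof.
rewrite mul0r subr0 /flat; case: ifPn => [s0|_]; last by rewrite !mulr0 addr0 lexx ler01.
have X0 : 0 <= kap * s^-1 by rewrite mulr_ge0 ?invr_ge0 ?ltW.
have -> : s^-1 ^+ 0 * expR (- (kap * s^-1)) + s * (kap * (s^-1 ^+ 2 * expR (- (kap * s^-1)))) =
    (1 + kap * s^-1) * expR (- (kap * s^-1)).
  by move: (expR _) => E; rewrite expr0; field; rewrite gt_eqF.
rewrite mulr_ge0 ?expR_ge0 ?addr_ge0//= expRN ler_pdivrMr ?expR_gt0// mul1r.
exact: expR_ge1Dx.
Qed.

End flat_id.

(** * The trial function of a polytope *)

Section lower_bound.
Context (R : realType) (p : R) (p1 : 1 < p) (m : nat) (Omega : set 'rV[R]_m.+1).
Hypotheses (oO : open Omega) (bO : bounded_set Omega).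
Local Notation mu := (lebesgue_rV R m.+1).

Let p0 : 0 < p. Proof. exact: lt_trans p1. Qed.
Let mO : measurable Omega. Proof. exact: open_rV_measurable. Qed.
Let q := p / (p - 1).
Let pB1 : 0 < p - 1. Proof. by rewrite subr_gt0. Qed.
Let q0 : 0 < q. Proof. by rewrite divr_gt0. Qed.
Let qB1 : (q - 1) * p = q. Proof. by rewrite /q; field; rewrite gt_eqF. Qed.

Variables (N : nat) (a : 'I_N -> 'rV[R]_m.+1) (b : 'I_N -> R) (rho eta : R).
Hypotheses (rho0 : 0 < rho) (eta0 : 0 < eta) (arho : forall i, enorm (a i) <= rho^-1).
Let ell i x := dotr (a i) x + b i.
Hypothesis subO : forall x, (forall i, ell i x <= 1 - eta) -> Omega x.

(* The log-sum-exp smoothing of max(0, ell_1, ..., ell_N). *)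
Let M : R := ln (1 + N%:R) / eta + 1.
Let S x := 1 + \sum_(i < N) expR (M * ell i x).
Let j x := M^-1 * ln (S x).
(** The shift keeps [w] positive, so that w^q = exp(q ln w) belongs to the class [elementary]. *)
Let w x := j x + eta.
Let s x := 1 - eta + (-1) * expR (q * ln (w x)).
(** Log-sum-exp overshoots the maximum by at most eta; subtracting it makes J <= t wherever all
    ell_i <= t, as the layer-cake estimate requires. Conversely w <= J + 2 eta. *)
Let J x := Num.max 0 (j x - eta).

Let N1 : 1 <= 1 + N%:R :> R. Proof. by rewrite lerDl. Qed.

Let M0 : 0 < M.
Proof. by rewrite ltr_wpDl// divr_ge0 ?(ltW eta0)// ln_ge0. Qed.

Let MN : M^-1 * ln (1 + N%:R) <= eta.
Proof.
rewrite ler_pdivrMl// /M mulrDl mul1r divfK ?gt_eqF// lerDl ltW//.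
Qed.

Let S1 x : 1 <= S x.
Proof. by rewrite lerDl sumr_ge0// => i _; exact: expR_ge0. Qed.

Let S0 x : 0 < S x. Proof. exact: lt_le_trans (S1 x). Qed.

Let j0 x : 0 <= j x.
Proof. by rewrite mulr_ge0 ?invr_ge0 ?(ltW M0)// ln_ge0. Qed.

Let w0 x : 0 < w x. Proof. by rewrite ltr_wpDl. Qed.

Let ell_le x i : ell i x <= j x.
Proof.
rewrite /j ler_pdivlMl// -ler_expR lnK ?posrE//.
rewrite /S (bigD1 i)//= addrCA lerDl addr_ge0// sumr_ge0// => k _; exact: expR_ge0.
Qed.

Let j_le t x : 0 <= t -> (forall i, ell i x <= t) -> j x <= t + eta.
Proof.
move=> t0 lt; apply: (@le_trans _ _ (t + M^-1 * ln (1 + N%:R))); last by rewrite lerD2l.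
have E1 : 1 <= expR (M * t) by rewrite -expR0 ler_expR mulr_ge0// ltW.
have St : S x <= (1 + N%:R) * expR (M * t).
  rewrite mulrDl mul1r; apply: lerD => //.
  apply: (@le_trans _ _ (\sum_(i < N) expR (M * t))).
    by apply: ler_sum => i _; rewrite ler_expR ler_pM2l.
  by rewrite sumr_const card_ord mulr_natl.
have N0 : 0 < 1 + N%:R :> R by exact: lt_le_trans N1.
have : ln (S x) <= ln (1 + N%:R) + M * t.
  by rewrite -[M * t]expRK -lnM ?posrE ?expR_gt0// ler_ln ?posrE ?mulr_gt0 ?expR_gt0.
move=> H; rewrite /j ler_pdivrMl// mulrDr mulrA divff ?gt_eqF// mul1r addrC; exact: H.
Qed.

Let eell i : elementary (ell i).
Proof.
apply: elementaryD; last exact: elementary_cst.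
apply: elementary_sum => k; apply: elementaryM; [exact: elementary_cst|exact: elementary_coord].
Qed.

Let eS : elementary S.
Proof.
apply: elementaryD; first exact: elementary_cst.
apply: elementary_sum => i; apply: elementary_exp; apply: elementaryM => //.
exact: elementary_cst.
Qed.

Let ej : elementary j.
Proof. by apply: elementaryM; [exact: elementary_cst|exact: elementary_ln]. Qed.

Let es : elementary s.
Proof.
apply: elementaryD; first exact: elementary_cst.
apply: elementaryM; first exact: elementary_cst.
apply: elementary_exp; apply: elementaryM; first exact: elementary_cst.
apply: elementary_ln => //; apply: elementaryD => //; exact: elementary_cst.
Qed.

Let sE x : s x = 1 - eta - w x `^ q.
Proof. by rewrite /s /powR (gt_eqF (w0 x)) mulN1r. Qed.

Let cj : continuous j. Proof. by have [] := smooth_C1 (elementary_smooth ej). Qed.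
Let cs : continuous s. Proof. by have [] := smooth_C1 (elementary_smooth es). Qed.

(** The gradient of log-sum-exp is a combination of the a_i with nonnegative weights of sum at most
    1, hence it inherits their bound 1/rho. *)
Let dj x e : exists2 d, is_derive x e j d & `|d| <= rho^-1 * enorm e.
Proof.
have dl i : is_derive x e (ell i) (dotr (a i) e).
  apply/is_derive_line.
  rewrite (_ : (fun t : R => ell i (x + t *: e)) = (fun t => ell i x + t * dotr (a i) e)).
    exact: is_derive_affine.
  by apply/funext => t; rewrite /ell dotrDr dotrZr addrAC.
have dE i : is_derive x e (fun y => expR (M * ell i y)) (expR (M * ell i x) * (M * dotr (a i) e)).
  exact: (is_derive_chain (is_derive_expR _) (is_deriveZ M (dl i))).
have dS : is_derive x e S (\sum_(i < N) expR (M * ell i x) * (M * dotr (a i) e)).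
  have H : is_derive x e (fun y => \sum_(i < N) expR (M * ell i y))
      (\sum_(i < N) expR (M * ell i x) * (M * dotr (a i) e)).
    have := @is_derive_sum R _ _ N (fun i y => expR (M * ell i y)) x e _ dE.
    by rewrite fct_sumE.
  have := is_deriveD (is_derive_cst (1 : R) x e) H.
  by rewrite add0r => H'; exact: H'.
have dL : is_derive x e (fun y => ln (S y))
    ((S x)^-1 * \sum_(i < N) expR (M * ell i x) * (M * dotr (a i) e)).
  exact: (is_derive_chain (is_derive1_ln (S0 x)) dS).
exists (M^-1 * ((S x)^-1 * \sum_(i < N) expR (M * ell i x) * (M * dotr (a i) e))).
  exact: (is_deriveZ M^-1 dL).
have Mi : 0 < M^-1 by rewrite invr_gt0.
have r0 : 0 <= rho^-1 * enorm e by rewrite mulr_ge0 ?enorm_ge0 ?invr_ge0 ?ltW.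
have Si : 0 < (S x)^-1 by rewrite invr_gt0.
rewrite normrM normrM (gtr0_norm Mi) (gtr0_norm Si) mulrCA.
rewrite ler_pdivrMl// ler_pdivrMl//; apply: (le_trans (ler_norm_sum _ _ _)).
apply: (@le_trans _ _ (\sum_(i < N) expR (M * ell i x) * (M * (rho^-1 * enorm e)))).
  apply: ler_sum => i _; rewrite !normrM ger0_norm ?expR_ge0// (gtr0_norm M0).
  rewrite ler_wpM2l ?expR_ge0// ler_pM2l//; apply: (le_trans (cauchy_schwarz _ _)).
  by rewrite ler_wpM2r ?enorm_ge0.
rewrite -mulr_suml mulrCA ler_wpM2l ?(ltW M0)// ler_wpM2r// /S lerDr.
exact: ler01.
Qed.

Section test.
Variable c : R.
Hypothesis c0 : 0 < c.
Let v x := c * (s x * flat eta 0 (s x)).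

Let sv : smooth v.
Proof.
apply: elementary_smooth; apply: elementaryM; first exact: elementary_cst.
by apply: elementaryM => //; exact: elementary_flat.
Qed.

(** The support lies in {s >= 0}, where w <= 1; hence every ell_i <= j <= 1 - eta, and [subO] places
    the point in Omega. *)
Let tv : test_fun Omega v.
Proof.
have C : closed [set x | 0 <= s x].
  by apply: (@preimage_closed _ _ s [set y | 0 <= y]) => //; exact: closed_ge.
have sub : closure [set x | v x != 0] `<=` [set x | 0 <= s x].
  rewrite [X in _ `<=` X](closure_id _).1//; apply: closure_subset => x /=.
  by rewrite leNgt; apply: contraNN => s0; rewrite /v /flat lt_gtF// !mulr0.
have sub2 : closure [set x | v x != 0] `<=` Omega.
  move=> x /sub /= sx; apply: subO => i; apply: (le_trans (ell_le x i)).
  have : w x `^ q <= 1.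
    by move: sx; rewrite sE => sx; have e0 := eta0; move: (w x `^ q) sx => W sx; lra.
  have E1 : 1 `^ q = 1 :> R by rewrite powR1.
  rewrite -[leRHS]E1 => H.
  suff : w x <= 1 by rewrite /w => H1; move: (j x) H1 => jx H1; lra.
  rewrite leNgt; apply/negP => w1.
  have := @gt0_ltr_powR R q q0 1 (w x); rewrite !nnegrE ler01 (ltW (w0 x)) => /(_ isT isT w1).
  by rewrite ltNge H.
split => //; apply: bounded_closed_compact; last exact: closed_closure.
have [K K0 OK] := bounded_set_rbox bO.
by apply: (@rbox_bounded _ _ _ 0 K) => x /sub2 /OK.
Qed.

Let v_ge x : c * (1 - 2 * eta - (J x + 2 * eta) `^ q) <= v x.
Proof.
rewrite /v ler_pM2l//; apply: le_trans (flat_id_ge eta0 (s x)).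
rewrite sE; suff : w x `^ q <= (J x + 2 * eta) `^ q.
  by move: (w x `^ q) (_ `^ q) => W W' WW; lra.
have : w x <= J x + 2 * eta by have : j x - eta <= J x; [rewrite /J le_max lexx orbT|rewrite /w; move: (j x) (J x) => jx Jx H; lra].
move=> H; apply: ge0_ler_powR; rewrite ?nnegrE ?(ltW q0) ?(ltW (w0 x))//.
by rewrite (le_trans _ H)// ltW.
Qed.

Let w_le x : w x `^ q <= (J x + 2 * eta) `^ q.
Proof.
have : w x <= J x + 2 * eta by have : j x - eta <= J x; [rewrite /J le_max lexx orbT|rewrite /w; move: (j x) (J x) => jx Jx H; lra].
move=> H; apply: ge0_ler_powR; rewrite ?nnegrE ?(ltW q0) ?(ltW (w0 x))//.
by rewrite (le_trans _ H)// ltW.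
Qed.

Let grad_v x : enorm (grad v x) `^ p <= (c * q / rho) `^ p * (J x + 2 * eta) `^ q.
Proof.
have K0 : 0 <= c * q / rho by rewrite !mulr_ge0 ?invr_ge0 ?ltW.
suff H : enorm (grad v x) <= (c * q / rho) * w x `^ (q - 1).
  apply: (@le_trans _ _ ((c * q / rho) `^ p * w x `^ q)); last by rewrite ler_wpM2l ?powR_ge0.
  have -> : w x `^ q = (w x `^ (q - 1)) `^ p by rewrite -powRrM qB1.
  rewrite -powRM ?powR_ge0//.
  apply: (ge0_ler_powR (ltW p0) _ _ H); rewrite nnegrE ?enorm_ge0//.
  by apply: mulr_ge0 => //; exact: powR_ge0.
(* Differentiating along grad v itself gives |grad v|^2 on one side and a multiple of |grad v| on
   the other; one factor is cancelled at the end. *)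
pose e := grad v x; have [d Dj dle] := dj x e.
have Dw : is_derive x e w d.
  have := is_deriveD Dj (is_derive_cst eta x e); rewrite addr0 => H'; exact: H'.
have Dln : is_derive x e (fun y => ln (w y)) ((w x)^-1 * d).
  exact: (is_derive_chain (is_derive1_ln (w0 x)) Dw).
have Dex : is_derive x e (fun y => expR (q * ln (w y))) (expR (q * ln (w x)) * (q * ((w x)^-1 * d))).
  exact: (is_derive_chain (is_derive_expR _) (is_deriveZ q Dln)).
have Ds : is_derive x e s ((-1) * (expR (q * ln (w x)) * (q * ((w x)^-1 * d)))).
  have := is_deriveD (is_derive_cst (1 - eta) x e) (is_deriveZ (-1 : R) Dex).
  by rewrite add0r => H'; exact: H'.
pose h := flat eta 0 (s x) + s x * (eta * flat eta 2 (s x) - 0 * flat eta 1 (s x)).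
have Dv : is_derive x e v (c * (h * ((-1) * (expR (q * ln (w x)) * (q * ((w x)^-1 * d)))))).
  have D1 : is_derive (s x) (1 : R) (fun t => t * flat eta 0 t) h.
    have := is_deriveM (is_derive_id (s x) (1 : R)) (is_derive_flat eta0 0 (s x)).
    by rewrite /GRing.scale/= mulr1 addrC => H'; exact: H'.
  exact: (is_deriveZ c (is_derive_chain D1 Ds)).
have Dv' := is_derive_C1 x e (smooth_C1 sv).
have E : dotr e e = c * (h * ((-1) * (expR (q * ln (w x)) * (q * ((w x)^-1 * d))))).
  by case: Dv' => _ <-; case: Dv => _ <-.
have wq : expR (q * ln (w x)) * (w x)^-1 = w x `^ (q - 1).
  apply: (mulfI (lt0r_neq0 (w0 x))).
  rewrite (mulr_powRB1 (ltW (w0 x)) q0) mulrCA mulfV ?mulr1 ?lt0r_neq0//.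
  by rewrite /powR (gt_eqF (w0 x)).
have /andP[h0 h1] := flat_id_derive_itv eta0 (s x); rewrite -/h in h0 h1.
have wq0 : 0 <= w x `^ (q - 1) by exact: powR_ge0.
have : enorm e * enorm e <= (c * q / rho * w x `^ (q - 1)) * enorm e.
  rewrite -expr2 sqr_enorm E.
  have -> : c * (h * ((-1) * (expR (q * ln (w x)) * (q * ((w x)^-1 * d))))) =
    (c * q * w x `^ (q - 1)) * (h * (- d)) by rewrite -wq; ring.
  have -> : c * q / rho * w x `^ (q - 1) * enorm e = (c * q * w x `^ (q - 1)) * (rho^-1 * enorm e) by ring.
  apply: ler_wpM2l; first by apply: mulr_ge0 => //; apply: mulr_ge0; exact: ltW.
  apply: (le_trans (ler_norm _)); rewrite normrM normrN (ger0_norm h0).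
  by apply: le_trans dle; rewrite ler_piMl.
have [->|en] := eqVneq (enorm e) 0; first by rewrite mulr_ge0.
by rewrite ler_pM2r// lt_neqAle eq_sym en enorm_ge0.
Qed.

Lemma torsional_rigidity_ge_logsumexp : exists J : 'rV[R]_m.+1 -> R,
  [/\ continuous J, forall x, 0 <= J x,
    forall t x, 0 <= t -> (forall i, dotr (a i) x + b i <= t) -> J x <= t &
    q * (c * \int[mu]_(x in Omega) (1 - 2 * eta - (J x + 2 * eta) `^ q) -
      p^-1 * ((c * q / rho) `^ p * \int[mu]_(x in Omega) ((J x + 2 * eta) `^ q)))
    <= torsional_rigidity p Omega].
Proof.
have cJ : continuous J.
  apply: (continuous_compr (h := fun t => Num.max 0 (t - eta))) cj => t.
  apply: (@continuous_max R _ (cst 0) (fun t : R => t - eta) t); first exact: cst_continuous.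
  by apply: (@continuous_addr R _ id (cst (- eta))) => y; [exact: cvg_id|exact: cst_continuous].
have J0 x : 0 <= J x by rewrite /J le_max lexx.
exists J; split => //.
  move=> t x t0 lt; rewrite /J ge_max t0 /= lerBlDr; exact: j_le.
have cW : continuous (fun x => (J x + 2 * eta) `^ q).
  have := continuous_compr (continuous_powR_norm q0)
    (continuous_addr cJ (@continuous_const _ _ (2 * eta))).
  rewrite (_ : (fun x => `|J x + 2 * eta| `^ q) = (fun x => (J x + 2 * eta) `^ q))//.
  by apply/funext => x; rewrite ger0_norm// addr_ge0// mulr_ge0// ltW.
have iW := open_integrable oO bO cW.
have cV : continuous (fun x => 1 - 2 * eta - (J x + 2 * eta) `^ q).
  by apply: continuous_addr; [exact: continuous_const|exact: continuous_oppr].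
have iV := open_integrable oO bO cV.
apply: le_trans (torsional_rigidity_ge p1 oO bO tv).
rewrite -/q ler_pM2l//; apply: lerB.
  rewrite -(RintegralZl _ mO iV).
  exact: (le_Rintegral mO (integrable_mull mO _ iV) (test_integrable oO bO tv) (fun x _ => v_ge x)).
rewrite ler_pM2l ?invr_gt0// -(RintegralZl _ mO iW).
exact: (le_Rintegral mO (test_penergy_integrable p1 oO bO tv) (integrable_mull mO _ iW) (fun x _ => grad_v x)).
Qed.

End test.
End lower_bound.

(** * Lower bounds and the ball *)

Section layer_cake.
Context (R : realType) (q : R) (k : nat) (q1 : 1 < q) (k0 : (0 < k)%N).

Let q0 : 0 < q. Proof. exact: lt_trans q1. Qed.
Let K : R := k%:R.
Let K0 : 0 < K. Proof. by rewrite ltr0n. Qed.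

(** Young's inequality for b^k and a^q with the exponents (k+q)/k and (k+q)/q. *)
Lemma powR_exprn_young (a b : R) : 0 <= a -> 0 <= b ->
  b ^+ k * a `^ q <= K / (K + q) * (b ^+ k * b `^ q) + q / (K + q) * (a ^+ k * a `^ q).
Proof.
move=> a0 b0; pose P := (K + q) / q.
have P1 : 1 < P by rewrite ltr_pdivlMr// mul1r ltrDr.
have E (t : R) : 0 <= t -> (t `^ q) `^ P = t ^+ k * t `^ q.
  move=> t0; rewrite -powRrM /P mulrC divfK ?gt_eqF// powRD ?powR_mulrn//.
  by rewrite gt_eqF ?implybT// addr_gt0.
have E' : (b `^ q) `^ (P - 1) = b ^+ k.
  rewrite -powRrM (_ : q * (P - 1) = K) ?powR_mulrn// /P; field; rewrite gt_eqF//.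
have := tangent_powR P1 (powR_ge0 a q) (powR_ge0 b q).
rewrite !E// E' => H.
have Kq : 0 < K + q by rewrite addr_gt0.
have qn : q != 0 by rewrite gt_eqF.
have Kqn : K + q != 0 by rewrite gt_eqF.
have P0 : 0 < P by rewrite divr_gt0.
rewrite -(ler_pM2l P0).
have -> : P * (K / (K + q) * (b ^+ k * b `^ q) + q / (K + q) * (a ^+ k * a `^ q)) =
    K / q * (b ^+ k * b `^ q) + a ^+ k * a `^ q by rewrite /P; field; rewrite qn Kqn.
move: H; have -> : b ^+ k * b `^ q + P * b ^+ k * (a `^ q - b `^ q) =
    P * (b ^+ k * a `^ q) - K / q * (b ^+ k * b `^ q) by rewrite /P; field.
by rewrite lerBlDl.
Qed.

(** One cell of a Riemann sum for the integral of (1 - t^k) d(t^q), whose primitive is t^q - q/(k+q)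
    t^(k+q). The term (q/n) t^k absorbs the discretization error and telescopes to q/n over
    [0,1]. *)
Lemma layer_step (n : nat) (a b : R) : 0 <= a -> a <= b -> b <= 1 -> b - a = n%:R^-1 ->
  (b `^ q - a `^ q) * (1 - a ^+ k) <=
  (b `^ q - q / (K + q) * (b ^+ k * b `^ q) + q / n%:R * b ^+ k) -
  (a `^ q - q / (K + q) * (a ^+ k * a `^ q) + q / n%:R * a ^+ k).
Proof.
move=> a0 ab b1 ban; have b0 := le_trans a0 ab.
have Y := powR_exprn_young a0 b0.
have d1 : b `^ q - a `^ q <= q / n%:R.
  have := tangent_powR q1 a0 b0; rewrite -ban => T.
  have bq : b `^ (q - 1) <= 1.
    have E1 : 1 `^ (q - 1) = 1 :> R by rewrite powR1.
    by rewrite -[leRHS]E1; apply: ge0_ler_powR; rewrite ?nnegrE// subr_ge0 ltW.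
  have : q * b `^ (q - 1) * (b - a) <= q * (b - a).
    by rewrite ler_wpM2r ?subr_ge0// ler_piMr// ltW.
  by move: T; rewrite -[a - b]opprB mulrN; move: (q * b `^ (q - 1) * (b - a)) => X; lra.
have d2 : a ^+ k <= b ^+ k by rewrite lerXn2r.
have d3 : (b `^ q - a `^ q) * (b ^+ k - a ^+ k) <= q / n%:R * (b ^+ k - a ^+ k).
  by rewrite ler_wpM2r ?subr_ge0.
have Kq : K + q != 0 by rewrite gt_eqF// addr_gt0.
have E : K / (K + q) = 1 - q / (K + q) by field.
move: Y d3; rewrite E; move: (q / (K + q)) (q / n%:R) (b `^ q) (a `^ q) (b ^+ k) (a ^+ k) => t c B A b' a'.
nra.
Qed.

Context d (T : measurableType d) (mu : {measure set T -> \bar R}) (E : set T) (J : T -> R).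
Hypotheses (mE : measurable E) (muE : (mu E < +oo)%E) (mJ : measurable_fun setT J).
Hypotheses (J01 : forall x, E x -> 0 <= J x <= 1).
Variable lam : R.
Hypotheses (lam0 : 0 <= lam) (HJ : forall i n : nat, (0 < i <= n)%N ->
  (i%:R / n%:R) ^+ k * lam <= fine (mu (E `&` [set x | J x <= i%:R / n%:R]))).

Let fin_sub (A : set T) : measurable A -> A `<=` E -> mu A \is a fin_num.
Proof.
move=> mA AE; rewrite ge0_fin_numE//; apply: le_lt_trans muE.
by apply: le_measure => //; rewrite inE.
Qed.

Let mle t : measurable [set x | J x <= t].
Proof.
rewrite (_ : [set _ | _] = setT `&` J @^-1` `]-oo, t]); first exact: mJ.
by apply/seteqP; split=> x /=; rewrite in_itv/= => // -[].
Qed.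

Let icst (c : R) : mu.-integrable E (EFin \o cst c).
Proof.
apply/integrableP; split; first by apply/measurable_EFinP; exact: measurable_cst.
rewrite (_ : (fun x => _) = cst `|c%:E|%E)//; rewrite integral_cst//.
by apply: lte_mul_pinfty.
Qed.

Let ile (f : T -> R) : measurable_fun E f -> (forall x, E x -> `|f x| <= 1) ->
  mu.-integrable E (EFin \o f).
Proof.
move=> mf f1; apply: (le_integrable mE _ _ (icst 1)); first exact/measurable_EFinP.
by move=> x Ex /=; rewrite lee_fin normr1 f1.
Qed.

Lemma powR_layer_integrable : mu.-integrable E (EFin \o (fun x => J x `^ q)).
Proof.
apply: ile.
  by apply: (measurableT_comp (measurable_powR q)); exact: measurable_funS mJ.
move=> x Ex /=; have /andP[j0 j1] := J01 Ex.
rewrite ger0_norm ?powR_ge0//.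
have E1 : 1 `^ q = 1 :> R by rewrite powR1.
by rewrite -[leRHS]E1; apply: ge0_ler_powR; rewrite ?nnegrE ?(ltW q0).
Qed.

(* Riemann sums replace the layer-cake integral, so that sublevel sets are only
   needed at rational heights. *)
Lemma layer_cake : \int[mu]_(x in E) (J x `^ q) <= fine (mu E) - q / (K + q) * lam.
Proof.
suff H n : (0 < n)%N ->
    \int[mu]_(x in E) (J x `^ q) <= fine (mu E) - q / (K + q) * lam + q * lam * n%:R^-1.
  have c : fine (mu E) - q / (K + q) * lam + q * lam * n.+1%:R^-1 @[n --> \oo] -->
      fine (mu E) - q / (K + q) * lam + q * lam * 0.
    apply: cvgD; first exact: cvg_cst.
    by apply: cvgM; [exact: cvg_cst|exact: cvg_harmonic].
  rewrite mulr0 addr0 in c.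
  have c0 : (fun _ : nat => \int[mu]_(x in E) (J x `^ q)) @ \oo --> \int[mu]_(x in E) (J x `^ q).
    exact: cvg_cst.
  by apply: (ler_cvg_to c0 c); apply: nearW => n; exact: H.
move=> n0; have N0 : 0 < n%:R :> R by rewrite ltr0n.
pose a (i : nat) : R := i%:R / n%:R.
have a0 i : 0 <= a i by rewrite divr_ge0.
have aS i : a i.+1 - a i = n%:R^-1 by rewrite /a -natr1 mulrDl addrAC subrr add0r mul1r.
have ale i : a i <= a i.+1 by rewrite -subr_ge0 aS invr_ge0 ltW.
have a1 i : (i <= n)%N -> a i <= 1 by move=> i_n; rewrite ler_pdivrMr// mul1r ler_nat.
have q00 : 0 `^ q = 0 :> R by rewrite powR0// gt_eqF.
have aq i : a i `^ q <= a i.+1 `^ q by apply: ge0_ler_powR; rewrite ?nnegrE ?(ltW q0).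
pose D i := a i.+1 `^ q - a i `^ q.
have D0 i : 0 <= D i by rewrite subr_ge0.
pose A i := E `&` ~` [set x | J x <= a i].
have mA i : measurable (A i) by apply: measurableI => //; exact: measurableC.
have AE i : A i `<=` E by move=> x [].
(* Increment [D i] counts exactly where J exceeds [a i], so at x the sum telescopes to the q-th
   power of a grid value that is at least J x. *)
have pt x : E x -> J x `^ q <= \sum_(0 <= i < n) D i * \1_(A i) x.
  move=> Ex; have /andP[j0 j1] := J01 Ex.
  have i0 i : 0 <= D i * \1_(A i) x by rewrite mulr_ge0// indicE.
  have : J x <= a n by rewrite /a divff// gt_eqF.
  have key l : J x <= a l -> J x `^ q <= \sum_(0 <= i < l) D i * \1_(A i) x.
    elim: l => [|l IH] jl.
      have -> : J x = 0 by apply/eqP; rewrite eq_le j0 andbT (le_trans jl)// /a mul0r.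
      by rewrite q00 big_nil.
    rewrite big_nat_recr//=; have [jl'|jl'] := leP (J x) (a l).
      by apply: (le_trans (IH jl')); rewrite lerDl.
    apply: (@le_trans _ _ (\sum_(0 <= i < l) D i + D l)).
      rewrite -(big_nat_recr l 0 D)//= telescope_sumr// /a mul0r q00 subr0 -/(a l.+1).
      by apply: ge0_ler_powR; rewrite ?nnegrE ?(ltW q0).
    have I1 i : (i <= l)%N -> \1_(A i) x = 1 :> R.
      move=> il; rewrite indicE mem_set//; split=> //= h.
      have : a i <= a l by rewrite /a ler_wpM2r ?invr_ge0// ler_nat.
      by move: jl'; rewrite ltNge => /negP + H; apply; exact: le_trans h H.
    rewrite I1// mulr1 lerD2r le_eqVlt; apply/orP; left; apply/eqP.
    by apply: eq_big_nat => i /andP[_ il]; rewrite I1 ?mulr1// ltnW.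
  exact: key.
have iA i : mu.-integrable E (EFin \o (fun x => \1_(A i) x : R)).
  apply: ile; first exact: measurable_indic.
  by move=> x _; rewrite indicE; case: (_ \in _); rewrite ?normr1 ?normr0.
have IA i : \int[mu]_(x in E) (\1_(A i) x : R) = fine (mu (A i)).
  by rewrite /Rintegral integral_indic// setIidl.
have muA i : (i <= n)%N -> fine (mu (A i)) <= fine (mu E) - a i ^+ k * lam.
  move=> i_n; have mI : measurable (E `&` [set x | J x <= a i]) by exact: measurableI.
  have H : fine (mu E) = fine (mu (A i)) + fine (mu (E `&` [set x | J x <= a i])).
    rewrite -(fineD (fin_sub (mA i) (@AE i)) (fin_sub mI (@subIsetl _ _ _))).
    by rewrite (measureDI mu mE (mle (a i))) setDE.
  rewrite lerBrDr {1}H lerD2l.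
  have [->|i0] := posnP i; first by rewrite /a mul0r expr0n gtn_eqF// mul0r fine_ge0.
  by apply: HJ; rewrite i0.
have sumI l : mu.-integrable E (EFin \o (fun x => \sum_(0 <= i < l) D i * \1_(A i) x)) /\
    \int[mu]_(x in E) (\sum_(0 <= i < l) D i * \1_(A i) x) = \sum_(0 <= i < l) D i * fine (mu (A i)).
  elim: l => [|l [IH1 IH2]].
    under [X in Rintegral _ _ X]eq_fun do rewrite big_nil.
    under eq_fun do rewrite big_nil; rewrite big_nil Rintegral_cst// mul0r; split => //.
    exact: (icst 0).
  under [X in Rintegral _ _ X]eq_fun do rewrite big_nat_recr//=.
  under eq_fun do rewrite big_nat_recr//=; rewrite big_nat_recr//=; split.
    exact: (integrable_addr mE IH1 (integrable_mull mE (D l) (iA l))).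
  by rewrite (RintegralD mE IH1 (integrable_mull mE (D l) (iA l))) IH2 (RintegralZl _ mE (iA l)) IA.
have [iS IS] := sumI n.
apply: (le_trans (le_Rintegral mE powR_layer_integrable iS pt)); rewrite IS.
(* [G] is the telescoping expression of [layer_step]. The bound V - a^k lam is split as (V - lam) +
   (1 - a^k) lam: the first part is multiplied by increments of a^q, the second by increments of
   [G]. *)
pose G i := a i `^ q - q / (K + q) * (a i ^+ k * a i `^ q) + q / n%:R * a i ^+ k.
apply: (@le_trans _ _ (\sum_(0 <= i < n) (D i * (fine (mu E) - lam) + (G i.+1 - G i) * lam))).
  apply: ler_sum_nat => i /andP[_ i_n]; apply: (le_trans (ler_wpM2l (D0 i) (muA i (ltnW i_n)))).
  have -> : D i * (fine (mu E) - a i ^+ k * lam) =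
    D i * (fine (mu E) - lam) + D i * (1 - a i ^+ k) * lam by ring.
  rewrite lerD2l ler_wpM2r//.
  by apply: layer_step => //; exact: a1.
rewrite big_split/= -!mulr_suml !telescope_sumr//.
have E1 : 1 `^ q = 1 :> R by rewrite powR1.
have an : a n = 1 by rewrite /a divff// gt_eqF.
have a00 : a 0%N = 0 by rewrite /a mul0r.
rewrite /G an a00 E1 q00 expr1n expr0n gtn_eqF//= !mulr0 !mulr1 !subr0 addr0 subr0.
by rewrite le_eqVlt; apply/orP; left; apply/eqP; ring.
Qed.

End layer_cake.

Section lower_bound_limit.
Context (R : realType) (p : R) (p1 : 1 < p) (m : nat) (Omega : set 'rV[R]_m.+1).
Hypotheses (oO : open Omega) (bO : bounded_set Omega).
Local Notation mu := (lebesgue_rV R m.+1).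

Let p0 : 0 < p. Proof. exact: lt_trans p1. Qed.
Let mO : measurable Omega. Proof. exact: open_rV_measurable. Qed.
Let q := p / (p - 1).
Let pB1 : 0 < p - 1. Proof. by rewrite subr_gt0. Qed.
Let q0 : 0 < q. Proof. by rewrite divr_gt0. Qed.
Let q1 : 1 < q. Proof. by rewrite ltr_pdivlMr// mul1r gtrBl. Qed.

Variables (k : nat) (lam rho : R).
Hypotheses (k0 : (0 < k)%N) (rho0 : 0 < rho) (lam0 : 0 <= lam).
(** Polytopes enclosing Omega and approximating it from within. The exponent k is the dimension when
    all of Omega is contracted to a point, and 1 when a slab is flattened in one direction. *)
Hypothesis family : forall eta, 0 < eta -> eta < 2^-1 ->
  exists (N : nat) (a : 'I_N -> 'rV[R]_m.+1) (b : 'I_N -> R),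
  [/\ forall i, enorm (a i) <= rho^-1,
      forall x, (forall i, dotr (a i) x + b i <= 1 - eta) -> Omega x,
      forall x, Omega x -> forall i, dotr (a i) x + b i <= 1 &
      forall t, 0 < t -> t <= 1 -> exists B : set 'rV[R]_m.+1,
        [/\ measurable B, B `<=` Omega, forall x, B x -> forall i, dotr (a i) x + b i <= t &
          t ^+ k * lam <= fine (mu B)] ].

Lemma torsional_rigidity_lower_bound (c V Theta : R) : 0 < c -> V = fine (mu Omega) ->
  Theta = V - q / (k%:R + q) * lam ->
  q * (c * (V - Theta) - p^-1 * ((c * q / rho) `^ p * Theta)) <= torsional_rigidity p Omega.
Proof.
move=> c0 -> -> {V Theta}; set V := fine _; set Theta := V - q / _ * lam; set X := (c * q / rho) `^ p; set T := torsional_rigidity p Omega.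
have V0 : 0 <= V by exact: fine_ge0.
have X0 : 0 <= X by exact: powR_ge0.
have P0 : 0 <= p^-1 by rewrite invr_ge0 ltW.
(* Slope of t^q up to t = 2, times the shift 2 eta: (J + 2 eta)^q <= J^q + C eta because J <= 1 and
   2 eta <= 1. *)
pose C := q * 2 `^ (q - 1) * 2.
have C0 : 0 <= C by apply: mulr_ge0 => //; apply: mulr_ge0; [exact: ltW|exact: powR_ge0].
(* The exact coefficient of eta after Theta has been replaced by Theta + C eta V and V by (1 - 2
   eta) V. *)
pose Z := q * (c * (2 * V + C * V) + p^-1 * (X * (C * V))).
have Z0 : 0 <= Z.
  have q00 := ltW q0; have c00 := ltW c0.
  exact: (mulr_ge0 q00 (addr_ge0 (mulr_ge0 c00 (addr_ge0 (mulr_ge0 (ler0n R 2) V0) (mulr_ge0 C0 V0)))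
    (mulr_ge0 P0 (mulr_ge0 X0 (mulr_ge0 C0 V0))))).
have V_fin : (mu Omega < +oo)%E by exact: (lebesgue_rV_bounded mO bO).
suff H eta : 0 < eta -> eta < 2^-1 ->
    q * (c * (V - Theta) - p^-1 * (X * Theta)) <= T + eta * Z.
  apply/ler_addgt0Pr => e e0.
  have Z1 : 0 < Z + 1 by rewrite ltr_wpDl.
  pose eta : R := Num.min 4^-1 (e / (Z + 1)).
  have eta0 : 0 < eta by rewrite lt_min invr_gt0 divr_gt0 ?ltr0n.
  have eta2 : eta < 2^-1 by rewrite gt_min ltf_pV2 ?posrE// ltr_nat.
  apply: (le_trans (H eta eta0 eta2)); rewrite lerD2l.
  apply: (@le_trans _ _ (e / (Z + 1) * Z)).
    by rewrite ler_wpM2r// ge_min lexx orbT.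
  by rewrite mulrAC ler_pdivrMr// ler_pM2l// lerDl.
move=> eta0 eta2; have [N [a [b [arho aO O1 Ht]]]] := family eta0 eta2.
have [J [cJ J0 Jt TJ]] := torsional_rigidity_ge_logsumexp p1 oO bO rho0 eta0 arho aO c0.
rewrite -/q -/X -/T in TJ.
have J1 x : Omega x -> J x <= 1 by move=> Ox; apply: Jt => // i; exact: O1.
have mJ : measurable_fun setT J by exact: continuous_rV_measurable.
have LC : \int[mu]_(x in Omega) (J x `^ q) <= Theta.
  apply: (layer_cake q1 k0 mO V_fin mJ _ lam0) => [x Ox|i n /andP[i0 i_n]].
    by rewrite J0 J1.
  have n0 : (0 < n)%N by exact: leq_trans i_n.
  have t0 : 0 < i%:R / n%:R :> R by rewrite divr_gt0 ?ltr0n.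
  have [|B [mB BO Bt BL]] := Ht _ t0; first by rewrite ler_pdivrMr ?ltr0n// mul1r ler_nat.
  apply: (le_trans BL).
  have mle : measurable (Omega `&` [set x | J x <= i%:R / n%:R]).
    apply: measurableI => //; rewrite (_ : [set _ | _] = setT `&` J @^-1` `]-oo, (i%:R / n%:R)]).
      exact: mJ.
    by apply/seteqP; split=> x /=; rewrite in_itv/= => // -[].
  have fle (A : set 'rV[R]_m.+1) : measurable A -> A `<=` Omega -> mu A \is a fin_num.
    move=> mA AO; rewrite ge0_fin_numE//; apply: le_lt_trans V_fin.
    by apply: le_measure => //; rewrite inE.
  apply: fine_le; [exact: fle|exact: fle _ mle (@subIsetl _ _ _)|].
  apply: le_measure; rewrite ?inE// => x Bx; split; first exact: BO.
  by apply: Jt; [exact: ltW|exact: Bt].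
have iJ : mu.-integrable Omega (EFin \o (fun x => J x `^ q)).
  apply: (powR_layer_integrable q1 mO V_fin mJ) => x Ox; by rewrite J0 J1.
have cW : continuous (fun x => (J x + 2 * eta) `^ q).
  have := continuous_compr (continuous_powR_norm q0)
    (continuous_addr cJ (@continuous_const _ _ (2 * eta))).
  rewrite (_ : (fun x => `|J x + 2 * eta| `^ q) = (fun x => (J x + 2 * eta) `^ q))//.
  by apply/funext => x; rewrite ger0_norm// addr_ge0// mulr_ge0// ltW.
have iW := open_integrable oO bO cW.
have icst (d : R) := finite_integrable_cst oO bO d.
have WE : \int[mu]_(x in Omega) ((J x + 2 * eta) `^ q) <= Theta + C * eta * V.
  apply: (@le_trans _ _ (\int[mu]_(x in Omega) (J x `^ q + cst (C * eta) x))).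
    apply: (le_Rintegral mO iW (integrable_addr mO iJ (icst _))) => x Ox.
    have j0 := J0 x; have j1 := J1 x Ox; have e2 : 2 * eta <= 1 by move: eta2; lra.
    have je : 0 <= J x + 2 * eta by rewrite addr_ge0// mulr_ge0// ltW.
    have := tangent_powR q1 j0 je.
    have : (J x + 2 * eta) `^ (q - 1) <= 2 `^ (q - 1).
      by apply: ge0_ler_powR; rewrite ?nnegrE ?subr_ge0 ?(ltW q1)//; lra.
    move=> h1 h2; rewrite /cst /C; have e00 := eta0.
    have : q * (J x + 2 * eta) `^ (q - 1) * (2 * eta) <= q * 2 `^ (q - 1) * (2 * eta).
      by rewrite ler_wpM2r ?mulr_ge0 ?(ltW eta0)// ler_pM2l.
    have E : J x - (J x + 2 * eta) = - (2 * eta) by ring.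
    rewrite E mulrN in h2; move: h2.
    by move: (q * (J x + _) `^ _ * _) (2 `^ (q - 1)) (_ `^ q) (_ `^ q) => y1 y2 y3 y4; lra.
  by rewrite (RintegralD mO iJ (icst _)) Rintegral_cst// lerD2r.
have VE : \int[mu]_(x in Omega) (1 - 2 * eta - (J x + 2 * eta) `^ q) =
    (1 - 2 * eta) * V - \int[mu]_(x in Omega) ((J x + 2 * eta) `^ q).
  by rewrite (RintegralB mO (icst (1 - 2 * eta)) iW) Rintegral_cst.
rewrite VE in TJ; move: TJ WE; move: (Rintegral _ _ _) => W TJ WE.
rewrite -lerBlDr; apply: le_trans TJ.
have -> : q * (c * (V - Theta) - p^-1 * (X * Theta)) - eta * Z =
  q * (c * ((1 - 2 * eta) * V - (Theta + C * eta * V)) - p^-1 * (X * (Theta + C * eta * V))).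
  by rewrite /Z; ring.
rewrite ler_pM2l//; apply: lerB.
  by rewrite ler_pM2l// lerD2l lerN2.
by apply: ler_wpM2l => //; exact: ler_wpM2l.
Qed.

End lower_bound_limit.

(** * Convex domains and circumscribed polytopes *)

Section convex_rV.
Context (R : realType) (m : nat).
Implicit Types (Omega : set 'rV[R]_m.+1) (x y z : 'rV[R]_m.+1).

Lemma dotr_sub_sqr (v w : 'rV[R]_m.+1) (u : R) :
  dotr (v - u *: w) (v - u *: w) = dotr v v - 2 * u * dotr v w + u ^+ 2 * dotr w w.
Proof. by rewrite dotrBl !dotrBr !dotrZl !dotrZr (dotrC w v); ring. Qed.

Lemma convex_setP Omega x y (t : R) : convex_set Omega -> 0 <= t -> t <= 1 ->
  Omega x -> Omega y -> Omega (t *: x + (1 - t) *: y).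
Proof.
move=> cO t0 t1 /mem_set Ox /mem_set Oy; have := cO x y (Itv01 t0 t1) Ox Oy.
by rewrite inE.
Qed.

Lemma open_rbox Omega x : open Omega -> Omega x ->
  exists2 e : R, 0 < e & rbox x (fun=> e) `<=` Omega.
Proof.
move=> oO /(oO x) /nbhs_ballP[e /= e0 H]; exists e => //.
by rewrite -(ball_rV x e0).
Qed.

Lemma closure_rbox Omega z (e : R) : closure Omega z -> 0 < e ->
  exists2 z', Omega z' & forall i, `|z' ord0 i - z ord0 i| < e.
Proof.
move=> cz e0; have [z' []] := cz _ (nbhsx_ballx z e e0).
by rewrite (ball_rV z e0) => Oz' h; exists z'.
Qed.

(** z is replaced by a nearby point of Omega and the error is carried over to x, which has room to
    move because Omega is open. *)
Lemma convex_closure_open Omega z x (t : R) : open Omega -> convex_set Omega ->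
  closure Omega z -> Omega x -> 0 < t -> t <= 1 -> Omega ((1 - t) *: z + t *: x).
Proof.
move=> oO cO cz Ox t0 t1; have [e e0 He] := open_rbox oO Ox.
have [|z' Oz' Hz'] := closure_rbox cz (_ : 0 < e * t); first by rewrite mulr_gt0.
have tn : t != 0 by rewrite gt_eqF.
pose x' := x + ((1 - t) / t) *: (z - z').
have Ox' : Omega x'.
  apply: He => i; rewrite !mxE addrAC subrr add0r normrM.
  have c0 : 0 <= (1 - t) / t by rewrite divr_ge0 ?subr_ge0// ltW.
  rewrite ger0_norm// distrC.
  have := Hz' i; move: `|_ - _| (normr_ge0 (z' ord0 i - z ord0 i)) => d d0 dlt.
  have : (1 - t) * d < e * t.
    apply: le_lt_trans dlt; rewrite ler_piMl//; lra.
  by rewrite mulrAC ltr_pdivrMr.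
have -> : (1 - t) *: z + t *: x = t *: x' + (1 - t) *: z'.
  by apply/rowP => i; rewrite !mxE; field.
by apply: convex_setP => //; exact: ltW.
Qed.

(** Separation through the nearest point of the closure, normalized so that Omega lies in {a . (x -
    x0) <= 1}. The level t < 1 leaves room for y on the boundary of Omega. *)
Lemma convex_separation Omega x0 y (t : R) : open Omega -> bounded_set Omega ->
  convex_set Omega -> Omega x0 -> ~ Omega y -> 0 < t -> t < 1 ->
  exists a : 'rV[R]_m.+1, (forall x, Omega x -> dotr a (x - x0) <= 1) /\
    t < dotr a (y - x0).
Proof.
move=> oO bO cO Ox0 Oy t0 t1; pose s := (t + 1) / 2.
have s0 : 0 < s by rewrite divr_gt0// addr_gt0.
have s1 : s < 1 by rewrite /s; lra.
have ts : t < s by rewrite /s; lra.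
have sn : s != 0 by rewrite gt_eqF.
(* y may lie in the closure; pushed away from x0 by 1/s > 1 it no longer does, and the projection
   starts from there. *)
pose y1 := x0 + s^-1 *: (y - x0).
have ny1 : ~ closure Omega y1.
  move=> cy1; apply: Oy.
  have := @convex_closure_open _ y1 x0 (1 - s) oO cO cy1 Ox0.
  rewrite subr_gt0 s1 gerBl (ltW s0) => /(_ isT isT).
  congr (Omega _); apply/rowP => i; rewrite !mxE; field; exact: sn.
have [M M0 OM] := bounded_set_rbox bO.
have cpt : compact (closure Omega).
  apply: bounded_closed_compact; last exact: closed_closure.
  apply: (@rbox_bounded _ _ _ 0 (M + 1)) => z /closure_rbox /(_ ltr01)[z' /OM Oz' Hz'] i.
  have := Oz' i; have := Hz' i; rewrite mxE !subr0 => h1 h2.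
  rewrite -[z ord0 i](subrK (z' ord0 i)) (le_lt_trans (ler_normD _ _))//.
  by rewrite distrC addrC ltrD.
pose f z := dotr (y1 - z) (y1 - z).
have cf : continuous f.
  by apply: continuous_dotr_comp => i; under eq_fun do rewrite mxE [X in _ + X]mxE;
    apply: continuous_addr; [exact: continuous_const|apply: continuous_oppr; exact: coord_continuous
    |exact: continuous_const|apply: continuous_oppr; exact: coord_continuous].
have [|z cz zmin] := @EVT_min_rV _ _ f (closure Omega) _ cpt (continuous_subspaceT cf).
  by exists x0; exact: subset_closure.
move/set_mem : cz => cz.
pose n := y1 - z; have n0 : 0 < dotr n n.
  rewrite -sqr_enorm exprn_gt0// enorm_gt0; apply/eqP => /subr0_eq yz.
  by apply: ny1; rewrite yz.
have nz x : Omega x -> dotr n (x - z) <= 0.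
  move=> Ox; rewrite leNgt; apply/negP; set A := dotr n _ => A0.
  pose d := dotr (x - z) (x - z); have d0 : 0 <= d by exact: dotr_ge0.
  have d1 : 0 < d + 1 by rewrite ltr_wpDl.
  (* Moving from z towards x by u changes the squared distance to y1 by u (u d - 2A), which is
     negative since u d <= A: this would contradict minimality. *)
  pose u := Num.min 1 (A / (d + 1)).
  have u0 : 0 < u by rewrite lt_min ltr01 divr_gt0.
  have u1 : u <= 1 by rewrite ge_min lexx.
  have uA : u * d <= A.
    apply: (@le_trans _ _ (A / (d + 1) * d)); first by rewrite ler_wpM2r// ge_min lexx orbT.
    by rewrite mulrAC ler_pdivrMr// ler_pM2l// lerDl.
  have Ow := convex_closure_open oO cO cz Ox u0 u1.
  have := zmin _ (mem_set (subset_closure Ow)); rewrite /f.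
  have -> : y1 - ((1 - u) *: z + u *: x) = n - u *: (x - z).
    by apply/rowP => i; rewrite !mxE; ring.
  rewrite -/n dotr_sub_sqr -/A -/d => H.
  have : 0 <= u * (u * d - 2 * A) by move: H; move: (dotr n n) => nn; lra.
  by rewrite pmulr_rge0// subr_ge0; lra.
pose h := dotr n (z - x0).
have h0 : 0 < h.
  have [e e0 He] := open_rbox oO Ox0; pose c := e / (1 + enorm n).
  have N1 : 0 < 1 + enorm n by rewrite ltr_pwDl// enorm_ge0.
  have c0 : 0 < c by rewrite divr_gt0.
  have Oc : Omega (x0 + c *: n).
    apply: He => i; rewrite mxE addrAC subrr add0r mxE normrM gtr0_norm//.
    rewrite /c mulrAC ltr_pdivrMr// ltr_pM2l//; apply: le_lt_trans (enorm_coord n i) _.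
    by rewrite ltrDr.
  have := nz _ Oc; have -> : x0 + c *: n - z = c *: n - (z - x0).
    by apply/rowP => i; rewrite !mxE; ring.
  rewrite dotrBr dotrZr -/h subr_le0; apply: lt_le_trans; exact: mulr_gt0.
exists (h^-1 *: n); split => [x Ox|].
  rewrite dotrZl ler_pdivrMl// mulr1; have := nz _ Ox.
  have -> : x - z = (x - x0) - (z - x0) by apply/rowP => i; rewrite !mxE; ring.
  by rewrite dotrBr subr_le0.
have -> : y - x0 = s *: (n + (z - x0)).
  by apply/rowP => i; rewrite !mxE; field; exact: sn.
rewrite dotrZl dotrZr dotrDr -/h; apply: (lt_trans ts).
have -> : h^-1 * (s * (dotr n n + h)) = s * (1 + dotr n n / h) by field; rewrite gt_eqF.
by rewrite ltr_pMr// ltrDl divr_gt0.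
Qed.

(** The open half-spaces of [convex_separation] cover the complement of Omega; compactness selects
    finitely many on a bounded part of it. *)
Lemma convex_polytope Omega x0 (t : R) : open Omega -> bounded_set Omega ->
  convex_set Omega -> Omega x0 -> 0 < t -> t < 1 ->
  exists (N : nat) (a : 'I_N -> 'rV[R]_m.+1),
    [/\ forall i, a i != 0, forall i x, Omega x -> dotr (a i) (x - x0) <= 1 &
      forall x, (forall i, dotr (a i) (x - x0) <= t) -> Omega x].
Proof.
move=> oO bO cO Ox0 t0 t1; have [M M0 OM0] := bounded_set_rbox bO.
have M20 : 0 < 2 * M by rewrite mulr_gt0.
have M40 : 0 < 4 * M by rewrite mulr_gt0.
have OM : Omega `<=` ball x0 (2 * M).
  move=> x Ox; rewrite (ball_rV x0 M20) => i; have := OM0 _ Ox i; have := OM0 _ Ox0 i.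
  rewrite mxE !subr0 => h1 h2; apply: (le_lt_trans (ler_normB _ _)).
  by move: h1 h2; lra.
(* Omega lies in the ball of radius 2M, so [K] contains a full shell around it. *)
pose K := closure (ball x0 (4 * M)) `&` ~` Omega.
have cK : compact K.
  apply: bounded_closed_compact; last first.
    by apply: closedI; [exact: closed_closure|exact: open_closedC].
  apply: (@rbox_bounded _ _ _ x0 (4 * M + 1)) => z [] /closure_rbox /(_ ltr01)[z' Bz' Hz'] _ i.
  have := Hz' i; move: Bz'; rewrite (ball_rV x0 M40) => /(_ i) h1 h2.
  have -> : z ord0 i - x0 ord0 i = (z ord0 i - z' ord0 i) + (z' ord0 i - x0 ord0 i) by ring.
  by rewrite (le_lt_trans (ler_normD _ _))// [X in X + _]distrC addrC ltrD.
pose D : set 'rV[R]_m.+1 := [set a | a != 0 /\ forall x, Omega x -> dotr a (x - x0) <= 1].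
pose f (a : 'rV[R]_m.+1) := [set y | t < dotr a (y - x0)].
have of_ a : D a -> open (f a).
  move=> _; have ca : continuous (fun y => dotr a (y - x0)).
    apply: continuous_dotr_comp => i; first exact: continuous_const.
    under eq_fun do rewrite mxE [X in _ + X]mxE.
    by apply: continuous_addr; [exact: coord_continuous|exact: continuous_const].
  rewrite (_ : f a = (fun y => dotr a (y - x0)) @^-1` [set r | t < r]); last by [].
  by apply: open_comp => //; exact: open_gt.
have cov : K `<=` cover D f.
  move=> y [_ Oy]; have [a [Da ya]] := convex_separation oO bO cO Ox0 Oy t0 t1.
  exists a => //; split => //; apply/eqP => a0.
  by move: ya; rewrite a0 dotr0l => /(lt_trans t0); rewrite ltxx.
have : cover_compact K by rewrite -compact_cover.
move=> /(_ _ D f of_ cov)[D' D'D Kcov].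
have DN (i : 'I_(size (finmap.enum_fset D'))) : D (finmap.enum_fset D')`_i.
  by apply: set_mem; apply: D'D; exact: (mem_nth 0 (ltn_ord i)).
exists (size (finmap.enum_fset D')), (fun i => (finmap.enum_fset D')`_i); split.
- by move=> i; have [] := DN i.
- by move=> i x Ox; have [_] := DN i; exact.
move=> x Hx; apply: contrapT => nOx.
have key y (sg : R) : 0 < sg -> sg <= 1 -> y = x0 + sg *: (x - x0) -> ~ Omega y ->
    ball x0 (4 * M) y -> False.
  move=> sg0 sg1 yE nOy By.
  have [a aD'] := Kcov y (conj (@subset_closure _ _ _ By) nOy).
  rewrite /f /= yE addrC addKr dotrZr.
  have aD'' : a \in finmap.enum_fset D' by [].
  have ia : (index a (finmap.enum_fset D') < size (finmap.enum_fset D'))%N by rewrite index_mem.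
  have := Hx (Ordinal ia); rewrite /= nth_index// => h1.
  rewrite ltNge; move/negP; apply; apply: (@le_trans _ _ (sg * t)).
    by rewrite ler_pM2l.
  by rewrite ler_piMl// ltW.
have [Bx|Bx] := pselect (ball x0 (4 * M) x).
  by apply: (key x 1) => //; rewrite ?ltr01// scale1r addrC subrK.
have nx : 2 * M < `|x - x0|.
  move: Bx; rewrite -ball_normE /ball_ /= distrC => /negP; rewrite -leNgt; apply: lt_le_trans.
  by move: M0; lra.
have nx0 : 0 < `|x - x0| by exact: lt_trans nx.
(* A point outside the ball of radius 4M is pulled back along its ray to distance 2M: it is still
   outside Omega, still satisfies the inequalities, and lies in [K]. *)
pose sg := 2 * M / `|x - x0|.
have sg0 : 0 < sg by rewrite divr_gt0.
have ny : `|x0 - (x0 + sg *: (x - x0))| = 2 * M.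
  by rewrite opprD addrA subrr add0r normrN normrZ gtr0_norm// /sg divfK// gt_eqF.
apply: (key (x0 + sg *: (x - x0)) sg) => //.
- by rewrite /sg ler_pdivrMr// mul1r ltW.
- by move=> /OM; rewrite -ball_normE /ball_ /= ny ltxx.
- by rewrite -ball_normE /ball_ /= ny; move: M0; lra.
Qed.

Lemma enorm_le_inv (a : 'rV[R]_m.+1) x0 (rho : R) : 0 < rho ->
  (forall x, eball x0 rho x -> dotr a (x - x0) <= 1) -> enorm a <= rho^-1.
Proof.
move=> r0 H; rewrite leNgt; apply/negP => ra.
have a0 : 0 < enorm a by apply: lt_trans ra; rewrite invr_gt0.
have ar : 1 < enorm a * rho by rewrite -ltr_pdivrMr// mul1r.
pose r := (rho + (enorm a)^-1) / 2.
have ai : (enorm a)^-1 < rho by rewrite invf_plt ?posrE.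
have rr : r < rho by rewrite /r; lra.
have air : (enorm a)^-1 < r by rewrite /r; lra.
have r00 : 0 < r by apply: lt_trans air; rewrite invr_gt0.
pose x := x0 + (r / enorm a) *: a.
have xx : x - x0 = (r / enorm a) *: a by rewrite /x addrC addKr.
have ex : eball x0 rho x.
  have ra0 : 0 < r / enorm a by rewrite divr_gt0.
  by rewrite /eball /= xx enormZ (gtr0_norm ra0) divfK// gt_eqF.
have := H _ ex; rewrite xx dotrZr -sqr_enorm expr2 mulrA divfK ?gt_eqF//.
by apply/negP; rewrite -ltNge -ltr_pdivrMr// mul1r.
Qed.

End convex_rV.

(** * Lower bounds for convex domains and slabs, upper bound for the ball *)

Section conjugate.
Context (R : realType) (p : R) (p1 : 1 < p).
Let q := p / (p - 1).
Let p0 : 0 < p. Proof. exact: lt_trans p1. Qed.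
Let pB1 : 0 < p - 1. Proof. by rewrite subr_gt0. Qed.
Let q0 : 0 < q. Proof. by rewrite divr_gt0. Qed.
Let qB1 : (q - 1) * p = q. Proof. by rewrite /q; field; rewrite gt_eqF. Qed.
Let qn : q != 0. Proof. by rewrite gt_eqF. Qed.

Lemma powR_subr1 (d s : R) : 0 < d -> d `^ (s - 1) = d `^ s / d.
Proof. by move=> d0; rewrite powRD ?(gt_eqF d0) ?implybT// powR_inv1// ltW. Qed.

Lemma powR_conj_scale (rho d : R) : 0 < rho -> 0 < d ->
  (rho `^ q * d `^ (1 - q) / q * q / rho) `^ p = rho `^ q * (d `^ (1 - q) / d).
Proof.
move=> r0 d0; have -> : rho `^ q * d `^ (1 - q) / q * q / rho = rho `^ (q - 1) * d `^ (1 - q).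
  by rewrite powR_subr1// divfK// mulrAC.
rewrite powRM ?powR_ge0// -!powRrM qB1; congr (_ * _).
by rewrite -powR_subr1//; congr (_ `^ _); rewrite -opprB mulNr qB1; ring.
Qed.

Lemma young_conj (a b : R) : 0 <= a -> 0 <= b ->
  a * b <= (1 - p^-1) * a `^ q + p^-1 * b `^ p.
Proof.
move=> a0 b0; have := young_powR p1 (powR_ge0 a (p - 1)^-1) b0.
rewrite -!powRrM mulVf ?gt_eqF// powRr1// (_ : (p - 1)^-1 * p = q)//.
by rewrite /q mulrC.
Qed.

End conjugate.

Section rigidity_bounds.
Context (R : realType) (p : R) (p1 : 1 < p) (m : nat).
Local Notation mu := (lebesgue_rV R m.+1).
Implicit Types Omega : set 'rV[R]_m.+1.

Let q := p / (p - 1).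
Let p0 : 0 < p. Proof. exact: lt_trans p1. Qed.
Let pB1 : 0 < p - 1. Proof. by rewrite subr_gt0. Qed.
Let q0 : 0 < q. Proof. by rewrite divr_gt0. Qed.
Let q1 : 1 < q. Proof. by rewrite ltr_pdivlMr// mul1r gtrBl. Qed.
Let D : R := m.+1%:R.
Let D0 : 0 < D. Proof. by rewrite ltr0n. Qed.

(** The term with fine (mu Omega) - lam is the penalty for sublevel sets that scale from a part of
    the domain only; it is zero for convex domains and tends to zero, relative to the volume, for
    long slabs. *)
Lemma torsional_rigidity_ge_family Omega (k : nat) (lam rho : R) :
  open Omega -> bounded_set Omega -> (0 < k)%N -> 0 < rho -> 0 <= lam ->
  (forall eta, 0 < eta -> eta < 2^-1 ->
    exists (N : nat) (a : 'I_N -> 'rV[R]_m.+1) (b : 'I_N -> R),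
    [/\ forall i, enorm (a i) <= rho^-1,
        forall x, (forall i, dotr (a i) x + b i <= 1 - eta) -> Omega x,
        forall x, Omega x -> forall i, dotr (a i) x + b i <= 1 &
        forall t, 0 < t -> t <= 1 -> exists B : set 'rV[R]_m.+1,
          [/\ measurable B, B `<=` Omega, forall x, B x -> forall i, dotr (a i) x + b i <= t &
            t ^+ k * lam <= fine (mu B)] ]) ->
  rho `^ q * k%:R `^ (1 - q) * (lam / (k%:R + q) - (q - 1) / k%:R * (fine (mu Omega) - lam))
    <= torsional_rigidity p Omega.
Proof.
move=> oO bO k0 rho0 lam0 fam; have K0 : 0 < k%:R :> R by rewrite ltr0n.
(* The maximizer of the lower bound over c when lam is the full volume; it is the amplitude of the
   torsion function of the ball for k the dimension, and of the slab for k = 1. *)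
pose c := rho `^ q * k%:R `^ (1 - q) / q.
have c0 : 0 < c by rewrite divr_gt0// mulr_gt0// powR_gt0.
have := @torsional_rigidity_lower_bound R p p1 m Omega oO bO k lam rho k0 rho0 lam0 fam
  c _ _ c0 erefl erefl.
rewrite -/q /c (powR_conj_scale p1 rho0 K0); apply: le_trans.
rewrite le_eqVlt; apply/orP; left; apply/eqP.
have pE : p^-1 = (q - 1) / q by rewrite /q; field; rewrite !gt_eqF.
rewrite pE; move: (rho `^ q) (k%:R `^ (1 - q)) (fine _) => Y Z V.
by field; rewrite !gt_eqF// addr_gt0.
Qed.

(** The polytope functions are a_i . (x - x0). The inscribed ball bounds their slopes by 1/rho, and
    contraction towards x0 makes the sublevel sets scale with the full volume, so k is the
    dimension. *)
Lemma torsional_rigidity_convex_ge Omega x0 (rho : R) :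
  open Omega -> bounded_set Omega -> convex_set Omega -> 0 < rho ->
  eball x0 rho `<=` Omega ->
  rho `^ q * D `^ (1 - q) / (D + q) * fine (mu Omega) <= torsional_rigidity p Omega.
Proof.
move=> oO bO cO rho0 BO; have mO := open_rV_measurable oO.
have V0 : 0 <= fine (mu Omega) by exact: fine_ge0.
have Ox0 : Omega x0 by apply: BO; rewrite /eball /= subrr enorm0.
have fam : forall eta, 0 < eta -> eta < 2^-1 ->
    exists (N : nat) (a : 'I_N -> 'rV[R]_m.+1) (b : 'I_N -> R),
    [/\ forall i, enorm (a i) <= rho^-1,
        forall x, (forall i, dotr (a i) x + b i <= 1 - eta) -> Omega x,
        forall x, Omega x -> forall i, dotr (a i) x + b i <= 1 &
        forall t, 0 < t -> t <= 1 -> exists B : set 'rV[R]_m.+1,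
          [/\ measurable B, B `<=` Omega, forall x, B x -> forall i, dotr (a i) x + b i <= t &
            t ^+ m.+1 * fine (mu Omega) <= fine (mu B)] ].
  move=> eta eta0 eta2.
  have [||N [a [_ a1 aO]]] := @convex_polytope R m Omega x0 (1 - eta) oO bO cO Ox0.
  - by rewrite subr_gt0 (lt_trans eta2)// invf_lt1 ?ltr1n.
  - by rewrite gtrBl.
  have E i x : dotr (a i) x - dotr (a i) x0 = dotr (a i) (x - x0) by rewrite dotrBr.
  exists N, a, (fun i => - dotr (a i) x0); split.
  - by move=> i; apply: (enorm_le_inv rho0) => x /BO; exact: a1.
  - by move=> x Hx; apply: aO => i; rewrite -E.
  - by move=> x Ox i; rewrite E a1.
  (* The preimage below is x0 + t (Omega - x0). *)
  - move=> t t0 t1; pose c := x0 - t^-1 *: x0.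
    have ti : 0 < t^-1 by rewrite invr_gt0.
    exists ((fun x => t^-1 *: x + c) @^-1` Omega).
    have xE x : x = t *: (t^-1 *: x + c) + (1 - t) *: x0.
      by apply/rowP => i; rewrite !mxE; field; rewrite gt_eqF.
    have A := lebesgue_rV_affine c ti mO.
    split.
    + apply: open_rV_measurable; apply: open_comp => // x _.
      by apply: continuousD; [apply: continuousZr; exact: cvg_id|exact: cst_continuous].
    + by move=> x /= Bx; rewrite (xE x); apply: (convex_setP cO (ltW t0) t1 Bx Ox0).
    + move=> x /= Bx i; rewrite E.
      have -> : x - x0 = t *: (t^-1 *: x + c - x0).
        by apply/rowP => j; rewrite !mxE; field; rewrite gt_eqF.
      by rewrite dotrZr ler_piMr ?(ltW t0)// a1.
    + by rewrite A invrK fineM ?fin_num_EFin// ge0_fin_numE// lebesgue_rV_bounded.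
have := torsional_rigidity_ge_family oO bO (ltn0Sn m) rho0 V0 fam.
apply: le_trans; rewrite subrr mulr0 subr0 -/D le_eqVlt; apply/orP; left; apply/eqP.
by rewrite mulrAC mulrA.
Qed.

(** Young's inequality is applied to |x|/D and |grad v|. It is sharp because the torsion function of
    the ball satisfies |grad u|^(p-1) = |x|/D; the q-th moment of |x| comes from [layer_cake]. *)
Lemma torsional_rigidity_ball_le (r : R) : 0 < r ->
  torsional_rigidity p (eball (0 : 'rV[R]_m.+1) r) <=
  r `^ q * D `^ (1 - q) / (D + q) * fine (mu (eball 0 r)).
Proof.
move=> r0; set B := eball _ r; have oB : open B by exact: open_eball.
have bB : bounded_set B by exact: bounded_eball.
have mB := open_rV_measurable oB; set V := fine (mu B).
have V0 : 0 <= V by exact: fine_ge0.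
have VB : (mu B < +oo)%E by exact: lebesgue_rV_bounded.
pose J (x : 'rV[R]_m.+1) := enorm x / r.
have cJ : continuous J.
  by apply: continuous_mulr; [exact: continuous_enorm|exact: continuous_const].
have mJ : measurable_fun setT J by exact: continuous_rV_measurable.
have J01 x : B x -> 0 <= J x <= 1.
  rewrite /B /eball /= subr0 => xr.
  by rewrite /J divr_ge0 ?enorm_ge0 ?(ltW r0)//= ler_pdivrMr// mul1r ltW.
have LC : \int[mu]_(x in B) (J x `^ q) <= V - q / (D + q) * V.
  apply: (layer_cake q1 (ltn0Sn m) mB VB mJ J01 V0) => i n /andP[i0 i_n].
  set t : R := i%:R / n%:R.
  have n0 : (0 < n)%N by exact: leq_trans i_n.
  have t0 : 0 < t by rewrite divr_gt0 ?ltr0n.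
  have t1 : t <= 1 by rewrite ler_pdivrMr ?ltr0n// mul1r ler_nat.
  have ti : 0 < t^-1 by rewrite invr_gt0.
  have A := lebesgue_rV_affine 0 ti mB; rewrite invrK in A.
  have -> : t ^+ m.+1 * V = fine (mu ((fun x => t^-1 *: x + 0) @^-1` B)).
    by rewrite A fineM ?fin_num_EFin// ge0_fin_numE.
  have mS : measurable (B `&` [set x | J x <= t]).
    apply: measurableI => //; rewrite (_ : [set _ | _] = setT `&` J @^-1` `]-oo, t]); first exact: mJ.
    by apply/seteqP; split=> x /=; rewrite in_itv/= => // -[].
  apply: fine_le.
  - by rewrite A fin_numM ?fin_num_EFin// ge0_fin_numE.
  - rewrite ge0_fin_numE//; apply: le_lt_trans VB.
    by apply: le_measure; rewrite ?inE//; exact: subIsetl.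
  apply: le_measure; rewrite ?inE//.
    apply: open_rV_measurable; apply: open_comp => // x _.
    by apply: continuousD; [apply: continuousZr; exact: cvg_id|exact: cst_continuous].
  move=> x; rewrite /B /eball /= addr0 !subr0 enormZ gtr0_norm// => h.
  have h' : enorm x < t * r by rewrite -ltr_pdivrMl.
  split; first by apply: (lt_le_trans h'); rewrite ler_piMl// ltW.
  by rewrite /J ler_pdivrMr// ltW.
have icJ : mu.-integrable B (EFin \o (fun x => J x `^ q)).
  exact: (powR_layer_integrable q1 mB VB mJ J01).
apply: (torsional_rigidity_le p1 oB bB) => v tv.
pose g (x : 'rV[R]_m.+1) := (1 - p^-1) * ((r / D) `^ q * J x `^ q) + p^-1 * enorm (grad v x) `^ p.
have ie := test_penergy_integrable p1 oB bB tv.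
have ig : mu.-integrable B (EFin \o g).
  exact: (integrable_addr mB (integrable_mull mB _ (integrable_mull mB _ icJ)) (integrable_mull mB _ ie)).
have cf : continuous (fun x => dotr x (grad v x)).
  by apply: continuous_dotr_comp => i; [exact: coord_continuous|exact: test_grad_coord_continuous tv].
have idf := open_integrable oB bB cf.
have fld := test_field oB bB tv.
have -> : \int[mu]_(x in B) v x = \int[mu]_(x in B) (- D^-1 * dotr x (grad v x)).
  rewrite (RintegralZl _ mB idf) fld -/D !mulNr mulrN opprK mulrA mulVf ?mul1r//.
  by rewrite gt_eqF.
apply: (@le_trans _ _ (\int[mu]_(x in B) g x)).
  apply: (le_Rintegral mB (integrable_mull mB _ idf) ig) => x _.
  apply: (@le_trans _ _ (enorm x / D * enorm (grad v x))).
    rewrite mulNr -mulrN [leRHS]mulrAC [leRHS]mulrC ler_pM2l ?invr_gt0//.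
    by apply: (le_trans (ler_norm _)); rewrite normrN; exact: cauchy_schwarz.
  have a0 : 0 <= enorm x / D by rewrite divr_ge0 ?enorm_ge0 ?(ltW D0).
  apply: (le_trans (young_conj p1 a0 (enorm_ge0 _))); rewrite lerD2r.
  rewrite -/q -powRM ?divr_ge0 ?enorm_ge0 ?(ltW r0) ?(ltW D0)//.
  rewrite (_ : r / D * J x = enorm x / D)// /J; field.
  by rewrite !gt_eqF.
have i1 := integrable_mull mB ((r / D) `^ q) icJ.
rewrite /g (RintegralD mB (integrable_mull mB _ i1) (integrable_mull mB _ ie)).
rewrite (RintegralZl _ mB ie) -/(penergy p B v) lerD2r (RintegralZl _ mB i1) (RintegralZl _ mB icJ).
apply: ler_wpM2l; first by rewrite subr_ge0 invf_le1 ?(ltW p1).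
apply: (le_trans (ler_wpM2l (powR_ge0 _ _) LC)).
rewrite powRM ?invr_ge0 ?(ltW r0) ?(ltW D0)//.
have -> : D^-1 `^ q = D `^ (1 - q) / D.
  by rewrite -powR_subr1// -powR_inv1 ?(ltW D0)// -powRrM; congr (_ `^ _); ring.
rewrite le_eqVlt; apply/orP; left; apply/eqP.
by move: (r `^ q) (D `^ _) => Y Z; field; rewrite !gt_eqF// addr_gt0.
Qed.

Lemma open_rbox_set n (c : 'rV[R]_n) (r : 'I_n -> R) : open (rbox c r).
Proof.
have H (s : seq 'I_n) : open [set x : 'rV[R]_n | forall i, i \in s -> `|x ord0 i - c ord0 i| < r i].
  elim: s => [|i s IH].
    by rewrite (_ : [set _ | _] = setT); [exact: openT|apply/seteqP; split].
  rewrite (_ : [set _ | _] = (fun x : 'rV[R]_n => `|x ord0 i - c ord0 i|) @^-1` [set y | y < r i] `&`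
      [set x : 'rV[R]_n | forall i, i \in s -> `|x ord0 i - c ord0 i| < r i]).
    apply: openI => //; apply: open_comp; last exact: open_lt.
    move=> x _; apply: (continuous_compr (@norm_continuous _ _)).
    by apply: continuous_addr; [exact: coord_continuous|exact: continuous_const].
  apply/seteqP; split=> x /= => [h|[h1 h2] j].
    by split => [|j js]; apply: h; rewrite inE ?eqxx// js orbT.
  by rewrite inE => /predU1P[->//|/h2].
rewrite (_ : rbox c r = [set x : 'rV[R]_n | forall i, i \in enum 'I_n -> `|x ord0 i - c ord0 i| < r i]).
  exact: H.
by apply/seteqP; split=> x /= h i => [_|]; [exact: h|apply: h; rewrite mem_enum].
Qed.

Definition slab (alpha L : R) : set 'rV[R]_m.+1 :=
  rbox 0 (fun i => if i == ord0 then alpha else L).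

Lemma lebesgue_slab alpha L : 0 < alpha -> 0 < L ->
  fine (mu (slab alpha L)) = 2 * alpha * (2 * L) ^+ m.
Proof.
move=> a0 L0; rewrite lebesgue_rbox//; last by move=> i; case: ifP.
rewrite /= big_ord_recl eqxx; congr (_ * _).
by under eq_bigr do rewrite /=; rewrite prodr_const card_ord.
Qed.

(** The side faces are given the same slope 1/alpha as the two main ones, so their functions become
    positive only within alpha of the sides. Cutting off that margin leaves a core in which only the
    first coordinate matters. *)
Lemma torsional_rigidity_slab_ge (alpha L : R) : 0 < alpha -> alpha < L ->
  alpha `^ q * (((L - alpha) / L) ^+ m / (1 + q) - (q - 1) * (1 - ((L - alpha) / L) ^+ m))
    * fine (mu (slab alpha L)) <= torsional_rigidity p (slab alpha L).
Proof.
move=> a0 aL; have L0 : 0 < L by exact: lt_trans aL.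
have La : 0 < L - alpha by rewrite subr_gt0.
pose lam := fine (mu (slab alpha (L - alpha))).
have lam0 : 0 <= lam by exact: fine_ge0.
have oS : open (slab alpha L) by exact: open_rbox_set.
have bS : bounded_set (slab alpha L).
  apply: (@rbox_bounded _ _ _ 0 L) => x Sx i; apply: (lt_le_trans (Sx i)).
  by case: ifP => // _; exact: ltW.
have fam : forall eta, 0 < eta -> eta < 2^-1 ->
    exists (N : nat) (a : 'I_N -> 'rV[R]_m.+1) (b : 'I_N -> R),
    [/\ forall i, enorm (a i) <= alpha^-1,
        forall x, (forall i, dotr (a i) x + b i <= 1 - eta) -> slab alpha L x,
        forall x, slab alpha L x -> forall i, dotr (a i) x + b i <= 1 &
        forall t, 0 < t -> t <= 1 -> exists B : set 'rV[R]_m.+1,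
          [/\ measurable B, B `<=` slab alpha L, forall x, B x -> forall i, dotr (a i) x + b i <= t &
            t ^+ 1 * lam <= fine (mu B)] ].
  move=> eta eta0 eta2.
  (* One function per face: a sign and a coordinate. *)
  pose A (j : bool * 'I_m.+1) : 'rV[R]_m.+1 := ((-1) ^+ j.1 * alpha^-1) *: delta_mx ord0 j.2.
  pose b (j : bool * 'I_m.+1) : R := if j.2 == ord0 then 0 else - ((L - alpha) / alpha).
  have AE j x : dotr (A j) x + b j =
      ((-1) ^+ j.1 * x ord0 j.2 - (if j.2 == ord0 then 0 else L - alpha)) / alpha.
    rewrite /A dotrZl dotrC dotr_delta /b; case: ifP => _; first by rewrite subr0 addr0; ring.
    by ring.
  have An j : enorm (A j) = alpha^-1.
    rewrite /A enormZ normrM normr_sign mul1r gtr0_norm ?invr_gt0//.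
    by rewrite /enorm dotr_delta mxE !eqxx sqrtr1 mulr1.
  pose e (i : 'I_#|{: bool * 'I_m.+1}|) := enum_val i.
  exists #|{: bool * 'I_m.+1}|, (A \o e), (b \o e); split.
  - by move=> i; rewrite /= An.
  - move=> x Hx i.
    have H j : dotr (A j) x + b j <= 1 - eta by have := Hx (enum_rank j); rewrite /= /e enum_rankK.
    have := H (false, i); have := H (true, i); rewrite !AE /= !ler_pdivrMr// mxE subr0.
    have ea : 0 < eta * alpha by exact: mulr_gt0.
    rewrite expr0 expr1 mulN1r mul1r ltr_norml.
    by case: ifP => _ h1 h2; apply/andP; split; move: h1 h2; lra.
  - move=> x Sx j; rewrite /= AE ler_pdivrMr//; have := Sx (e j).2; rewrite mxE subr0 ltr_norml.
    by case: (e j).1 => /=; rewrite ?expr0 ?expr1 ?mulN1r ?mul1r; case: ifP => _ /andP[h1 h2];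
      move: h1 h2; lra.
  (* Only the first direction shrinks with t, hence the exponent 1; on the shortened sides the other
     functions are negative. *)
  - move=> t t0 t1; exists (slab (t * alpha) (L - alpha)); split.
    + exact: measurable_rbox.
    + move=> x Bx i; apply: (lt_le_trans (Bx i)); case: ifP => _; last by rewrite gerBl ltW.
      by rewrite ler_piMl// ltW.
    + move=> x Bx j; rewrite /= AE ler_pdivrMr//; have := Bx (e j).2; rewrite mxE subr0 ltr_norml.
      have ta : 0 < t * alpha by exact: mulr_gt0.
      by case: (e j).1 => /=; rewrite ?expr0 ?expr1 ?mulN1r ?mul1r; case: ifP => _ /andP[h1 h2];
        move: h1 h2; lra.
    + rewrite expr1 /lam !lebesgue_slab ?mulr_gt0//.
      by rewrite le_eqVlt; apply/orP; left; apply/eqP; ring.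
have := torsional_rigidity_ge_family oS bS (ltn0Sn 0) a0 lam0 fam.
apply: le_trans; rewrite /lam !lebesgue_slab//.
have E1 : 1 `^ (1 - q) = 1 :> R by rewrite powR1.
rewrite E1 mulr1 divr1 -mulrA ler_pM2l ?powR_gt0//.
rewrite le_eqVlt; apply/orP; left; apply/eqP.
rewrite expr_div_n !exprMn; have LM : L ^+ m != 0 by rewrite expf_neq0 ?gt_eqF.
have q1n : 1 + q != 0 by rewrite gt_eqF// addr_gt0.
move: (L ^+ m) ((L - alpha) ^+ m) (2 ^+ m) LM => X Y Z LM; field.
by rewrite q1n LM.
Qed.

End rigidity_bounds.

(** * Upper bound by circumscribed polytopes *)

(** A convex sequence that vanishes at n lies below its chord: each drop before j is at least the
    drop at j, each later one at most that. *)
Lemma discrete_convex (R : realType) (M : nat -> R) (n : nat) :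
  M n = 0 -> (forall j, M j.+1 - M j.+2 <= M j - M j.+1) ->
  forall j, (j <= n)%N -> n%:R * M j <= (n%:R - j%:R) * M 0%N.
Proof.
move=> Mn cM j jn; pose d k := M k - M k.+1.
have up k : k%:R * d k <= M 0%N - M k.
  elim: k => [|k IH]; first by rewrite mul0r subrr.
  have k0 : 0 <= k.+1%:R :> R by [].
  apply: (le_trans (ler_wpM2l k0 (cM k))); rewrite -natr1 mulrDl mul1r -/(d k).
  by move: IH; rewrite /d; lra.
have dS k : d (j + k)%N <= d j.
  by elim: k => [|k IH]; rewrite ?addn0// addnS; apply: le_trans IH; exact: cM.
have down k : M j - M (j + k)%N <= k%:R * d j.
  elim: k => [|k IH]; first by rewrite addn0 subrr mul0r.
  by have := dS k; move: IH; rewrite -natr1 mulrDl mul1r addnS /d; lra.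
have := down (n - j)%N; rewrite subnKC// Mn subr0 natrB// => D1.
have j0 : 0 <= j%:R :> R by [].
have nj : 0 <= n%:R - j%:R :> R by rewrite subr_ge0 ler_nat.
have := ler_wpM2l j0 D1; have := ler_wpM2l nj (up j).
rewrite (_ : j%:R * ((n%:R - j%:R) * d j) = (n%:R - j%:R) * (j%:R * d j)); last by ring.
move=> h1 h2; have := le_trans h2 h1.
by rewrite (_ : (n%:R - j%:R) * (M 0%N - M j) = (n%:R - j%:R) * M 0%N - n%:R * M j + j%:R * M j);
  [lra|ring].
Qed.

Section cells.
Context (R : realType) (p : R) (p1 : 1 < p) (m N : nat).
Variables (e : 'I_N -> 'rV[R]_m.+1) (b : 'I_N -> R) (rho : R).
Local Notation mu := (lebesgue_rV R m.+1).
Local Notation leb := (@lebesgue_measure R).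
Let l i x := dotr (e i) x + b i.
Let P := [set x | forall i, 0 < l i x].
Hypotheses (e1 : forall i, enorm (e i) = 1) (rho0 : 0 < rho).
Hypotheses (lrho : forall x, exists i, l i x <= rho) (bP : bounded_set P).

Let p0 : 0 < p. Proof. exact: lt_trans p1. Qed.
Let q := p / (p - 1).
Let pB1 : 0 < p - 1. Proof. by rewrite subr_gt0. Qed.
Let q0 : 0 < q. Proof. by rewrite divr_gt0. Qed.
Let q1 : 1 < q. Proof. by rewrite ltr_pdivlMr// mul1r gtrBl. Qed.

(* The points of the polytope whose nearest face is the i-th one, ties being
   broken by the index. *)
Definition cell_part (i j : 'I_N) : set 'rV[R]_m.+1 :=
  [set x | 0 < l j x] `&` ~` [set x | 0 < l i x - l j x] `&`
  (if (j < i)%N then [set x | 0 < l j x - l i x] else setT).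

Definition cell (i : 'I_N) : set 'rV[R]_m.+1 := \bigcap_(j in [set: 'I_N]) cell_part i j.

Lemma cellP i x : cell i x <-> forall j, [/\ 0 < l j x, l i x <= l j x &
  ((j < i)%N -> l i x < l j x)].
Proof.
split=> [C j|H j _].
  have [[lj /negP]] := C j Logic.I; rewrite -leNgt subr_le0 => lij.
  by case: ifP => [ji /=|_ _]; [rewrite subr_gt0|split].
have [h1 h2 h3] := H j; split; [split => //=|].
  by apply/negP; rewrite -leNgt subr_le0.
by case: ifP => // ji; rewrite /= subr_gt0 h3.
Qed.

Let cl i : continuous (l i).
Proof.
apply: continuous_addr; last exact: continuous_const.
by apply: continuous_dotr_comp => k; [exact: continuous_const|exact: coord_continuous].
Qed.

Let open_pos (f : 'rV[R]_m.+1 -> R) : continuous f -> open [set x | 0 < f x].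
Proof.
move=> cf; rewrite (_ : [set _ | _] = f @^-1` [set y | 0 < y]); last by [].
by apply: open_comp; [move=> x _; exact: cf|exact: open_gt].
Qed.

Let cB i j : continuous (fun x => l i x - l j x).
Proof. by apply: continuous_addr => //; exact: continuous_oppr. Qed.

Lemma measurable_cell i : measurable (cell i).
Proof.
apply: fin_bigcap_measurable => // j _; apply: measurableI; first apply: measurableI.
- by apply: open_rV_measurable; exact: open_pos.
- by apply: measurableC; apply: open_rV_measurable; exact: open_pos.
- by case: ifP => // _; apply: open_rV_measurable; exact: open_pos.
Qed.

Let oP : open P.
Proof.
have H (s : seq 'I_N) : open [set x | forall i, i \in s -> 0 < l i x].
  elim: s => [|i s IH].
    by rewrite (_ : [set _ | _] = setT); [exact: openT|apply/seteqP; split].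
  rewrite (_ : [set _ | _] = [set x | 0 < l i x] `&` [set x | forall i, i \in s -> 0 < l i x]).
    by apply: openI => //; exact: open_pos.
  apply/seteqP; split=> x /= => [h|[h1 h2] j].
    by split => [|j js]; apply: h; rewrite inE ?eqxx// js orbT.
  by rewrite inE => /predU1P[->//|/h2].
rewrite (_ : P = [set x | forall i, i \in enum 'I_N -> 0 < l i x]); first exact: H.
by apply/seteqP; split=> x /= h i => [_|]; [exact: h|apply: h; rewrite mem_enum].
Qed.

Let mP : measurable P. Proof. exact: open_rV_measurable. Qed.

Lemma cell_sub i : cell i `<=` P.
Proof. by move=> x /cellP H j; have [] := H j. Qed.

Lemma cell_cover x : P x -> exists i, cell i x.
Proof.
move=> Px; have [i1 _] := lrho x.
have [i0 Hi0] : exists i, forall j, l i x <= l j x.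
  case: (@arg_minP _ _ _ i1 xpredT (fun i => l i x) isT) => i _ H.
  by exists i => j; exact: H.
have Pi0 : [forall j, l i0 x <= l j x] by apply/forallP.
case: (@arg_minnP _ i0 (fun i => [forall j, l i x <= l j x]) (@nat_of_ord N) Pi0) => i /forallP Hi mi.
exists i; apply/cellP => j; split => // ji.
rewrite ltNge; apply/negP => lji.
have : (i <= j)%N by apply: mi; apply/forallP => k; exact: le_trans lji (Hi k).
by rewrite leqNgt ji.
Qed.

Lemma cell_inj i k x : cell i x -> cell k x -> i = k.
Proof.
move=> Ci Ck; have [_ h1 h2] := (cellP i x).1 Ci k; have [_ h3 h4] := (cellP k x).1 Ck i.
have [ik|ki|/val_inj//] := ltngtP i k.
  by have := h4 ik; rewrite ltNge h1.
by have := h2 ki; rewrite ltNge h3.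
Qed.

Let lB i j x t : l j (x - t *: e i) = l j x - t * dotr (e j) (e i).
Proof. by rewrite /l dotrBr dotrZr addrAC. Qed.

Let lD i x t : l i (x + t *: e i) = l i x + t.
Proof. by rewrite /l dotrDr dotrZr -sqr_enorm e1 expr1n mulr1 addrAC. Qed.

Let lB1 i x t : l i (x - t *: e i) = l i x - t.
Proof. by rewrite lB -sqr_enorm e1 expr1n mulr1. Qed.

Let lB_ge i j x t : 0 <= t -> l j x - t <= l j (x - t *: e i).
Proof.
move=> t0; rewrite lB lerD2l lerN2 ler_piMr//.
by apply: (le_trans (ler_norm _)); apply: (le_trans (cauchy_schwarz _ _)); rewrite !e1 mulr1.
Qed.

(** Moving towards face i lowers l_i by exactly t and any other l_j by at most t, since the normals
    are unit vectors; face i stays the nearest and ties are not broken differently. *)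
Lemma cell_down i x t : cell i x -> 0 <= t -> 0 < l i (x - t *: e i) -> cell i (x - t *: e i).
Proof.
move=> /cellP C t0 l0; apply/cellP => j; have [h1 h2 h3] := C j.
have g := lB_ge i j x t0; have E := lB1 i x t.
have le : l i (x - t *: e i) <= l j (x - t *: e i) by rewrite E; move: g h2; lra.
split => //; first exact: lt_le_trans le.
by move=> /h3 h; rewrite E; move: g h; lra.
Qed.

(** No point of a cell is deeper than rho, so rho + 1 exceeds the length of every normal and leads
    out of the polytope. [s i y] below is the length of the part of the cell met from y in the
    inward direction [e i]. *)
Let T : set (measurableTypeR R) := `[0, rho + 1]%classic.
Let mT : measurable T. Proof. exact: measurable_itv. Qed.
Let sleb i y := leb (T `&` [set t | cell i (y + t *: e i)]).
Let s i y := fine (sleb i y).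

Let msec i y : measurable (T `&` [set t | cell i (y + t *: e i)]).
Proof. by apply: measurableI => //; exact: (measurable_flow_section _ _ (measurable_cell i)). Qed.

Let lebT (c : R) : 0 <= c -> leb (`[0, c]%classic : set (measurableTypeR R)) = c%:E.
Proof.
move=> c0; rewrite lebesgue_measure_itv /= lte_fin.
by have [c1|] := ltP 0 c; [rewrite oppr0 adde0|move=> c2; congr EFin; apply/eqP; rewrite eq_le c0 c2].
Qed.

Let sleb_le i y (c : R) : 0 <= c ->
  (forall t, 0 <= t -> cell i (y + t *: e i) -> t <= c) -> (sleb i y <= c%:E)%E.
Proof.
move=> c0 H; rewrite -lebT//; apply: le_measure; rewrite ?inE//.
move=> t [Tt Ct]; have : t \in `[0, rho + 1] by exact: Tt.
rewrite in_itv/= => /andP[t0 _].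
suff : t \in `[0, c] by [].
by rewrite in_itv/= t0; exact: H.
Qed.

Let sleb_fin i y : sleb i y \is a fin_num.
Proof.
rewrite ge0_fin_numE//; apply: (@le_lt_trans _ _ (rho + 1)%:E); last exact: ltry.
rewrite -lebT ?addr_ge0 ?(ltW rho0)//; apply: le_measure; rewrite ?inE//; exact: subIsetl.
Qed.

Let s_le i y (c : R) : 0 <= c ->
  (forall t, 0 <= t -> cell i (y + t *: e i) -> t <= c) -> s i y <= c.
Proof. by move=> c0 H; rewrite -(@lee_fin R) /s fineK//; exact: sleb_le. Qed.

Let s_ge0 i y : 0 <= s i y. Proof. exact: fine_ge0. Qed.

Let ms i : measurable_fun setT (s i).
Proof. by apply: measurableT_comp => //; exact: measurable_flow_length (measurable_cell i) mT. Qed.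

Let cell_rho i x : cell i x -> l i x <= rho.
Proof. by move=> /cellP C; have [k] := lrho x; apply: le_trans; have [] := C k. Qed.

Let cell_pos i x : cell i x -> 0 < l i x.
Proof. by move=> /cell_sub. Qed.

Let s_rho i y : cell i y -> s i y <= rho.
Proof.
move=> /cell_pos ly; apply: s_le; first exact: ltW.
by move=> t t0 /cell_rho; rewrite lD; move: ly; lra.
Qed.

Let s_gt i y (t : R) : cell i y -> 0 <= t -> t < s i y -> cell i (y + t *: e i).
Proof.
move=> Cy t0 ts; apply: contrapT => nC; move: ts; apply/negP; rewrite -leNgt.
apply: s_le => // u u0 Cu; rewrite leNgt; apply/negP => tu; apply: nC.
have E : y + t *: e i = (y + u *: e i) - (u - t) *: e i.
  by apply/rowP => k; rewrite !mxE; ring.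
rewrite E; apply: cell_down => //; first by rewrite subr_ge0 ltW.
by rewrite -E lD ltr_wpDr// cell_pos.
Qed.

Let muP : (mu P < +oo)%E. Proof. exact: (lebesgue_rV_bounded mP bP). Qed.

Let fin A : measurable A -> A `<=` P -> mu A \is a fin_num.
Proof.
move=> mA AP; rewrite ge0_fin_numE//; apply: le_lt_trans muP.
by apply: le_measure => //; rewrite inE.
Qed.

Let split_fine A B : measurable A -> measurable B -> A `<=` P ->
  fine (mu A) = fine (mu (A `\` B)) + fine (mu (A `&` B)).
Proof.
move=> mA mB AP.
have mD : measurable (A `\` B) by exact: measurableD.
have mI : measurable (A `&` B) by exact: measurableI.
rewrite -(fineD (fin mD (fun x h => AP x h.1)) (fin mI (fun x h => AP x h.1))).
by rewrite (measureDI mu mA mB).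
Qed.

Let shift_le A B c : measurable A -> A `<=` P -> measurable B -> B `<=` P ->
  (forall x, A x -> B (x + c)) -> fine (mu A) <= fine (mu B).
Proof.
move=> mA AP mB BP AB; have := lebesgue_rV_affine c ltr01 mB; rewrite invr1 expr1n mul1e => E.
apply: fine_le; rewrite ?fin//.
rewrite -E; apply: le_measure; rewrite ?inE//; last by move=> x /= Ax; rewrite scale1r; exact: AB.
by rewrite -[X in measurable X]setTI; apply: measurable_rV_affine.
Qed.

Let top i (t : R) := cell i `&` [set x | 0 < l i x - t].
Let mtop i t : measurable (top i t).
Proof.
apply: measurableI; first exact: measurable_cell.
by apply: open_rV_measurable; apply: open_pos; apply: continuous_addr => //; exact: continuous_const.
Qed.
Let top_sub i t : top i t `<=` P. Proof. by move=> x [/cell_sub]. Qed.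

(** Cut the cell into layers of thickness h parallel to its face. By [cell_down] each layer, shifted
    by h towards the face, fits into the next one; so the volumes beyond depth k h form a convex
    sequence, which vanishes at depth rho. *)
Let top_le i (j n : nat) : (0 < j <= n)%N ->
  fine (mu (top i (rho * (j%:R / n%:R)))) <= (1 - j%:R / n%:R) * fine (mu (cell i)).
Proof.
move=> /andP[j0 jn]; have n0 : (0 < n)%N by exact: leq_trans jn.
have N0 : 0 < n%:R :> R by rewrite ltr0n.
pose tau (k : nat) : R := rho * (k%:R / n%:R); pose h := rho / n%:R.
have h0 : 0 < h by rewrite divr_gt0.
have tauS k : tau k.+1 = tau k + h by rewrite /tau /h -natr1; ring.
have tau0 k : 0 <= tau k by rewrite mulr_ge0 ?(ltW rho0)// divr_ge0.
pose M k := fine (mu (top i (tau k))).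
have M0 : M 0%N = fine (mu (cell i)).
  rewrite /M; congr (fine (mu _)); apply/seteqP; split => x; first by case.
  by move=> Cx; split => //=; rewrite /tau mul0r mulr0 subr0 cell_pos.
have Mn : M n = 0.
  rewrite /M (_ : top _ _ = set0) ?measure0//; apply/seteqP; split => // x [/cell_rho lx] /=.
  by rewrite /tau divff ?gt_eqF// mulr1 subr_gt0 ltNge lx.
have dE k : M k - M k.+1 = fine (mu (top i (tau k) `\` top i (tau k.+1))).
  rewrite /M (split_fine (mtop i (tau k)) (mtop i (tau k.+1)) (@top_sub i _)).
  rewrite (setIidr (_ : top i (tau k.+1) `<=` top i (tau k))) ?addrK//.
  by move=> x [Cx] /= h1; split => //=; move: h1; rewrite tauS; move: h0; lra.
have cM k : M k.+1 - M k.+2 <= M k - M k.+1.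
  rewrite !dE; apply: (@shift_le _ _ (- (h *: e i))).
  - exact: measurableD.
  - by move=> x [/top_sub].
  - exact: measurableD.
  - by move=> x [/top_sub].
  - move=> x [[Cx /= h1] h2]; have lx := lB1 i x h.
    have Cx' : cell i (x - h *: e i).
      apply: cell_down => //; first exact: ltW.
      by rewrite lx; move: h1 (tau0 k); rewrite tauS; lra.
    split; first by split => //=; rewrite lx; move: h1; rewrite tauS; lra.
    move=> [_ /= h3]; apply: h2; split => //=; move: h3; rewrite lx tauS.
    by rewrite [tau k.+2]tauS tauS; lra.
have := discrete_convex Mn cM jn; rewrite M0 -/(tau j) -/(M j) => H.
rewrite -(ler_pM2l N0) (le_trans H)// mulrA le_eqVlt; apply/orP; left; apply/eqP.
by field; rewrite gt_eqF.
Qed.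

(** The lengths [s], divided by rho, satisfy the distribution bound of [layer_cake] with exponent 1,
    as a uniform variable does. *)
Lemma cell_layer i : mu.-integrable (cell i) (EFin \o (fun y => s i y `^ q)) /\
  \int[mu]_(y in cell i) (s i y `^ q) <= rho `^ q / (1 + q) * fine (mu (cell i)).
Proof.
have mC := measurable_cell i.
have muC : (mu (cell i) < +oo)%E by rewrite -ge0_fin_numE//; apply: fin => //; exact: cell_sub.
pose J y := s i y / rho.
have mJ : measurable_fun setT J by apply: measurable_funM.
have J01 y : cell i y -> 0 <= J y <= 1.
  by move=> Cy; rewrite /J divr_ge0 ?(ltW rho0)//= ler_pdivrMr// mul1r s_rho.
have V0 : 0 <= fine (mu (cell i)) by exact: fine_ge0.
have sJ : (fun y => s i y `^ q) = (fun y => rho `^ q * J y `^ q).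
  by apply/funext => y; rewrite -powRM ?divr_ge0 ?(ltW rho0)// /J mulrC divfK// gt_eqF.
have iJ := powR_layer_integrable q1 mC muC mJ J01.
rewrite sJ; split; first exact: (integrable_mull mC _ iJ).
rewrite (RintegralZl _ mC iJ) -mulrA ler_pM2l ?powR_gt0//.
have := layer_cake q1 (ltn0Sn 0) mC muC mJ J01 V0 => LC.
apply: (le_trans (LC _)); last first.
  rewrite le_eqVlt; apply/orP; left; apply/eqP; move: (fine _) => V.
  by field; rewrite gt_eqF// addr_gt0.
move=> j n jn; rewrite expr1; set t := j%:R / n%:R.
have t0 : 0 <= t by rewrite divr_ge0.
have mS : measurable [set x | J x <= t].
  rewrite (_ : [set _ | _] = setT `&` J @^-1` `]-oo, t]); first exact: mJ.
  by apply/seteqP; split=> x /=; rewrite in_itv/= => // -[].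
have H1 := split_fine mC mS (@cell_sub i).
(* If s(y) > rho t, then y shifted inwards by rho t is still in the cell and at depth greater than
   rho t, so [top_le] bounds the volume. *)
have H2 : fine (mu (cell i `\` [set x | J x <= t])) <= fine (mu (top i (rho * t))).
  have DP : cell i `\` [set x | J x <= t] `<=` P by move=> x [/cell_sub].
  have mD : measurable (cell i `\` [set x | J x <= t]) by exact: measurableD.
  apply: (@shift_le _ _ ((rho * t) *: e i) mD DP (mtop i (rho * t)) (@top_sub i (rho * t))).
  - move=> x [Cx /= /negP]; rewrite -ltNge /J ltr_pdivlMr// mulrC => ts.
    have rt : 0 <= rho * t by rewrite mulr_ge0// ltW.
    by split; [exact: s_gt|rewrite /= lD addrK cell_pos].
have H3 := top_le i jn; rewrite -/t in H3.
by move: H1 H2 H3; rewrite mulrBl mul1r; lra.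
Qed.

Lemma cell_partition (f : 'rV[R]_m.+1 -> R) : continuous f ->
  \sum_i \int[mu]_(x in cell i) f x = \int[mu]_(x in P) f x.
Proof.
move=> cf; have iPf := open_integrable oP bP cf.
have E i : \int[mu]_(x in cell i) f x = \int[mu]_(x in P) (f \_ (cell i)) x.
  rewrite /Rintegral integral_mkcond [in RHS]integral_mkcond; congr fine.
  apply: eq_integral => x _; rewrite !patchE /=.
  case: ifPn => [|_]; last by case: ifP.
  by rewrite inE => Cx; rewrite mem_set//; exact: cell_sub Cx.
have iE i : mu.-integrable P (EFin \o (f \_ (cell i))).
  have iF := open_integrable oP bP cf.
  apply: (le_integrable mP _ _ iF).
    apply/measurable_EFinP; apply: (@measurable_funS _ _ _ _ setT) => //.
    apply/(measurable_restrictT _ (measurable_cell i)).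
    by apply: (@measurable_funS _ _ _ _ setT) => //; exact: continuous_rV_measurable.
  by move=> x _; rewrite /= lee_fin patchE; case: ifP => // _; rewrite normr0.
have [_ S] := integrable_sumr oP bP (index_enum 'I_N) iE.
under eq_bigr do rewrite E; rewrite -S; apply: eq_Rintegral => x /set_mem Px.
have [i Ci] := cell_cover Px.
rewrite (bigD1 i)//= patchE mem_set// big1 ?addr0// => k ki.
by rewrite patchE ifN//; apply/negP => /set_mem Ck; move/eqP: ki; apply; exact: cell_inj Ck Ci.
Qed.

Variable Omega : set 'rV[R]_m.+1.
Hypotheses (oO : open Omega) (OP : Omega `<=` P).

(** v is integrated along the normal from outside the polytope; [tonelli_flow] then weights the
    normal derivative at y by the length [s i y], and Young's inequality separates the two
    factors. *)
Lemma cell_bound (v : 'rV[R]_m.+1 -> R) i : test_fun Omega v ->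
  \int[mu]_(x in cell i) `|v x| <=
  (1 - p^-1) * (rho `^ q / (1 + q)) * fine (mu (cell i)) +
  p^-1 * \int[mu]_(x in cell i) (enorm (grad v x) `^ p).
Proof.
move=> tv; have mC := measurable_cell i; have [is_ Hs] := cell_layer i.
have bC : bounded_set (cell i).
  have [K K0 PK] := bounded_set_rbox bP.
  by apply: (@rbox_bounded _ _ _ 0 K) => x /cell_sub /PK.
have Cv := test_fun_C1 tv; have [cv _ _] := Cv.
have cav : continuous (fun x => `|v x|) by exact: (continuous_compr (@norm_continuous _ _)).
have iav := continuous_integrable mC bC cav.
have cgv := test_grad_continuous p1 tv.
have igv := continuous_integrable mC bC cgv.
pose W x := (1 - p^-1) * s i x `^ q + p^-1 * enorm (grad v x) `^ p.
have iW : mu.-integrable (cell i) (EFin \o W).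
  exact: (integrable_addr mC (integrable_mull mC _ is_) (integrable_mull mC _ igv)).
have W0 x : 0 <= W x.
  by rewrite addr_ge0// mulr_ge0 ?powR_ge0 ?invr_ge0 ?(ltW p0)// subr_ge0 invf_le1 ?(ltW p1).
apply: (@le_trans _ _ (\int[mu]_(x in cell i) W x)); last first.
  rewrite /W (RintegralD mC (integrable_mull mC _ is_) (integrable_mull mC _ igv)).
  rewrite (RintegralZl _ mC is_) (RintegralZl _ mC igv) lerD2r -mulrA.
  by apply: ler_wpM2l => //; rewrite subr_ge0 invf_le1 ?(ltW p1).
pose G x := `|dotr (grad v x) (e i)|.
have mG : measurable_fun setT G.
  apply: continuous_rV_measurable; apply: (continuous_compr (@norm_continuous _ _)).
  by apply: continuous_dotr_comp => k; [exact: test_grad_coord_continuous tv|exact: continuous_const].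
have G0 x : 0 <= G x by exact: normr_ge0.
pose F x : \bar R := (\int[leb]_t (\1_(cell i) x * \1_T t * G (x - t *: e i))%:E)%E.
have FE x : cell i x -> F x = (\int[leb]_(t in T) (G (x - t *: e i))%:E)%E.
  move=> Ox; rewrite [RHS]integral_mkcond; apply: eq_integral => t _.
  rewrite patchE !indicE (mem_set Ox) mul1r.
  by case: ifPn => _; rewrite ?mul1r ?mul0r.
have mF : measurable_fun setT F by exact: measurable_flow_integral mC mT mG G0.
have F0 x : (0 <= F x)%E.
  by apply: integral_ge0 => t _; rewrite lee_fin !mulr_ge0.
rewrite -(@lee_fin R) !fineK ?(integrable_fin_num mC iav) ?(integrable_fin_num mC iW)//.
apply: (@le_trans _ _ (\int[mu]_x F x)%E).
  rewrite integral_mkcond; apply: ge0_le_integral => //.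
  - by move=> x _; rewrite patchE; case: ifPn => // _; rewrite lee_fin.
  - by apply/(measurable_restrictT _ mC); case/integrableP : iav.
  - move=> x _; rewrite patchE; case: ifPn => [|_]; last exact: F0.
    rewrite inE => Cx; rewrite FE//; apply: line_bound => //.
      by rewrite addr_gt0.
    apply: (test_fun_out tv) => /OP /(_ i); rewrite lB1.
    by have := cell_rho Cx; lra.
rewrite /F (tonelli_flow _ mC mT mG G0) [leRHS]integral_mkcond.
apply: ge0_le_integral => //.
- by move=> x _; rewrite mule_ge0// lee_fin.
- apply: emeasurable_funM; first exact/measurable_EFinP.
  exact: measurable_flow_length mC mT.
- by apply/(measurable_restrictT _ mC); case/integrableP : iW.
move=> y _; rewrite -/(sleb i y) -(fineK (sleb_fin i y)) -/(s i y) -EFinM patchE.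
have Gle : G y <= enorm (grad v y).
  by apply: (le_trans (cauchy_schwarz _ _)); rewrite e1 mulr1.
case: ifPn => [_|/negP nC].
  rewrite lee_fin /W; apply: (@le_trans _ _ (s i y * enorm (grad v y))).
    by rewrite mulrC ler_wpM2l.
  by apply: young_conj => //; exact: enorm_ge0.
(* Outside the cell the weight must not contribute: a point of Omega with s > 0 lies below a point
   of the cell on the same normal, so [cell_down] would put it in the cell. *)
rewrite lee_fin; have [sy|sy] := eqVneq (s i y) 0; first by rewrite sy mulr0.
have [Oy|Oy] := pselect (Omega y); last first.
  by rewrite /G (test_grad_out tv Oy) dotr0l normr0 mul0r.
exfalso; apply: nC; apply: mem_set.
have [t t0 Ct] : exists2 t, 0 <= t & cell i (y + t *: e i).
  apply: contrapT => H; move/eqP: sy; apply; apply/eqP; rewrite eq_le s_ge0 andbT.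
  by apply: s_le => // t t0 Ct; exfalso; apply: H; exists t.
have -> : y = (y + t *: e i) - t *: e i by rewrite addrK.
apply: cell_down => //; rewrite addrK; exact: OP Oy i.
Qed.

Lemma torsional_rigidity_polytope_le :
  torsional_rigidity p Omega <= rho `^ q / (1 + q) * fine (mu P).
Proof.
have bO : bounded_set Omega.
  have [K K0 PK] := bounded_set_rbox bP.
  by apply: (@rbox_bounded _ _ _ 0 K) => x /OP /PK.
have mO := open_rV_measurable oO.
have ext (f : 'rV[R]_m.+1 -> R) : (forall x, ~ Omega x -> f x = 0) ->
    \int[mu]_(x in P) f x = \int[mu]_(x in Omega) f x.
  move=> f0; rewrite /Rintegral integral_mkcond [in RHS]integral_mkcond; congr fine.
  apply: eq_integral => x _; rewrite !patchE; case: ifPn => [_|/negP nP].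
    by case: ifPn => // /negP nO; rewrite f0// => Ox; apply: nO; exact: mem_set.
  by case: ifPn => // /set_mem /OP Px; exfalso; apply: nP; exact: mem_set.
apply: (torsional_rigidity_le p1 oO bO) => v tv.
have [cv _ _] := test_fun_C1 tv.
have cav : continuous (fun x => `|v x|) by exact: (continuous_compr (@norm_continuous _ _)).
apply: (@le_trans _ _ (\int[mu]_(x in Omega) `|v x|)).
  apply: (le_Rintegral mO (test_integrable oO bO tv) (open_integrable oO bO cav)) => x _.
  exact: ler_norm.
rewrite -ext; last by move=> x Ox; rewrite (test_fun_out tv Ox) normr0.
rewrite -cell_partition//; apply: (le_trans (ler_sum _ (fun i _ => cell_bound i tv))).
have HS : \sum_i fine (mu (cell i)) = fine (mu P).
  have c1 : continuous (fun _ : 'rV[R]_m.+1 => 1 : R) by exact: continuous_const.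
  have := cell_partition c1; rewrite Rintegral_cst// mul1r => <-.
  by apply: eq_bigr => i _; have mC := measurable_cell i; rewrite Rintegral_cst// mul1r.
rewrite big_split/= -!mulr_sumr HS; apply: lerD; first by rewrite !mulrA.
rewrite ler_pM2l ?invr_gt0// (cell_partition (test_grad_continuous p1 tv)) ext//.
by move=> x Ox; rewrite (test_grad_out tv Ox) enorm0 powR0// gt_eqF.
Qed.

End cells.

(** * Sharp bounds in terms of the inradius *)

Section inradius.
Context (R : realType) (m : nat).
Implicit Types Omega : set 'rV[R]_m.+1.
Local Notation d0 := (delta_mx ord0 ord0 : 'rV[R]_m.+1).

Lemma enorm_delta : enorm d0 = 1.
Proof. by rewrite /enorm dotr_delta mxE !eqxx sqrtr1. Qed.

Lemma eball_segment Omega x (r s : R) : eball x r `<=` Omega -> 0 <= s -> s < r ->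
  Omega (x + s *: d0) /\ Omega (x - s *: d0).
Proof.
move=> BO s0 sr; split; apply: BO; rewrite /eball /= addrC addKr.
  by rewrite enormZ ger0_norm// enorm_delta mulr1.
by rewrite enormN enormZ ger0_norm// enorm_delta mulr1.
Qed.

Lemma le_of_lt_le (a r : R) : 0 < r -> (forall s, 0 <= s -> s < r -> s <= a) -> r <= a.
Proof.
move=> r0 H; rewrite leNgt; apply/negP => ar.
have a0 : 0 <= a by exact: H.
have : (a + r) / 2 <= a by apply: H; lra.
by lra.
Qed.

Lemma inradius_has_sup Omega : convex_domain Omega ->
  has_sup [set r | 0 < r /\ exists x, eball x r `<=` Omega].
Proof.
move=> [[x Ox] oO bO _]; split.
  have [e e0 H] := open_rbox oO Ox; exists e; split => //; exists x => y ye; apply: H => i.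
  by apply: le_lt_trans ye; have := enorm_coord (y - x) i; rewrite !mxE.
have [M M0 OM] := bounded_set_rbox bO; exists (2 * M) => r [r0 [y BO]].
apply: (le_of_lt_le r0) => s s0 sr; have [/OM h1 /OM h2] := eball_segment BO s0 sr.
have := h1 ord0; have := h2 ord0; rewrite !mxE !eqxx /= !mulr1 !subr0 !ltr_norml.
by move=> /andP[h3 h4] /andP[h5 h6]; move: h3 h4 h5 h6; lra.
Qed.

Lemma le_inradius Omega x (r : R) : convex_domain Omega -> 0 < r ->
  eball x r `<=` Omega -> r <= inradius Omega.
Proof.
move=> cO r0 BO; apply: sup_upper_bound; first exact: inradius_has_sup.
by split => //; exists x.
Qed.

Lemma lt_inradius Omega (r : R) : convex_domain Omega -> r < inradius Omega ->
  exists x, eball x r `<=` Omega.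
Proof.
move=> cO rO; have [S0 _] := inradius_has_sup cO.
have [s [_ [x BO]] rs] := sup_gt S0 rO; exists x => y ye; apply: BO; exact: lt_trans rs.
Qed.

(** Only the diameter in the first coordinate direction of an inscribed ball is needed for the upper
    estimate; for balls and slabs that direction is already extremal. *)
Lemma inradius_eq Omega x (a : R) : convex_domain Omega -> 0 < a -> eball x a `<=` Omega ->
  (forall y s, 0 <= s -> Omega (y + s *: d0) -> Omega (y - s *: d0) -> s <= a) ->
  inradius Omega = a.
Proof.
move=> cO a0 BO H; apply/eqP; rewrite eq_le (le_inradius cO a0 BO) andbT.
apply: ge_sup; first by have [] := inradius_has_sup cO.
move=> r [r0 [y By]]; apply: (le_of_lt_le r0) => s s0 sr.
by have [h1 h2] := eball_segment By s0 sr; exact: H h1 h2.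
Qed.

Lemma convex_set_of Omega : (forall x y (t : R), 0 <= t -> t <= 1 -> Omega x -> Omega y ->
  Omega (t *: x + (1 - t) *: y)) -> convex_set Omega.
Proof.
move=> H x y t /set_mem Ox /set_mem Oy; apply: mem_set.
by apply: (H x y t%:num).
Qed.

Lemma convex_domain_eball (b : R) : 0 < b ->
  convex_domain_inradius b (eball (0 : 'rV[R]_m.+1) b).
Proof.
move=> b0; have cB : convex_domain (eball (0 : 'rV[R]_m.+1) b).
  split; [|exact: open_eball|exact: bounded_eball|].
    by exists 0; rewrite /eball /= subrr enorm0.
  apply: convex_set_of => x y t t0 t1; rewrite /eball /= !subr0 => xb yb.
  apply: (le_lt_trans (enormD _ _)); rewrite !enormZ !ger0_norm ?subr_ge0//.
  have [->|tn] := eqVneq t 0; first by rewrite mul0r add0r subr0 mul1r.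
  have tp : 0 < t by rewrite lt_neqAle eq_sym tn.
  have h1 : t * enorm x < t * b by rewrite ltr_pM2l.
  have h2 : (1 - t) * enorm y <= (1 - t) * b by rewrite ler_wpM2l ?subr_ge0// ltW.
  by rewrite (lt_le_trans (ltr_leD h1 h2))// -mulrDl addrC subrK mul1r.
split => //; apply: (inradius_eq cB b0 (x := 0)) => // y s s0.
rewrite /eball /= !subr0 => h1 h2.
have := enormB (y + s *: d0) (y - s *: d0).
have : enorm ((y + s *: d0) - (y - s *: d0)) <= enorm (y + s *: d0) + enorm (y - s *: d0).
  by rewrite -(enormN (y - s *: d0)); exact: enormD.
have -> : (y + s *: d0) - (y - s *: d0) = (2 * s) *: d0.
  by apply/rowP => i; rewrite !mxE; ring.
rewrite enormZ enorm_delta mulr1 ger0_norm ?mulr_ge0//.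
by move: h1 h2; lra.
Qed.

Lemma convex_domain_slab (a L : R) : 0 < a -> a < L ->
  convex_domain_inradius a (@slab R m a L).
Proof.
move=> a0 aL; have L0 : 0 < L by exact: lt_trans aL.
have B : eball 0 a `<=` @slab R m a L.
  move=> x xa i; have xi : `|x ord0 i - (0 : 'rV[R]_m.+1) ord0 i| < a.
    by apply: le_lt_trans xa; have := enorm_coord (x - 0) i; rewrite !mxE.
  by case: ifP => // _; exact: lt_trans aL.
have cS : convex_domain (@slab R m a L).
  split; [|exact: open_rbox_set| |].
  - by exists 0; apply: B; rewrite /eball /= subrr enorm0.
  - apply: (@rbox_bounded _ _ _ 0 L) => x Sx i; apply: (lt_le_trans (Sx i)).
    by case: ifP => // _; exact: ltW.
  - apply: convex_set_of => x y t t0 t1 Sx Sy i; have := Sx i; have := Sy i.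
    rewrite !mxE !subr0; set c := (if _ then _ else _); rewrite !ltr_norml => /andP[h1 h2] /andP[h3 h4].
    have [->|tn] := eqVneq t 0; first by rewrite !mul0r !add0r !subr0 !mul1r h1.
    have tp : 0 < t by rewrite lt_neqAle eq_sym tn.
    have t1' : 0 <= 1 - t by rewrite subr_ge0.
    move: h3 h4; rewrite -(ltr_pM2l tp) -(ltr_pM2l tp (x ord0 i)) => h3 h4.
    have := ler_wpM2l t1' (ltW h1); have := ler_wpM2l t1' (ltW h2).
    move: (t * x ord0 i) ((1 - t) * y ord0 i) h3 h4 => X Y h3 h4 h5 h6.
    by apply/andP; split; lra.
split => //; apply: (inradius_eq cS a0 B) => y s s0 h1 h2.
have := h1 ord0; have := h2 ord0; rewrite !mxE !eqxx /= !mulr1 !subr0 !ltr_norml.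
by move=> /andP[h3 h4] /andP[h5 h6]; move: h3 h4 h5 h6; lra.
Qed.

End inradius.

Section sharp_bounds.
Context (R : realType) (p : R) (p1 : 1 < p) (m : nat).
Local Notation mu := (lebesgue_rV R m.+1).
Implicit Types Omega : set 'rV[R]_m.+1.
Let q := p / (p - 1).
Let pB1 : 0 < p - 1. Proof. by rewrite subr_gt0. Qed.
Let q0 : 0 < q. Proof. by rewrite divr_gt0// (lt_trans ltr01 p1). Qed.

Lemma convex_domain_volume Omega : convex_domain Omega -> 0 < fine (mu Omega).
Proof.
move=> [ne oO bO _]; rewrite fine_gt0// lebesgue_rV_open_gt0//=.
by apply: lebesgue_rV_bounded => //; exact: open_rV_measurable.
Qed.

Let cvg_u : 1 + k.+1%:R^-1 @[k --> \oo] --> (1 + 0 : R).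
Proof. by apply: cvgD; [exact: cvg_cst|exact: cvg_harmonic]. Qed.

Let cvg_uq : `|1 + k.+1%:R^-1| `^ q @[k --> \oo] --> (1 : R).
Proof.
have c1 : {for (1 + 0 : R), continuous (fun t : R => `|t| `^ q)} by exact: continuous_powR_norm.
have E1 : 1 `^ q = 1 :> R by rewrite powR1.
have h : `|1 + k.+1%:R^-1| `^ q @[k --> \oo] --> (`|1 + 0| `^ q : R) by exact: (continuous_cvg _ c1 cvg_u).
by move: h; rewrite addr0 normr1 E1.
Qed.

(** The inradius is a supremum that is not known to be attained, so balls of radius r/(1 + 1/(k+1))
    are used and k tends to infinity. *)
Lemma torsional_rigidity_inradius_ge Omega : convex_domain Omega -> 0 < inradius Omega ->
  inradius Omega `^ q * m.+1%:R `^ (1 - q) / (m.+1%:R + q) * fine (mu Omega)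
  <= torsional_rigidity p Omega.
Proof.
move=> cO r0; have [_ oO bO xO] := cO; set r := inradius Omega; set T := torsional_rigidity p Omega.
set Z := m.+1%:R `^ (1 - q); set V := fine _.
have H k : r `^ q * Z / (m.+1%:R + q) * V <= T * `|1 + k.+1%:R^-1| `^ q.
  have u0 : 0 < k.+1%:R^-1 :> R by rewrite invr_gt0.
  have u1 : 0 < 1 + k.+1%:R^-1 :> R by rewrite addr_gt0.
  set u := 1 + k.+1%:R^-1 in u1 *.
  have ru : r / u < r by rewrite ltr_pdivrMr// ltr_pMr// /u ltrDl.
  have ru0 : 0 < r / u by rewrite divr_gt0.
  have [x0 BO] := lt_inradius cO ru.
  have := torsional_rigidity_convex_ge p1 oO bO xO ru0 BO; rewrite -/q -/Z -/V -/T => H.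
  have uq : 0 < u `^ q by rewrite powR_gt0.
  rewrite gtr0_norm// -ler_pdivrMr// (le_trans _ H)// le_eqVlt; apply/orP; left; apply/eqP.
  have E : u^-1 `^ q = (u `^ q)^-1 by rewrite -[u^-1](powR_inv1 (ltW u1)) -powRrM mulN1r powRN.
  rewrite powRM ?invr_ge0 ?(ltW u1) ?(ltW r0)// E.
  by move: (r `^ q) (u `^ q) uq => Y U U0; field; rewrite !gt_eqF// addr_gt0.
have c : T * `|1 + k.+1%:R^-1| `^ q @[k --> \oo] --> T * 1.
  by apply: cvgM; [exact: cvg_cst|exact: cvg_uq].
rewrite mulr1 in c.
set W := r `^ q * Z / _ * V in H *.
have cW : (fun _ : nat => W) @ \oo --> W by exact: cvg_cst.
by apply: (ler_cvg_to cW c); apply: nearW.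
Qed.

(** [torsional_rigidity_polytope_le] for a circumscribed polytope. The factors u^2 and u^3 compare
    its volume and its depth with those of Omega, and disappear as u tends to 1. *)
Lemma torsional_rigidity_dilation_le Omega (u : R) : convex_domain Omega -> 0 < inradius Omega ->
  1 < u -> torsional_rigidity p Omega <=
  (inradius Omega * u ^+ 3) `^ q / (1 + q) * ((u ^+ 2) ^+ m.+1 * fine (mu Omega)).
Proof.
move=> cO r0 u1; have [[x0 Ox0] oO bO xO] := cO; set r := inradius Omega.
have mO := open_rV_measurable oO.
have u0 : 0 < u by exact: lt_trans u1.
have un : u != 0 by rewrite gt_eqF.
have t1 : u^-1 < 1 by rewrite invf_lt1.
have t0 : 0 < u^-1 by rewrite invr_gt0.
have [N [a [an a1 aO]]] := convex_polytope oO bO xO Ox0 t0 t1.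
have a0 i : 0 < enorm (a i) by rewrite enorm_gt0.
pose e i : 'rV[R]_m.+1 := (- (enorm (a i))^-1) *: a i.
pose b i := (u + dotr (a i) x0) / enorm (a i).
have lE i x : dotr (e i) x + b i = (u - dotr (a i) (x - x0)) / enorm (a i).
  by rewrite /e /b dotrZl dotrBr; field; rewrite gt_eqF.
have e1 i : enorm (e i) = 1.
  by rewrite /e enormZ normrN gtr0_norm ?invr_gt0// mulVf// gt_eqF.
(* That is, all a_i . (x - x0) < u. Omega satisfies the bound 1 < u, and contraction by u^-2 brings
   [P] to level 1/u, where [convex_polytope] places it inside Omega. *)
pose P := [set x | forall i, 0 < dotr (e i) x + b i].
have tt : 0 < u ^- 2 by rewrite invr_gt0 exprn_gt0.
have dil x : (forall i, dotr (a i) (x - x0) <= u) -> Omega (x0 + u ^- 2 *: (x - x0)).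
  move=> H; apply: aO => i; rewrite addrC addKr dotrZr ler_pdivrMl ?exprn_gt0//.
  by apply: (le_trans (H i)); rewrite expr2 mulfK.
have PO x : P x -> Omega (x0 + u ^- 2 *: (x - x0)).
  move=> Px; apply: dil => i; have := Px i; rewrite lE pmulr_lgt0 ?invr_gt0// subr_gt0.
  exact: ltW.
pose c := x0 - u ^- 2 *: x0.
have cE x : x0 + u ^- 2 *: (x - x0) = u ^- 2 *: x + c.
  by apply/rowP => i; rewrite !mxE; ring.
have OP : Omega `<=` P.
  move=> x Ox i; rewrite lE divr_gt0// subr_gt0; exact: le_lt_trans (a1 i x Ox) u1.
have [K K0 OK] := bounded_set_rbox bO.
have bP : bounded_set P.
  apply: (@rbox_bounded _ _ _ 0 ((K + enorm c) * u ^+ 2)) => x /PO; rewrite cE => /OK h i.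
  have := h i; rewrite !mxE !subr0 => hi.
  rewrite -ltr_pdivrMr ?exprn_gt0// mulrC.
  have ci := enorm_coord c i; rewrite !mxE in ci.
  have -> : u ^- 2 * `|x ord0 i| = `|u ^- 2 * x ord0 i| by rewrite normrM (gtr0_norm tt).
  set y := u ^- 2 * x ord0 i in hi *; set z := x0 ord0 i - _ in hi ci.
  by have := ler_normB (y + z) z; rewrite addrK => h3; apply: (le_lt_trans h3); exact: ltr_leD.
have rho0 : 0 < r * u ^+ 3 by rewrite mulr_gt0// exprn_gt0.
(* A point of depth greater than r u^3 in [P] would, after the same contraction, be the centre of a
   ball of radius r u > r inside Omega. *)
have lrho x : exists i, dotr (e i) x + b i <= r * u ^+ 3.
  apply: contrapT => H.
  have {}H i : r * u ^+ 3 < dotr (e i) x + b i.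
    by rewrite ltNge; apply/negP => h; apply: H; exists i.
  have ru : 0 < r * u by rewrite mulr_gt0.
  have : r * u <= r.
    apply: (@le_inradius _ _ Omega (x0 + u ^- 2 *: (x - x0)) _ cO ru) => z zB.
    pose y := x0 + u ^+ 2 *: (z - x0).
    have -> : z = x0 + u ^- 2 *: (y - x0) by apply/rowP => i; rewrite !mxE; field.
    apply: dil => i; have := H i; rewrite lE ltr_pdivlMr// => Hi.
    have -> : y - x0 = (x - x0) + u ^+ 2 *: (z - (x0 + u ^- 2 *: (x - x0))).
      by apply/rowP => j; rewrite !mxE; field.
    rewrite dotrDr dotrZr; set w := z - _.
    have wB : enorm w < r * u by exact: zB.
    have aw : dotr (a i) w <= enorm (a i) * (r * u).
      apply: (le_trans (ler_norm _)); apply: (le_trans (cauchy_schwarz _ _)).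
      by rewrite ler_pM2l// ltW.
    have h2 : u ^+ 2 * dotr (a i) w <= r * u ^+ 3 * enorm (a i).
      have -> : r * u ^+ 3 * enorm (a i) = u ^+ 2 * (enorm (a i) * (r * u)) by ring.
      by rewrite ler_pM2l// exprn_gt0.
    by move: Hi h2; lra.
  by rewrite leNgt ltr_pMr// u1.
have := torsional_rigidity_polytope_le p1 e1 rho0 lrho bP oO OP.
rewrite -/q => H; apply: (le_trans H); apply: ler_wpM2l.
  by rewrite divr_ge0 ?powR_ge0// addr_ge0// ltW.
pose Q : set 'rV[R]_m.+1 := (fun x => u ^- 2 *: x + c) @^-1` Omega.
have A : mu Q = (((u ^+ 2) ^+ m.+1)%:E * mu Omega)%E.
  by rewrite (lebesgue_rV_affine c tt mO) invrK.
have mPre : measurable Q.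
  by rewrite -[X in measurable X]setTI; apply: measurable_rV_affine.
have fO : mu Omega \is a fin_num by rewrite ge0_fin_numE// (lebesgue_rV_bounded mO bO).
have -> : (u ^+ 2) ^+ m.+1 * fine (mu Omega) =
    fine (mu Q).
  by rewrite A fineM ?fin_num_EFin.
have sub : P `<=` Q by move=> x /PO; rewrite cE.
have fA : mu Q \is a fin_num.
  by rewrite A fin_numM ?fin_num_EFin.
have mPP : measurable P.
  rewrite (_ : P = \bigcap_(i in [set: 'I_N]) [set x | 0 < dotr (e i) x + b i]).
    apply: fin_bigcap_measurable => // i _; apply: open_rV_measurable.
    rewrite (_ : [set _ | _] = (fun x => dotr (e i) x + b i) @^-1` [set y | 0 < y]); last by [].
    apply: open_comp; last exact: open_gt.
    move=> x _; apply: continuous_addr; last exact: continuous_const.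
    by apply: continuous_dotr_comp => k; [exact: continuous_const|exact: coord_continuous].
  by apply/seteqP; split => x /= h i => [_|]; [exact: h|exact: (h i Logic.I)].
have le : (mu P <= mu Q)%E by apply: le_measure; rewrite ?inE.
apply: fine_le => //; rewrite ge0_fin_numE//; apply: (le_lt_trans le).
by rewrite -ge0_fin_numE.
Qed.

Lemma torsional_rigidity_inradius_le Omega : convex_domain Omega -> 0 < inradius Omega ->
  torsional_rigidity p Omega <= inradius Omega `^ q / (1 + q) * fine (mu Omega).
Proof.
move=> cO r0; set r := inradius Omega; set T := torsional_rigidity p Omega; set V := fine _.
pose F (u : R) := `|r * u ^+ 3| `^ q / (1 + q) * ((u ^+ 2) ^+ m.+1 * V).
have cF : continuous F.
  have cX k (f : R -> R) : continuous f -> continuous (fun u => f u ^+ k).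
    by move=> cf; apply: (continuous_compr (h := fun t => t ^+ k)) => // t; exact: exprn_continuous.
  have cid : continuous (fun u : R => u) by move=> u; exact: cvg_id.
  apply: continuous_mulr; apply: continuous_mulr; try exact: continuous_const.
    apply: (continuous_compr (continuous_powR_norm q0)).
    by apply: continuous_mulr; [exact: continuous_const|exact: cX].
  by apply: (cX m.+1 (fun u => u ^+ 2)); exact: cX.
have c1 : {for (1 + 0 : R), continuous F} by exact: cF.
have c : F (1 + k.+1%:R^-1) @[k --> \oo] --> F (1 + 0) by exact: (continuous_cvg _ c1 cvg_u).
have F1 : F (1 + 0) = r `^ q / (1 + q) * V.
  by rewrite /F addr0 !expr1n mulr1 mul1r gtr0_norm.
rewrite F1 in c.
have cT : (fun _ : nat => T) @ \oo --> T by exact: cvg_cst.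
apply: (ler_cvg_to cT c); apply: nearW => k.
have u1 : 1 < 1 + k.+1%:R^-1 :> R by rewrite ltrDl invr_gt0.
have := torsional_rigidity_dilation_le cO r0 u1; rewrite /F gtr0_norm//.
by rewrite mulr_gt0// exprn_gt0// (lt_trans ltr01 u1).
Qed.

End sharp_bounds.

(** * Normalized rigidity and the constant gamma *)

Section normalized_rigidity.
Context (R : realType) (p : R) (p1 : 1 < p).
Let q := p / (p - 1).
Let p0 : 0 < p. Proof. exact: lt_trans p1. Qed.
Let pB1 : 0 < p - 1. Proof. by rewrite subr_gt0. Qed.
Let q0 : 0 < q. Proof. by rewrite divr_gt0. Qed.
Let q1 : 1 < q. Proof. by rewrite ltr_pdivlMr// mul1r gtrBl. Qed.

Definition mean_rigidity m (Omega : set 'rV[R]_m.+1) : R :=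
  torsional_rigidity p Omega / fine (lebesgue_rV R m.+1 Omega).

(** Mean torsion of the unit ball in dimension d; for d = 1 it is also the limit of the mean torsion
    of long slabs of half-width 1. *)
Definition ball_constant (d : R) : R := d `^ (1 - q) / (d + q).

Lemma ball_constant_gt0 (d : R) : 0 < d -> 0 < ball_constant d.
Proof. by move=> d0; rewrite divr_gt0 ?powR_gt0// addr_gt0. Qed.

Lemma ball_constant1 : ball_constant 1 = (1 + q)^-1.
Proof. by rewrite /ball_constant powR1 mul1r. Qed.

Lemma mean_rigidity_ge m (Omega : set 'rV[R]_m.+1) (r : R) : 0 < r ->
  convex_domain_inradius r Omega -> r `^ q * ball_constant m.+1%:R <= mean_rigidity Omega.
Proof.
move=> r0 [cO rE]; have V0 := convex_domain_volume cO.
rewrite /mean_rigidity ler_pdivlMr// mulrA -rE.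
by apply: torsional_rigidity_inradius_ge => //; rewrite rE.
Qed.

Lemma mean_rigidity_le m (Omega : set 'rV[R]_m.+1) (r : R) : 0 < r ->
  convex_domain_inradius r Omega -> mean_rigidity Omega <= r `^ q * ball_constant 1.
Proof.
move=> r0 [cO rE]; have V0 := convex_domain_volume cO.
rewrite /mean_rigidity ler_pdivrMr// ball_constant1 -rE.
by apply: torsional_rigidity_inradius_le => //; rewrite rE.
Qed.

Lemma mean_rigidity_ball m (r : R) : 0 < r ->
  mean_rigidity (eball (0 : 'rV[R]_m.+1) r) = r `^ q * ball_constant m.+1%:R.
Proof.
move=> r0; have cB := convex_domain_eball m r0.
apply/eqP; rewrite eq_le (mean_rigidity_ge r0 cB) andbT.
have V0 := convex_domain_volume cB.1.
by rewrite /mean_rigidity ler_pdivrMr// /ball_constant mulrA; exact: torsional_rigidity_ball_le.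
Qed.

Lemma mean_rigidity_gt0 m (Omega : set 'rV[R]_m.+1) (r : R) : 0 < r ->
  convex_domain_inradius r Omega -> 0 < mean_rigidity Omega.
Proof.
move=> r0 H; apply: lt_le_trans (mean_rigidity_ge r0 H).
by rewrite mulr_gt0 ?powR_gt0// ball_constant_gt0.
Qed.

(** Written as a power p - 1 > 0 of an inverse, so that monotonicity and continuity of positive
    powers apply. *)
Lemma normalizedE m (Omega : set 'rV[R]_m.+1) (r : R) : 0 < r ->
  convex_domain_inradius r Omega ->
  normalized_torsional_rigidity p Omega = (mean_rigidity Omega)^-1 `^ (p - 1).
Proof.
move=> r0 H; have t0 := mean_rigidity_gt0 r0 H; have V0 := convex_domain_volume H.1.
have T0 : 0 < torsional_rigidity p Omega.
  by move: t0; rewrite /mean_rigidity pmulr_lgt0 ?invr_gt0.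
rewrite /normalized_torsional_rigidity /mean_rigidity invfM invrK mulrC.
rewrite powRM ?invr_ge0 ?ltW//; congr (_ * _).
by rewrite -[X in _ = X `^ _](powR_inv1 (ltW T0)) -powRrM mulN1r opprB.
Qed.

Lemma normalized_le m n (A : set 'rV[R]_m.+1) (B : set 'rV[R]_n.+1) (a b : R) : 0 < a -> 0 < b ->
  convex_domain_inradius a A -> convex_domain_inradius b B ->
  (normalized_torsional_rigidity p B <= normalized_torsional_rigidity p A) =
  (mean_rigidity A <= mean_rigidity B).
Proof.
move=> a0 b0 HA HB; rewrite (normalizedE a0 HA) (normalizedE b0 HB).
have A0 := mean_rigidity_gt0 a0 HA; have B0 := mean_rigidity_gt0 b0 HB.
have -> : (mean_rigidity A <= mean_rigidity B) = ((mean_rigidity B)^-1 <= (mean_rigidity A)^-1).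
  by rewrite lef_pV2 ?posrE.
have Ai : 0 <= (mean_rigidity A)^-1 by rewrite invr_ge0 ltW.
have Bi : 0 <= (mean_rigidity B)^-1 by rewrite invr_ge0 ltW.
apply/idP/idP => [|h].
  by apply: contraTT; rewrite -!ltNge => h; apply: (gt0_ltr_powR pB1); rewrite ?nnegrE.
by apply: (ge0_ler_powR (ltW pB1)); rewrite ?nnegrE.
Qed.

(** The exponents -1/p of the definition and 1 - p of the normalization multiply to (p-1)/p =
    1/q. *)
Let gamma_powR (m : nat) : 0 < torsion_gamma m.+1 p :> R /\
  (torsion_gamma m.+1 p : R) `^ q = ball_constant m.+1%:R / ball_constant 1.
Proof.
pose c := ball_constant m.+1%:R; pose c1 := ball_constant 1.
have c0 : 0 < c by exact: ball_constant_gt0.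
have c10 : 0 < c1 by exact: ball_constant_gt0.
have E n : normalized_torsional_rigidity p (eball (0 : 'rV[R]_n.+1) 1) =
    (ball_constant n.+1%:R)^-1 `^ (p - 1).
  by rewrite (normalizedE ltr01 (convex_domain_eball n ltr01)) mean_rigidity_ball// powR1 mul1r.
have g : torsion_gamma m.+1 p = (c / c1) `^ ((p - 1) / p).
  rewrite /torsion_gamma !E -/c -/c1.
  have -> : c^-1 `^ (p - 1) / c1^-1 `^ (p - 1) = (c / c1) `^ (1 - p).
    have I (x s : R) : 0 < x -> x^-1 `^ s = x `^ (- s).
      by move=> x0; rewrite -[x^-1](powR_inv1 (ltW x0)) -powRrM mulN1r.
    rewrite (I _ _ c0) (I _ _ c10) -powRN powRM ?invr_ge0 ?(ltW c0) ?(ltW c10)// (I _ _ c10).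
    by congr (_ `^ _ * _ `^ _); ring.
  by rewrite -powRrM; congr (_ `^ _); rewrite mulrN -mulNr opprB.
have cc : 0 < c / c1 by rewrite divr_gt0.
have pq : (p - 1) / p * q = 1 by rewrite /q; field; rewrite !gt_eqF.
by rewrite g; split; [rewrite powR_gt0|rewrite -powRrM pq powRr1// ltW].
Qed.

Lemma gamma_gt0 (m : nat) : 0 < torsion_gamma m.+1 p :> R.
Proof. by have [] := gamma_powR m. Qed.

Lemma gamma_powRE (m : nat) (b : R) : 0 < b ->
  (torsion_gamma m.+1 p * b) `^ q * ball_constant 1 = b `^ q * ball_constant m.+1%:R.
Proof.
move=> b0; have [g0 gE] := gamma_powR m.
rewrite powRM ?ltW// gE mulrAC divfK ?gt_eqF ?ball_constant_gt0//.
by rewrite mulrC.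
Qed.

Lemma mean_rigidity_slabs m (a : R) : 0 < a -> exists omega : nat -> set 'rV[R]_m.+1,
  (forall n, convex_domain_inradius a (omega n)) /\
  mean_rigidity (omega n) @[n --> \oo] --> a `^ q * ball_constant 1.
Proof.
(* The factor n + 2 keeps L strictly above a, so the inradius is a, and gives (L - a)/L = 1 -
   1/(n+2). *)
move=> a0; pose L (n : nat) := a * n.+2%:R.
have aL n : a < L n by rewrite ltr_pMr// ltr1n.
exists (fun n => slab a (L n)); have HS n := convex_domain_slab m a0 (aL n); split => //.
pose kap (n : nat) : R := (1 - n.+2%:R^-1) ^+ m.
pose low (y : R) := a `^ q * (y ^+ m / (1 + q) - (q - 1) * (1 - y ^+ m)).
have cX : continuous (fun y : R => y ^+ m) by move=> y; exact: exprn_continuous.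
have clow : continuous low.
  have c1 : continuous (fun _ : R => (1 + q)^-1) by exact: continuous_const.
  have c2 : continuous (fun _ : R => q - 1) by exact: continuous_const.
  have c3 : continuous (fun _ : R => a `^ q) by exact: continuous_const.
  have c4 : continuous (fun _ : R => 1 : R) by exact: continuous_const.
  apply: (continuous_mulr c3); apply: continuous_addr; first exact: continuous_mulr.
  apply: continuous_oppr; apply: (continuous_mulr c2); apply: (continuous_addr c4).
  exact: continuous_oppr.
have cy : 1 - n.+2%:R^-1 @[n --> \oo] --> (1 - 0 : R).
  apply: cvgB; first exact: cvg_cst.
  by have := @cvg_harmonic R; rewrite -cvg_shiftS.
have cl1 : {for (1 - 0 : R), continuous low} by exact: clow.
have cl : low (1 - n.+2%:R^-1) @[n --> \oo] --> low (1 - 0) by exact: (continuous_cvg _ cl1 cy).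
have E : low (1 - 0) = a `^ q * ball_constant 1.
  by rewrite /low subr0 expr1n subrr mulr0 subr0 mul1r ball_constant1.
rewrite E in cl.
have cu : (fun _ : nat => a `^ q * ball_constant 1) @ \oo --> a `^ q * ball_constant 1 by exact: cvg_cst.
apply: (squeeze_cvgr _ cl cu); apply: nearW => n; rewrite (mean_rigidity_le a0 (HS n)) andbT.
have V0 := convex_domain_volume (HS n).1.
rewrite /mean_rigidity ler_pdivlMr//.
have := torsional_rigidity_slab_ge p1 m a0 (aL n); rewrite -/q /low.
have -> : (L n - a) / L n = 1 - n.+2%:R^-1; last by [].
have : n.+2%:R != 0 :> R by rewrite pnatr_eq0.
by rewrite /L; move: (n.+2%:R) => y y0; field; rewrite y0 gt_eqF.
Qed.

Lemma normalized_cvg m (omega : nat -> set 'rV[R]_m.+1) (B : set 'rV[R]_m.+1) (a b : R) :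
  0 < a -> 0 < b -> (forall n, convex_domain_inradius a (omega n)) ->
  convex_domain_inradius b B ->
  mean_rigidity (omega n) @[n --> \oo] --> mean_rigidity B ->
  normalized_torsional_rigidity p (omega n) @[n --> \oo] --> normalized_torsional_rigidity p B.
Proof.
move=> a0 b0 Ho HB H; have B0 := mean_rigidity_gt0 b0 HB.
have Bi : 0 < (mean_rigidity B)^-1 by rewrite invr_gt0.
have cV : (mean_rigidity (omega n))^-1 @[n --> \oo] --> (mean_rigidity B)^-1.
  by apply: cvgV => //; rewrite gt_eqF.
have c1 : {for (mean_rigidity B)^-1, continuous (fun t : R => `|t| `^ (p - 1))}.
  exact: continuous_powR_norm.
have := continuous_cvg _ c1 cV; rewrite (gtr0_norm Bi) -(normalizedE b0 HB).
rewrite (_ : (fun n => normalized_torsional_rigidity p (omega n)) =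
  (fun n => `|(mean_rigidity (omega n))^-1| `^ (p - 1))); first exact.
apply/funext => n; rewrite (normalizedE a0 (Ho n)) gtr0_norm// invr_gt0.
exact: mean_rigidity_gt0 a0 (Ho n).
Qed.

Lemma ltr_powR_q (x y : R) : 0 <= x -> 0 <= y -> (x `^ q < y `^ q) = (x < y).
Proof.
move=> x0 y0; apply/idP/idP => [|h]; last by apply: gt0_ltr_powR; rewrite ?nnegrE.
by apply: contraTT; rewrite -!leNgt => h; apply: ge0_ler_powR; rewrite ?nnegrE ?(ltW q0).
Qed.

End normalized_rigidity.

Theorem theorem2 (R : realType) (D : nat) (p a b : R)
    (hD : (2 <= D)%N) (hp : 1 < p) (ha : 0 < a) (hab : a < b) :
  [/\ 0 < torsion_gamma D p,
      (forall Omega_a Omega_b : set 'rV[R]_D,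
         convex_domain_inradius a Omega_a -> convex_domain_inradius b Omega_b ->
         normalized_torsional_rigidity p Omega_b
           <= normalized_torsional_rigidity p Omega_a)
      <-> torsion_gamma D p * b >= a,
      torsion_gamma D p * b > a ->
        forall Omega_a Omega_b : set 'rV[R]_D,
          convex_domain_inradius a Omega_a -> convex_domain_inradius b Omega_b ->
          normalized_torsional_rigidity p Omega_b
            < normalized_torsional_rigidity p Omega_a
    & torsion_gamma D p * b = a ->
        exists omega : nat -> set 'rV[R]_D,
          (forall n, convex_domain_inradius a (omega n)) /\
          normalized_torsional_rigidity p (omega n) @[n --> \oo] -->
            normalized_torsional_rigidity p (eball (0 : 'rV[R]_D) b)].
Proof.
case: D hD => [//|m] _; have b0 : 0 < b by exact: lt_trans hab.
set q := p / (p - 1).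
have g0 := gamma_gt0 hp m; have gb0 : 0 <= torsion_gamma m.+1 p * b by rewrite mulr_ge0// ltW.
have gE := gamma_powRE hp m b0.
have c10 := ball_constant_gt0 hp (ltr01 : 0 < 1 :> R).
have HB := convex_domain_eball m b0.
have BE := mean_rigidity_ball hp m b0.
have [omega [Ho co]] := mean_rigidity_slabs hp m ha.
have le_gamma : (a `^ q * ball_constant p 1 <= b `^ q * ball_constant p m.+1%:R) =
    (a <= torsion_gamma m.+1 p * b).
  by rewrite -gE ler_pM2r// leNgt ltr_powR_q// ?(ltW ha)// -leNgt.
have lt_gamma : (a `^ q * ball_constant p 1 < b `^ q * ball_constant p m.+1%:R) =
    (a < torsion_gamma m.+1 p * b).
  by rewrite -gE ltr_pM2r// ltr_powR_q// ltW.
split => //.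
- split=> [H|agb Oa Ob HOa HOb].
    (* Necessity: the ball of radius b, of least mean torsion, is compared with slabs of inradius a,
       whose mean torsion tends to the largest value. *)
    rewrite -le_gamma -BE; apply: (ler_cvg_to co (cvg_cst _)); apply: nearW => n.
    by rewrite -(normalized_le hp ha b0 (Ho n) HB); exact: H.
  rewrite (normalized_le hp ha b0 HOa HOb).
  apply: (le_trans (mean_rigidity_le hp ha HOa)); apply: le_trans (mean_rigidity_ge hp b0 HOb).
  by rewrite le_gamma.
- move=> agb Oa Ob HOa HOb.
  (* The strict comparison is the negation of the weak one with the two domains exchanged. *)
  rewrite ltNge (normalized_le hp b0 ha HOb HOa) -ltNge.
  apply: (le_lt_trans (mean_rigidity_le hp ha HOa)); apply: lt_le_trans (mean_rigidity_ge hp b0 HOb).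
  by rewrite lt_gamma.
- move=> agb; exists omega; split => //.
  apply: (normalized_cvg hp ha b0 Ho HB); rewrite BE -gE agb; exact: co.
Qed.
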